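(* Let $G(\mathbb R)_0$ be the Cartan motion group of a connected noncompact real reductive group, and let $V$ be a $(\mathfrak g_0,K)$-module in the Dirac series of $G(\mathbb R)_0$. Then the isomorphism class of $V$ is completely determined by its Dirac cohomology $H_{D_0}(V)$ as a $\widetilde K$-module: if $V$ and $V'$ are two $(\mathfrak g_0,K)$-modules in the Dirac series of $G(\mathbb R)_0$ such that $H_{D_0}(V)\cong H_{D_0}(V')$ as $\widetilde K$-modules, then $V\cong V'$ as $(\mathfrak g_0,K)$-modules.
   Context: Setting. $G$ is a connected complex reductive algebraic group with an antiholomorphic involution $\sigma$ such that $G(\mathbb R):=G^\sigma$ is connected and noncompact; $\theta$ is a corresponding Cartan involution of $G$ (commuting with $\sigma$); $K:=G^\theta$ is a complex reductive algebraic group and $K(\mathbb R):=K^\sigma$ is a maximal compact subgroup of $G(\mathbb R)$ with complexification $K$. Put $\mathfrak g=\mathrm{Lie}(G)$, $\mathfrak k=\mathrm{Lie}(K)$, and let $\mathfrak p$ be the $(-1)$-eigenspace of $\theta$ on $\mathfrak g$; then $\mathfrak g=\mathfrak k\oplus\mathfrak p$, with real forms $\mathfrak g^\sigma=\mathfrak k^\sigma\oplus\mathfrak p^\sigma$. The Cartan motion group is $G(\mathbb R)_0=\mathfrak p^\sigma\rtimes K(\mathbb R)$ (restricted adjoint action). Its complexified Lie algebra is $\mathfrak g_0=\mathfrak k\oplus\mathfrak p_0$ with $\mathfrak p_0=\mathfrak p$ as a $K$-module and bracket $[X_1+Y_1,X_2+Y_2]_0=[Y_1,X_2]+[X_1,Y_2]+[Y_1,Y_2]$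 for $X_i\in\mathfrak p$, $Y_i\in\mathfrak k$ (so $\mathfrak p_0$ is an abelian ideal); $\mathfrak p_0^\sigma=\mathfrak p^\sigma$ and $\mathfrak g_0^\sigma=\mathfrak k^\sigma\oplus\mathfrak p_0^\sigma$. Form. Fix a symmetric bilinear form $\beta$ on $\mathfrak g$ which restricts to the Killing form on $[\mathfrak g,\mathfrak g]$, is positive definite on $\mathfrak p^\sigma$ and negative definite on $\mathfrak k^\sigma$, and is $\theta$-, $K$- and $\mathfrak g$-invariant. Put $\beta_0=\beta|_{\mathfrak p_0\times\mathfrak p_0}$. Clifford algebra and Dirac operator. $\operatorname{Cl}(\mathfrak p_0,\beta_0)$ is the quotient of the tensor algebra $T(\mathfrak p_0)$ by the two-sided ideal generated by $X\otimes Y+Y\otimes X-\beta_0(X,Y)$; $\gamma_0:\mathfrak p_0\to\operatorname{Cl}(\mathfrak p_0,\beta_0)$ is the canonical embedding. $A_0=\mathcal U(\mathfrak g_0)\otimes_{\mathbb C}\operatorname{Cl}(\mathfrak p_0,\beta_0)$. The Dirac operator is $D_0=\sum_i e_i\otimes\gamma_0(e_i')\in A_0$, for any basis $\{e_i\}$ of $\mathfrak p_0$ with $\beta_0$-dual basis $\{e_i'\}$ (independent of the choice). Spin module and spin double cover. $S_0$ is a fixed simple $\operatorname{Cl}(\mathfrak p_0,\beta_0)$-module, realized on $\bigwedge\mathfrak p_0^-$ with $\mathfrak p_0^-\subset\mathfrak p_0$ a maximal isotropic subspace. The spin double cover $\mathcal C:\widetilde K\to K$ is the pullback of the double cover $\operatorname{Spin}(\mathfrak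 p_0,\beta_0)\to SO(\mathfrak p_0,\beta_0)$ along $\operatorname{Ad}:K\to SO(\mathfrak p_0,\beta_0)$, where $\operatorname{Spin}(\mathfrak p_0,\beta_0)\subset\operatorname{Cl}(\mathfrak p_0,\beta_0)^\times$ consists of products of an even number of elements $\gamma_0(v)$ with $\gamma_0(v)^2=1$. $\widetilde K$ acts on $S_0$ through its projection to $\operatorname{Spin}(\mathfrak p_0,\beta_0)$ and the Clifford action. Modules and Dirac cohomology. A $(\mathfrak g_0,K)$-module is a complex vector space with a Lie algebra action of $\mathfrak g_0$ and a locally finite algebraic action of $K$ that are compatible in the usual sense. It is infinitesimally unitary if it carries a positive-definite Hermitian inner product for which $K(\mathbb R)$ acts unitarily and $\mathfrak g_0^\sigma$ acts by skew-Hermitian operators. For a $(\mathfrak g_0,K)$-module $V$, $A_0$ acts on $V\otimes_{\mathbb C}S_0$ factorwise and $\widetilde K$ acts by the tensor product action (through $\mathcal C$ on $V$); $D_0(V)$ denotes the ($\widetilde K$-equivariant) operator by which $D_0$ acts, and the Dirac cohomology is the $\widetilde K$-module $H_{D_0}(V)=\ker D_0(V)/(\ker D_0(V)\cap\operatorname{im}D_0(V))$. The Dirac series of $G(\mathbb R)_0$ is the set of equivalence classes of irreducible infinitesimally unitary $(\mathfrak g_0,K)$-modules $V$ with $H_{D_0}(V)\ne0$. *)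

(* Defs.v *)
From HB Require Import structures.
From mathcomp Require Import all_boot all_order all_algebra.
From mathcomp Require Import ring_quotient generic_quotient complex.
From mathcomp Require Import all_classical all_reals all_analysis.

Set Implicit Arguments.
Unset Strict Implicit.
Unset Printing Implicit Defensive.

Import Order.TTheory GRing.Theory Num.Theory.
Import numFieldNormedType.Exports.

Local Open Scope classical_set_scope.
Local Open Scope ring_scope.
Local Open Scope quotient_scope.

(* MathComp-Analysis puts the topology of the modulus only on the alias
   (R[i])^o. *)
Set Warnings "-redundant-canonical-projection".
HB.instance Definition _ (R : rcfType) := NormedModule.copy R[i] (R[i])^o.

(** * Quotients of the tensor algebra *)

Section TensorQuotient.
Context (F : fieldType) (V : lmodType F).

(* Noncommutative polynomial expressions in the vectors of V. *)
Inductive texpr : Type :=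
| TScal of F
| TVect of V
| TAdd of texpr & texpr
| TMul of texpr & texpr.

HB.instance Definition _ := gen_eqMixin texpr.
HB.instance Definition _ := gen_choiceMixin texpr.

Context (rel : texpr -> texpr -> Prop).

(* Without [TRel], the classes of this congruence form T(V): the algebra laws
   hold, and V -> T(V) is linear.  [TRel] adds the two-sided ideal generated by
   all the x - y with rel x y. *)
Inductive teq : texpr -> texpr -> Prop :=
| TRefl x : teq x x
| TSym x y : teq x y -> teq y x
| TTrans x y z : teq x y -> teq y z -> teq x z
| TCongAdd x x' y y' : teq x x' -> teq y y' -> teq (TAdd x y) (TAdd x' y')
| TCongMul x x' y y' : teq x x' -> teq y y' -> teq (TMul x y) (TMul x' y')
| TAddA x y z : teq (TAdd x (TAdd y z)) (TAdd (TAdd x y) z)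
| TAddC x y : teq (TAdd x y) (TAdd y x)
| TAdd0 x : teq (TAdd (TScal 0) x) x
| TMul0 x : teq (TMul (TScal 0) x) (TScal 0)
| TMulA x y z : teq (TMul x (TMul y z)) (TMul (TMul x y) z)
| TMul1 x : teq (TMul (TScal 1) x) x
| TMulDl x y z : teq (TMul (TAdd x y) z) (TAdd (TMul x z) (TMul y z))
| TMulDr x y z : teq (TMul x (TAdd y z)) (TAdd (TMul x y) (TMul x z))
| TScalD a b : teq (TScal (a + b)) (TAdd (TScal a) (TScal b))
| TScalM a b : teq (TScal (a * b)) (TMul (TScal a) (TScal b))
| TScalC a x : teq (TMul (TScal a) x) (TMul x (TScal a))
| TVectP a u v :
    teq (TVect (a *: u + v)) (TAdd (TMul (TScal a) (TVect u)) (TVect v))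
| TRel x y : rel x y -> teq x y.

Definition teqb (x y : texpr) : bool := `[< teq x y >].

Lemma teqb_equiv : equiv_class_of teqb.
Proof.
split=> [x|x y|y x z].
- by apply/asboolP/TRefl.
- by apply/asboolP/asboolP => /TSym.
- by move=> /asboolP xy /asboolP yz; apply/asboolP/(TTrans xy yz).
Qed.

Canonical teqb_equivRel := EquivRelPack teqb_equiv.
Canonical teqb_encModRel := defaultEncModRel teqb.

Definition tquot := {eq_quot teqb}.
HB.instance Definition _ := EqQuotient.on tquot.
HB.instance Definition _ := Choice.on tquot.

Lemma tquotP x y : \pi_tquot x = \pi_tquot y <-> teq x y.
Proof.
split=> [/eqP|xy]; first by rewrite piE => /asboolP.
by apply/eqP; rewrite piE; apply/asboolP.
Qed.

Definition tcst (a : F) : tquot := \pi_tquot (TScal a).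
Definition tadd := lift_op2 tquot TAdd.
Definition tmul := lift_op2 tquot TMul.
Definition topp (x : tquot) : tquot := tmul (tcst (-1)) x.
Definition tgen (v : V) : tquot := \pi_tquot (TVect v).

Lemma teq_repr x : teq (repr (\pi_tquot x)) x.
Proof. by apply/tquotP; rewrite reprK. Qed.

Lemma taddE x y : tadd (\pi_tquot x) (\pi_tquot y) = \pi_tquot (TAdd x y).
Proof. by unlock tadd; apply/tquotP; apply: TCongAdd; exact: teq_repr. Qed.

Lemma tmulE x y : tmul (\pi_tquot x) (\pi_tquot y) = \pi_tquot (TMul x y).
Proof. by unlock tmul; apply/tquotP; apply: TCongMul; exact: teq_repr. Qed.

Let tE := (taddE, tmulE).

Lemma taddA : associative tadd.
Proof.
by move=> x y z; rewrite -[x]reprK -[y]reprK -[z]reprK !tE; apply/tquotP; apply: TAddA.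
Qed.

Lemma taddC : commutative tadd.
Proof. by move=> x y; rewrite -[x]reprK -[y]reprK !tE; apply/tquotP; apply: TAddC. Qed.

Lemma tadd0 : left_id (tcst 0) tadd.
Proof. by move=> x; rewrite -[x]reprK /tcst tE; apply/tquotP; apply: TAdd0. Qed.

Lemma tmulA : associative tmul.
Proof.
by move=> x y z; rewrite -[x]reprK -[y]reprK -[z]reprK !tE; apply/tquotP; apply: TMulA.
Qed.

Lemma tmul1 : left_id (tcst 1) tmul.
Proof. by move=> x; rewrite -[x]reprK /tcst tE; apply/tquotP; apply: TMul1. Qed.

Lemma tcstC a x : tmul (tcst a) x = tmul x (tcst a).
Proof. by rewrite -[x]reprK /tcst !tE; apply/tquotP; apply: TScalC. Qed.

Lemma tmul1r : right_id (tcst 1) tmul.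
Proof. by move=> x; rewrite -tcstC tmul1. Qed.

Lemma tmulDl : left_distributive tmul tadd.
Proof.
by move=> x y z; rewrite -[x]reprK -[y]reprK -[z]reprK !tE; apply/tquotP; apply: TMulDl.
Qed.

Lemma tmulDr : right_distributive tmul tadd.
Proof.
by move=> x y z; rewrite -[x]reprK -[y]reprK -[z]reprK !tE; apply/tquotP; apply: TMulDr.
Qed.

Lemma tcstD a b : tcst (a + b) = tadd (tcst a) (tcst b).
Proof. by rewrite /tcst tE; apply/tquotP; apply: TScalD. Qed.

Lemma tcstM a b : tcst (a * b) = tmul (tcst a) (tcst b).
Proof. by rewrite /tcst tE; apply/tquotP; apply: TScalM. Qed.

Lemma taddN : left_inverse (tcst 0) topp tadd.
Proof.
move=> x; rewrite -[X in tadd _ X]tmul1 /topp -tmulDl -tcstD addNr.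
by rewrite -[x]reprK /tcst tE; apply/tquotP; apply: TMul0.
Qed.

HB.instance Definition _ := GRing.isPzRing.Build tquot
  taddA taddC tadd0 taddN tmulA tmul1 tmul1r tmulDl tmulDr.

HB.instance Definition _ := GRing.Zmodule_isLmodule.Build F tquot
  (fun a b x => etrans (tmulA (tcst a) (tcst b) x)
                       (congr1 (tmul^~ x) (esym (tcstM a b))))
  tmul1 (fun a => tmulDr (tcst a))
  (fun x a b => etrans (congr1 (tmul^~ x) (tcstD a b))
                       (tmulDl (tcst a) (tcst b) x)).

End TensorQuotient.

(* u (x) v + v (x) u = b(u, v): the normalization without the factor 2. *)
Inductive clifford_rel (F : fieldType) (V : lmodType F) (b : V -> V -> F) :
    texpr V -> texpr V -> Prop :=
| CliffordRel u v :
    clifford_rel b (TAdd (TMul (TVect u) (TVect v)) (TMul (TVect v) (TVect u)))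
                   (TScal V (b u v)).

Definition clifford (F : fieldType) (V : lmodType F) (b : V -> V -> F) :=
  tquot (clifford_rel b).
HB.instance Definition _ (F : fieldType) (V : lmodType F) (b : V -> V -> F) :=
  GRing.PzRing.on (clifford b).
HB.instance Definition _ (F : fieldType) (V : lmodType F) (b : V -> V -> F) :=
  GRing.Lmodule.on (clifford b).

Definition cliff_gamma (F : fieldType) (V : lmodType F) (b : V -> V -> F)
  (v : V) : clifford b := tgen (clifford_rel b) v.

Lemma cliff_gamma_linear (F : fieldType) (V : lmodType F) (b : V -> V -> F) :
  linear (@cliff_gamma F V b).
Proof.
move=> a u v; rewrite -[RHS]/(tadd (tmul (tcst _ a) (tgen _ u)) (tgen _ v)).
by rewrite /tcst /tgen tmulE taddE; apply/tquotP; apply: TVectP.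
Qed.
HB.instance Definition _ (F : fieldType) (V : lmodType F) (b : V -> V -> F) :=
  GRing.isLinear.Build F V (clifford b) *:%R (@cliff_gamma F V b)
    (@cliff_gamma_linear F V b).

Lemma cliff_gammaP (F : fieldType) (V : lmodType F) (b : V -> V -> F) u v :
  cliff_gamma b u * cliff_gamma b v + cliff_gamma b v * cliff_gamma b u
  = b u v *: (1 : clifford b).
Proof.
rewrite -[LHS]/(tadd (tmul (tgen _ u) (tgen _ v)) (tmul (tgen _ v) (tgen _ u))).
rewrite -[RHS]/(tmul (tcst _ (b u v)) (tcst _ 1)) -tcstM mulr1.
by rewrite /tcst /tgen !tmulE taddE; apply/tquotP; apply: TRel.
Qed.

Record clifford_module (F : fieldType) (V : lmodType F) (b : V -> V -> F)
    (m : nat) := CliffordModule {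
  cliff_act :> {rmorphism clifford b -> 'M[F]_m};
  cliff_actZ : scalable cliff_act
}.

(* The module is the space 'cV_m; a simple Clifford module is finite dimensional, as V is
   in all uses. *)
Definition simple_clifford_module (F : fieldType) (V : lmodType F)
    (b : V -> V -> F) (m : nat) (S : clifford_module b m) : Prop :=
  (0 < m)%N /\
  forall U : {vspace 'cV[F]_m},
    (forall x s, s \in U -> S x *m s \in U) -> U = 0%VS \/ U = fullv.

Definition spin_group (F : fieldType) (V : lmodType F) (b : V -> V -> F) :
    set (clifford b) :=
  [set a | exists vs : seq V,
    [/\ ~~ odd (size vs),
        forall v, v \in vs -> cliff_gamma b v * cliff_gamma b v = 1
      & a = \prod_(v <- vs) cliff_gamma b v]].

(** * ker D / (ker D /\ im D) *)

Section LmodQuotient.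
Context (F : fieldType) (U : lmodType F) (I : {pred U}).
Context (I_closed : submod_closed I).

Definition submod_pred of submod_closed I : {pred U} := I.
HB.instance Definition _ :=
  GRing.isSubmodClosed.Build F U (submod_pred I_closed) I_closed.

Definition lmod_quot := Quotient.quot (submod_pred I_closed).
HB.instance Definition _ := GRing.Zmodule.on lmod_quot.
HB.instance Definition _ := EqQuotient.on lmod_quot.

Definition lq_scale (a : F) := lift_op1 lmod_quot ( *:%R a).

Lemma lq_eqP (x y : U) : \pi_lmod_quot x = \pi_lmod_quot y <-> x - y \in I.
Proof.
rewrite -[_ \in I]/(_ \in submod_pred I_closed) Quotient.idealrBE.
by split=> [->|/eqP].
Qed.

Lemma lq_scaleE a (x : U) : lq_scale a (\pi_lmod_quot x) = \pi_lmod_quot (a *: x).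
Proof.
unlock lq_scale; apply/lq_eqP; rewrite -scalerBr -[_ \in I]/(_ \in submod_pred I_closed) rpredZ //.
by apply/lq_eqP; rewrite reprK.
Qed.

Lemma lq_addE (x y : U) :
  \pi_lmod_quot x + \pi_lmod_quot y = \pi_lmod_quot (x + y) :> lmod_quot.
Proof. exact/esym/(Quotient.pi_add (submod_pred I_closed)). Qed.

Lemma lq_scaleA a b q : lq_scale a (lq_scale b q) = lq_scale (a * b) q.
Proof. by rewrite -[q]reprK !lq_scaleE scalerA. Qed.

Lemma lq_scale1 : left_id 1 lq_scale.
Proof. by move=> q; rewrite -[q]reprK lq_scaleE scale1r. Qed.

Lemma lq_scaleDr : right_distributive lq_scale +%R.
Proof.
by move=> a p q; rewrite -[p]reprK -[q]reprK lq_addE !lq_scaleE lq_addE scalerDr.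
Qed.

Lemma lq_scaleDl q : {morph lq_scale^~ q : a b / a + b}.
Proof. by move=> a b; rewrite -[q]reprK !lq_scaleE lq_addE scalerDl. Qed.

HB.instance Definition _ := GRing.Zmodule_isLmodule.Build F lmod_quot
  lq_scaleA lq_scale1 lq_scaleDr lq_scaleDl.

End LmodQuotient.

Section KerModIm.
Context (F : fieldType) (W : lmodType F) (D : {linear W -> W}).

Definition ker_pred : {pred W} := [pred x | D x == 0].

Lemma ker_pred_closed : submod_closed ker_pred.
Proof.
split=> [|a x y]; rewrite !inE ?linear0// => /eqP x0 /eqP y0.
by rewrite linearP x0 y0 scaler0 addr0.
Qed.
HB.instance Definition _ := GRing.isSubmodClosed.Build F W ker_pred
  ker_pred_closed.

Definition ker_type := {x : W | x \in ker_pred}.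
HB.instance Definition _ := SubChoice.on ker_type.
HB.instance Definition _ := [SubChoice_isSubLmodule of ker_type by <:].

Definition ker_im : {pred ker_type} := fun x => `[< exists y, D y = val x >].

Lemma ker_im_closed : submod_closed ker_im.
Proof.
split=> [|a x y].
  by apply/asboolP; exists 0; rewrite !linear0.
move=> /asboolP[x' xE] /asboolP[y' yE]; apply/asboolP.
by exists (a *: x' + y'); rewrite !linearP xE yE.
Qed.

Definition ker_mod_im := lmod_quot ker_im_closed.

(* The operator induced by an f that preserves ker D and im D; the default value
   of [insubd] is never reached for such an f. *)
Definition ker_mod_im_map (f : W -> W) (q : ker_mod_im) :
    ker_mod_im :=
  \pi_ker_mod_im (insubd (0 : ker_type) (f (val (repr q)))).

End KerModIm.

(** * Linear algebraic groups over the complex numbers *)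

(* Connectedness and compactness refer to the metric topology of the matrices;
   for complex algebraic groups, connectedness is the same in the Zariski
   topology.  GL_(n+1) has matrices of size n.+1, so that they form a nonzero
   ring. *)

Section AlgebraicGroups.
Context (R : realType) (n : nat).
Local Notation C := R[i].
Local Notation M := 'M[C]_n.+1.

(* The regular functions on GL_(n+1). *)
Inductive regular_fun : (M -> C) -> Prop :=
| RegCst c : regular_fun (fun=> c)
| RegCoef i j : regular_fun (fun g => g i j)
| RegDetV : regular_fun (fun g => (\det g)^-1)
| RegAdd f h : regular_fun f -> regular_fun h ->
    regular_fun (fun g => f g + h g)
| RegMul f h : regular_fun f -> regular_fun h ->
    regular_fun (fun g => f g * h g).

Definition regular_on (H : set M) (f : M -> C) : Prop :=
  exists2 f0, regular_fun f0 & forall g, H g -> f g = f0 g.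

Definition zariski_closed (H : set M) : Prop :=
  exists2 I : set (M -> C), I `<=` regular_fun &
    H = [set g | g \in unitmx /\ forall f, I f -> f g = 0].

Definition algebraic_subgroup (H : set M) : Prop :=
  [/\ zariski_closed H, H 1,
      forall g h, H g -> H h -> H (g * h) & forall g, H g -> H g^-1].

Definition unipotent (g : M) : Prop := exists k, (g - 1) ^+ k = 0.

(* The unipotent radical is trivial. *)
Definition reductive (G : set M) : Prop :=
  forall N, algebraic_subgroup N -> connected N -> N `<=` G ->
    (forall g h, G g -> N h -> N (g * h * g^-1)) ->
    (forall h, N h -> unipotent h) ->
    N = [set 1].

Definition group_involution (G : set M) (phi : M -> M) : Prop :=
  [/\ forall g, G g -> G (phi g),
      forall g h, G g -> G h -> phi (g * h) = phi g * phi h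
    & forall g, G g -> phi (phi g) = g].

Definition fixed (G : set M) (phi : M -> M) : set M :=
  [set g | G g /\ phi g = g].

(* G is a closed complex submanifold of GL_(n+1), so that a holomorphic map on G
   is locally the restriction of a holomorphic map on an open set of matrices.
   [differentiable] is over the field C, i.e. complex differentiability. *)
Definition antiholomorphic_on (G : set M) (phi : M -> M) : Prop :=
  forall g, G g -> exists F : M -> M, \forall x \near g,
    differentiable F x /\ (G x -> phi x = map_mx Num.conj (F x)).

(** * Lie algebras *)

Definition expm (X : M) : M :=
  lim (series (fun k : nat => (k`!%:R)^-1 *: X ^+ k) @ \oo).

Definition lie_of (H : set M) : set M :=
  [set X | forall t : R, H (expm ((t%:C)%C *: X))].

(* d phi (X) = Y, for a smooth homomorphism phi. *)
Definition differential (phi : M -> M) (X Y : M) : Prop :=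
  forall t : R, phi (expm ((t%:C)%C *: X)) = expm ((t%:C)%C *: Y).

Definition lieb (X Y : M) : M := X * Y - Y * X.

(* For subalgebras L. *)
Definition derived_algebra (L : {vspace M}) : {vspace M} :=
  <<[seq lieb X Y | X <- vbasis L, Y <- vbasis L]>>%VS.

Definition killing_form (L : {vspace M}) (X Y : M) : C :=
  \sum_(i < \dim L) coord (vbasis L) i (lieb X (lieb Y (vbasis L)`_i)).

(* For g that normalizes L; [vsproj L] only retypes an element of L. *)
Definition Ad (L : {vspace M}) (g : M) (X : subvs_of L) : subvs_of L :=
  vsproj L (g * vsval X * g^-1).

End AlgebraicGroups.

(** * The Cartan motion group *)

Section MotionGroup.
Context (R : realType) (n : nat).
Local Notation C := R[i].
Local Notation M := 'M[C]_n.+1.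

(* theta is a Cartan involution for the real form sigma: it commutes with sigma
   and sigma theta is a compact real form.  The last six fields name the complex
   subspaces Lie(G), Lie(K) and p of the matrices, which are determined by the
   previous fields. *)
Record cartan_datum := CartanDatum {
  cG : set M;
  csigma : M -> M;
  ctheta : M -> M;
  cG_algebraic : algebraic_subgroup cG;
  cG_connected : connected cG;
  cG_reductive : reductive cG;
  csigma_involution : group_involution cG csigma;
  csigma_antiholomorphic : antiholomorphic_on cG csigma;
  cGR_connected : connected (fixed cG csigma);
  cGR_noncompact : ~ compact (fixed cG csigma);
  ctheta_involution : group_involution cG ctheta;
  ctheta_regular : forall i j, regular_on cG (fun g => ctheta g i j);
  ctheta_csigma : forall g, cG g -> ctheta (csigma g) = csigma (ctheta g);
  ctheta_cartan : compact (fixed cG (csigma \o ctheta));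
  cg : {vspace M};
  cgP : forall X, X \in cg <-> lie_of cG X;
  ck : {vspace M};
  ckP : forall X, X \in ck <-> lie_of (fixed cG ctheta) X;
  cp : {vspace M};
  cpP : forall X, X \in cp <-> lie_of cG X /\ differential ctheta X (- X)
}.

Context (s : cartan_datum).

Definition cK : set M := fixed (cG s) (ctheta s).
Definition cKR : set M := fixed cK (csigma s).

(* X in Lie(G)^sigma *)
Definition sigma_real (X : M) : Prop := differential (csigma s) X X.

Record invariant_form (beta : M -> M -> C) : Prop := InvariantForm {
  beta_linear : forall a X Y Z, X \in cg s -> Y \in cg s -> Z \in cg s ->
    beta (a *: X + Y) Z = a * beta X Z + beta Y Z;
  beta_sym : forall X Y, X \in cg s -> Y \in cg s -> beta X Y = beta Y X;
  beta_killing : forall X Y,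
    X \in derived_algebra (cg s) -> Y \in derived_algebra (cg s) ->
    beta X Y = killing_form (derived_algebra (cg s)) X Y;
  beta_pos : forall X, X \in cp s -> sigma_real X -> X != 0 -> 0 < beta X X;
  beta_neg : forall X, X \in ck s -> sigma_real X -> X != 0 -> beta X X < 0;
  beta_theta : forall X X' Y Y',
    X \in cg s -> Y \in cg s -> X' \in cg s -> Y' \in cg s ->
    differential (ctheta s) X X' -> differential (ctheta s) Y Y' ->
    beta X' Y' = beta X Y;
  beta_K : forall k X Y, cK k -> X \in cg s -> Y \in cg s ->
    beta (k * X * k^-1) (k * Y * k^-1) = beta X Y;
  beta_g : forall X Y Z, X \in cg s -> Y \in cg s -> Z \in cg s ->
    beta (lieb Z X) Y + beta X (lieb Z Y) = 0
}.

Definition p0 := subvs_of (cp s).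

(* k (+) p_0; a pair (Y, X) stands for Y + X. *)
Definition g0 := (subvs_of (ck s) * p0)%type.
HB.instance Definition _ := GRing.Lmodule.on g0.

Definition bracket0 (Z1 Z2 : g0) : g0 :=
  (vsproj (ck s) (lieb (vsval Z1.1) (vsval Z2.1)),
   vsproj (cp s) (lieb (vsval Z1.1) (vsval Z2.2)
                  + lieb (vsval Z1.2) (vsval Z2.1))).

Definition Ad0 (k : M) (Z : g0) : g0 := (Ad k Z.1, Ad k Z.2).

Definition g0_real (Z : g0) : Prop :=
  sigma_real (vsval Z.1) /\ sigma_real (vsval Z.2).

(* w is a basis of a finite-dimensional K-stable subspace, on which k in K acts
   by the matrix a k. *)
Definition affords (V : lmodType C) (actK : M -> V -> V)
    (m : nat) (w : 'I_m -> V) (a : M -> 'M[C]_m) : Prop :=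
  (forall c : 'I_m -> C, \sum_i c i *: w i = 0 -> forall i, c i = 0) /\
  (forall k, cK k -> forall j, actK k (w j) = \sum_i a k i j *: w i).

Record gK_module := GKModule {
  gK_sort :> lmodType C;
  actK : M -> {linear gK_sort -> gK_sort};
  actg : g0 -> {linear gK_sort -> gK_sort};
  actK1 : forall v, actK 1 v = v;
  actKM : forall k l v, cK k -> cK l -> actK (k * l) v = actK k (actK l v);
  actK_finite : forall v, exists m (w : 'I_m -> gK_sort) (a : M -> 'M[C]_m),
    [/\ affords actK w a,
        forall i j, regular_on cK (fun k => a k i j)
      & exists c : 'I_m -> C, v = \sum_i c i *: w i];
  actgP : forall a Z Z' v, actg (a *: Z + Z') v = a *: actg Z v + actg Z' v;
  actg_bracket : forall Z Z' v,
    actg (bracket0 Z Z') v = actg Z (actg Z' v) - actg Z' (actg Z v);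
  actK_actg : forall k Z v, cK k ->
    actK k (actg Z v) = actg (Ad0 k Z) (actK k v);
  (* The differential of the action of K is the action of k. *)
  actK_differential : forall m (w : 'I_m -> gK_sort) (a : M -> 'M[C]_m),
    affords actK w a -> forall (Y : subvs_of (ck s)) j,
    actg (Y, 0) (w j) =
      \sum_i 'D_1 (fun t : C => a (expm (t *: vsval Y)) i j) 0 *: w i
}.

Definition gK_isomorphic (V V' : gK_module) : Prop :=
  exists f : {linear V -> V'},
    [/\ bijective f,
        forall k v, cK k -> f (actK V k v) = actK V' k (f v)
      & forall Z v, f (actg V Z v) = actg V' Z (f v)].

Definition gK_irreducible (V : gK_module) : Prop :=
  (exists v : V, v != 0) /\
  forall W : set V,
    W 0 -> (forall a u v, W u -> W v -> W (a *: u + v)) ->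
    (forall k v, cK k -> W v -> W (actK V k v)) ->
    (forall Z v, W v -> W (actg V Z v)) ->
    W = [set 0] \/ W = setT.

Definition gK_unitary (V : gK_module) : Prop :=
  exists h : V -> V -> C,
    [/\ forall a u v w, h (a *: u + v) w = a * h u w + h v w,
        forall u v, h v u = Num.conj (h u v),
        forall v, v != 0 -> 0 < h v v,
        forall k u v, cKR k -> h (actK V k u) (actK V k v) = h u v
      & forall Z u v, g0_real Z -> h (actg V Z u) v = - h u (actg V Z v)].

(** * Dirac cohomology *)

Context (beta : M -> M -> C).

Definition beta0 (X Y : p0) : C := beta (vsval X) (vsval Y).

Definition Cl0 := clifford beta0.
Definition gamma0 : p0 -> Cl0 := @cliff_gamma C p0 beta0.

(* The pairs (k, a) of K x Spin(p_0) with Ad(k) = a . a^-1 on p_0. *)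
Definition Ktilde : set (M * Cl0) :=
  [set x | [/\ cK x.1, spin_group x.2
             & forall X, x.2 * gamma0 X = gamma0 (Ad x.1 X) * x.2]].

(* V (x) C^m *)
Definition spinors (V : lmodType C) (m : nat) := {ffun 'I_m -> V}.
HB.instance Definition _ V m := GRing.Lmodule.on (spinors V m).

(* f (x) A *)
Definition tensor_op (V : lmodType C) (m : nat) (f : {linear V -> V})
    (A : 'M[C]_m) (x : spinors V m) : spinors V m :=
  [ffun i => \sum_j A i j *: f (x j)].

Lemma tensor_op_linear V m f A : linear (@tensor_op V m f A).
Proof.
move=> a x y; apply/ffunP => i; rewrite !ffunE scaler_sumr -big_split /=.
apply: eq_bigr => j _; rewrite !ffunE linearP scalerDr !scalerA.
by rewrite [A i j * a]mulrC.
Qed.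
HB.instance Definition _ V m f A :=
  GRing.isLinear.Build C (spinors V m) (spinors V m) *:%R (@tensor_op V m f A)
    (@tensor_op_linear V m f A).

Context (d : nat) (e e' : d.-tuple p0).

Definition dual_bases : Prop :=
  basis_of fullv e /\
  forall i j, beta0 (tnth e i) (tnth e' j) = (i == j)%:R.

Context (m : nat) (S : clifford_module beta0 m).

(* sum_i e_i (x) gamma_0(e'_i) acting on V (x) S *)
Definition dirac_op (V : gK_module) (x : spinors V m) : spinors V m :=
  \sum_i tensor_op (actg V (0, tnth e i)) (S (gamma0 (tnth e' i))) x.

Lemma dirac_op_linear V : linear (@dirac_op V).
Proof.
move=> a x y; rewrite /dirac_op scaler_sumr -big_split /=.
by apply: eq_bigr => i _; rewrite linearP.
Qed.
HB.instance Definition _ (V : gK_module) :=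
  GRing.isLinear.Build C (spinors V m) (spinors V m) *:%R (@dirac_op V)
    (@dirac_op_linear V).

Definition dirac_cohomology (V : gK_module) : lmodType C :=
  ker_mod_im (@dirac_op V).

(* The operator by which (k, a) in K~ acts on the Dirac cohomology. *)
Definition dirac_cohomology_act (V : gK_module) (x : M * Cl0) :
    dirac_cohomology V -> dirac_cohomology V :=
  ker_mod_im_map (D := @dirac_op V) (tensor_op (actK V x.1) (S x.2)).

Definition dirac_cohomology_isomorphic (V V' : gK_module) : Prop :=
  exists f : {linear dirac_cohomology V -> dirac_cohomology V'},
    bijective f /\
    forall x q, Ktilde x ->
      f (dirac_cohomology_act x q) = dirac_cohomology_act x (f q).

Definition dirac_series (V : gK_module) : Prop :=
  [/\ gK_irreducible V, gK_unitary V
    & exists q : dirac_cohomology V, q != 0].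

End MotionGroup.

(* Main.v *)
(* Let v_j be a sigma-real orthogonal basis of p_0.  Since p_0 is an abelian ideal, D_0^2 is a positive
   multiple of the sum of the squares of the v_j, which act by skew-Hermitian operators on a unitary
   module; so the components of an element of ker D_0 are annihilated by p_0.  By irreducibility p_0
   acts by 0 on a module V of the Dirac series; then D_0 = 0, the Dirac cohomology is V (x) S_0, and V
   is an irreducible finite-dimensional K-module.

   An element k of K close to 1 lifts to some (k, a) in K~ for which a acts on S_0 with nonzero
   trace.  Hence an isomorphism of Dirac cohomologies makes the characters of V and V' agree near 1 in
   K.  The equality propagates to the subgroup generated by any neighbourhood of 1 in K, and this is
   all of K: by the polar decomposition with respect to a Hermitian form invariant under the compact
   group G^(sigma theta), this follows from the connectedness of G^sigma.  Irreducible representations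
   with the same character are isomorphic, because the algebra spanned by an irreducible
   representation contains elements of rank one. *)

From HB Require Import structures.
Require Import Defs.
From mathcomp Require Import all_boot all_order all_algebra.
From mathcomp Require Import perm sesquilinear spectral complex ring lra zify.
From mathcomp Require Import all_classical all_reals all_analysis.

Set Implicit Arguments.
Unset Strict Implicit.
Unset Printing Implicit Defensive.

Import Order.TTheory GRing.Theory Num.Theory.
Import numFieldNormedType.Exports.

Local Open Scope classical_set_scope.
Local Open Scope ring_scope.
Local Open Scope sesquilinear_scope.

(** * Limits of complex matrices *)

(** The character of S_0 may vanish somewhere on K~, so it cannot be cancelled globally; near 1 it
    can, and this is why everything else propagates an equality outwards from 1. A lift (k, a) has
    an ambiguous sign, and normalizing its vectors involves arbitrary complex square roots; [a] is
    therefore controlled only up to a scalar, which does not affect whether its trace vanishes.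

    Connectedness is given for G and G^sigma, whereas the induction runs over K. A property of K(R)
    that is locally constant is transported to G^sigma through the compact factor of the polar
    decomposition, where it becomes clopen.

    The analytic tools are elementary. Limits along an ultrafilter replace subsequences. An
    invariant Hermitian form maximizes a determinant instead of being an average. Roots of the
    positive part lie in an algebraic group because regular functions restricted to its powers are
    sums of exponentials. A closed subgroup that contains all the one-parameter subgroups of G
    contains a neighbourhood of 1, by a choice of elements nearly closest to 1 in their cosets. *)

Notation cabs := ComplexField.Normc.normc.

Section ComplexAbs.
Context {R : realType}.
Implicit Types x y z : R[i].

Lemma normcE x : `|x| = (cabs x)%:C%C. Proof. by []. Qed.
Lemma cabs_ge0 x : 0 <= cabs x.
Proof. by have := normr_ge0 x; rewrite normcE ler0c. Qed.
Lemma cabs0 : cabs (0 : R[i]) = 0.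
Proof. exact: ComplexField.Normc.normc0. Qed.
Lemma cabs1 : cabs (1 : R[i]) = 1.
Proof. exact: ComplexField.Normc.normc1. Qed.
Lemma cabsM x y : cabs (x * y) = cabs x * cabs y.
Proof. exact: ComplexField.Normc.normcM. Qed.
Lemma cabsV x : cabs x^-1 = (cabs x)^-1.
Proof. exact: ComplexField.Normc.normcV. Qed.
Lemma cabsD x y : cabs (x + y) <= cabs x + cabs y.
Proof. exact: le_normcD. Qed.
Lemma cabsN x : cabs (- x) = cabs x.
Proof. by apply: complexI; rewrite -!normcE normrN. Qed.
Lemma cabsB x y : cabs (x - y) = cabs (y - x).
Proof. by rewrite -cabsN opprB. Qed.
Lemma cabs_eq0 x : (cabs x == 0) = (x == 0).
Proof.
by apply/eqP/eqP => [/ComplexField.Normc.eq0_normc//|->]; rewrite cabs0.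
Qed.
Lemma cabsJ x : cabs x^* = cabs x.
Proof. by apply: complexI; rewrite -!normcE norm_conjC. Qed.
Lemma cabs_sum (I : finType) (F : I -> R[i]) :
  cabs (\sum_i F i) <= \sum_i cabs (F i).
Proof.
elim/big_ind2: _ => // [|x1 x2 y1 y2 h1 h2]; first by rewrite cabs0.
by apply: le_trans (cabsD _ _) _; exact: lerD.
Qed.
Lemma cabsR (r : R) : cabs r%:C%C = `|r|.
Proof. by rewrite /cabs /= expr0n /= addr0 sqrtr_sqr. Qed.
Lemma cabs_Re x : `|complex.Re x| <= cabs x.
Proof. by have := normc_ge_Re x; rewrite normcE lecR. Qed.
Lemma cabs_Im x : `|complex.Im x| <= cabs x.
Proof.
by case: x => a b /=; rewrite -sqrtr_sqr ler_sqrt ?addr_ge0 ?sqr_ge0 // lerDr sqr_ge0.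
Qed.
Lemma cabs_le_ReIm x : cabs x <= `|complex.Re x| + `|complex.Im x|.
Proof.
rewrite {1}[x]complexE; apply: le_trans (cabsD _ _) _.
by rewrite cabsM !cabsR /cabs /= expr0n expr1n add0r sqrtr1 mul1r.
Qed.
End ComplexAbs.

(* Sum of the moduli of the entries: a submultiplicative norm with values in R,
   where the norm of the library has values in R[i]. *)
Definition nrm {R : realType} {p q : nat} (A : 'M[R[i]]_(p, q)) : R :=
  \sum_i \sum_j cabs (A i j).

Section Norm.
Context {R : realType}.
Implicit Types p q r : nat.

Lemma nrm_ge0 p q (A : 'M[R[i]]_(p, q)) : 0 <= nrm A.
Proof. by apply: sumr_ge0 => i _; apply: sumr_ge0 => j _; exact: cabs_ge0. Qed.

Lemma cabs_le_nrm p q (A : 'M[R[i]]_(p, q)) i j : cabs (A i j) <= nrm A.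
Proof.
rewrite /nrm (bigD1 i) //= (bigD1 j) //= -addrA lerDl addr_ge0 //.
  by apply: sumr_ge0 => k _; exact: cabs_ge0.
by apply: sumr_ge0 => k _; apply: sumr_ge0 => l _; exact: cabs_ge0.
Qed.

Lemma nrm0 p q : nrm (0 : 'M[R[i]]_(p, q)) = 0.
Proof. by rewrite /nrm big1 // => i _; rewrite big1 // => j _; rewrite mxE cabs0. Qed.

Lemma nrm_eq0 p q (A : 'M[R[i]]_(p, q)) : (nrm A == 0) = (A == 0).
Proof.
apply/eqP/eqP => [A0|->]; last exact: nrm0.
apply/matrixP => i j; rewrite mxE; apply/eqP; rewrite -cabs_eq0 eq_le cabs_ge0 andbT.
by rewrite -A0 cabs_le_nrm.
Qed.

Lemma nrm_gt0 p q (A : 'M[R[i]]_(p, q)) : (0 < nrm A) = (A != 0).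
Proof. by rewrite lt_neqAle nrm_ge0 andbT eq_sym nrm_eq0. Qed.

Lemma nrmD p q (A B : 'M[R[i]]_(p, q)) : nrm (A + B) <= nrm A + nrm B.
Proof.
rewrite /nrm -big_split /=; apply: ler_sum => i _; rewrite -big_split /=.
by apply: ler_sum => j _; rewrite mxE cabsD.
Qed.

Lemma nrmN p q (A : 'M[R[i]]_(p, q)) : nrm (- A) = nrm A.
Proof. by apply: eq_bigr => i _; apply: eq_bigr => j _; rewrite mxE cabsN. Qed.

Lemma nrmB p q (A B : 'M[R[i]]_(p, q)) : nrm (A - B) = nrm (B - A).
Proof. by rewrite -nrmN opprB. Qed.

Lemma nrm_triangle p q (B A C : 'M[R[i]]_(p, q)) :
  nrm (A - C) <= nrm (A - B) + nrm (B - C).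
Proof. by rewrite (le_trans _ (nrmD _ _)) // addrA subrK. Qed.

Lemma nrm_sum p q (I : finType) (F : I -> 'M[R[i]]_(p, q)) :
  nrm (\sum_i F i) <= \sum_i nrm (F i).
Proof.
elim/big_ind2: _ => // [|x1 x2 y1 y2 h1 h2]; first by rewrite nrm0.
by apply: le_trans (nrmD _ _) _; exact: lerD.
Qed.

Lemma nrmZ p q c (A : 'M[R[i]]_(p, q)) : nrm (c *: A) = cabs c * nrm A.
Proof.
rewrite /nrm mulr_sumr; apply: eq_bigr => i _; rewrite mulr_sumr.
by apply: eq_bigr => j _; rewrite mxE cabsM.
Qed.

Lemma nrmM p q r (A : 'M[R[i]]_(p, q)) (B : 'M[R[i]]_(q, r)) :
  nrm (A *m B) <= nrm A * nrm B.
Proof.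
rewrite /nrm mulr_suml; apply: ler_sum => i _.
apply: (@le_trans _ _ (\sum_j \sum_k cabs (A i k) * cabs (B k j))).
  apply: ler_sum => j _; rewrite mxE; apply: le_trans (cabs_sum _) _.
  by apply: ler_sum => k _; rewrite cabsM.
rewrite exchange_big /= mulr_suml; apply: ler_sum => k _; rewrite -mulr_sumr.
apply: ler_wpM2l; first exact: cabs_ge0.
rewrite [leRHS](bigD1 k) //= lerDl.
by apply: sumr_ge0 => l _; apply: sumr_ge0 => j _; exact: cabs_ge0.
Qed.

Lemma nrm_exp n (A : 'M[R[i]]_n.+1) k : nrm (A ^+ k.+1) <= nrm A ^+ k.+1.
Proof.
elim: k => [|k IH]; first by rewrite !expr1.
rewrite exprS [leRHS]exprS; apply: le_trans (nrmM _ _) _.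
by apply: ler_wpM2l => //; exact: nrm_ge0.
Qed.

Lemma nbhs_nrmP p q (A : 'M[R[i]]_(p, q)) (P : set 'M[R[i]]_(p, q)) :
  nbhs A P <-> exists2 e : R, 0 < e & forall B, nrm (B - A) < e -> P B.
Proof.
split.
  case/nbhs_ballP => e e0 eP.
  have er : (complex.Re e)%:C%C = e by rewrite RRe_real // ger0_real // ltW.
  exists (complex.Re e); first by rewrite -ltcR er.
  move=> B Be; apply: eP; split=> // i j; rewrite -ball_normE /=.
  rewrite -er normcE ltcR; apply: le_lt_trans Be.
  by rewrite nrmB; have := cabs_le_nrm (A - B) i j; rewrite !mxE.
case=> e e0 eP; apply/nbhs_ballP.
pose d := e / (p * q).+1%:R.
have d0 : 0 < d by rewrite divr_gt0.
exists d%:C%C; first by rewrite /= ltcR.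
move=> B [_ AB]; apply: eP; rewrite nrmB.
apply: (@le_lt_trans _ _ (\sum_(i < p) \sum_(j < q) d)).
  apply: ler_sum => i _; apply: ler_sum => j _; apply: ltW; rewrite !mxE.
  by have := AB i j; rewrite -ball_normE /= normcE ltcR.
rewrite !sumr_const !card_ord -mulrnA -[d *+ _]mulr_natr /d mulrAC.
by rewrite ltr_pdivrMr // ltr_pM2l // ltr_nat mulnC.
Qed.

End Norm.

(** Convergence is measured by real-valued norms along an arbitrary set system, so that limits of
    sequences, limits within K and ultrafilter limits share the same lemmas. *)
Definition ctends {R : realType} {T : Type} (F : set_system T) (f : T -> R[i]) (a : R[i]) :=
  forall e : R, 0 < e -> \forall t \near F, cabs (f t - a) < e.
Definition tends {R : realType} {T : Type} {p q : nat} (F : set_system T)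
    (f : T -> 'M[R[i]]_(p, q)) (A : 'M[R[i]]_(p, q)) :=
  forall e : R, 0 < e -> \forall t \near F, nrm (f t - A) < e.

Section Limits.
Context {R : realType} {T : Type} {F : set_system T} {FF : Filter F}.
Implicit Types (f g : T -> R[i]) (a b : R[i]).

Lemma ctends_cst a : ctends F (fun=> a) a.
Proof. by move=> e e0; apply: nearW => t; rewrite subrr cabs0. Qed.

Lemma ctendsD f g a b : ctends F f a -> ctends F g b ->
  ctends F (fun t => f t + g t) (a + b).
Proof.
move=> fa gb e e0; have e20 : 0 < e / 2 by rewrite divr_gt0.
near=> t; rewrite opprD addrACA; apply: le_lt_trans (cabsD _ _) _.
by rewrite [e]splitr; apply: ltrD; near: t; [exact: fa | exact: gb].
Unshelve. all: by end_near. Qed.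

Lemma ctendsM f g a b : ctends F f a -> ctends F g b ->
  ctends F (fun t => f t * g t) (a * b).
Proof.
move=> fa gb e e0.
have A0 : 0 < cabs a + 1 by rewrite ltr_wpDl // cabs_ge0.
have B0 : 0 < cabs b + 1 by rewrite ltr_wpDl // cabs_ge0.
have ea : 0 < e / 2 / (cabs a + 1) by rewrite !divr_gt0.
have eb : 0 < e / 2 / (cabs b + 1) by rewrite !divr_gt0.
near=> t.
have -> : f t * g t - a * b = a * (g t - b) + (f t - a) * g t by ring.
apply: le_lt_trans (cabsD _ _) _; rewrite !cabsM [e]splitr; apply: ltr_leD.
  apply: (@le_lt_trans _ _ ((cabs a + 1) * cabs (g t - b))).
    by rewrite ler_wpM2r ?cabs_ge0 // lerDl.
  by rewrite mulrC -ltr_pdivlMr //; near: t; exact: gb.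
apply: (@le_trans _ _ (cabs (f t - a) * (cabs b + 1))).
  apply: ler_wpM2l; first exact: cabs_ge0.
  rewrite -(subrK b (g t)) addrC; apply: le_trans (cabsD _ _) _.
  by rewrite lerD2l ltW //; near: t; exact: gb.
by rewrite -ler_pdivlMr // ltW //; near: t; exact: fa.
Unshelve. all: by end_near. Qed.

Lemma ctendsZ f c a : ctends F f a -> ctends F (fun t => c * f t) (c * a).
Proof. exact/ctendsM/ctends_cst. Qed.

Lemma ctendsN f a : ctends F f a -> ctends F (fun t => - f t) (- a).
Proof. by move=> fa e /fa; apply: filterS => t; rewrite -opprD cabsN. Qed.

Lemma ctendsB f g a b : ctends F f a -> ctends F g b ->
  ctends F (fun t => f t - g t) (a - b).
Proof. by move=> fa gb; apply: ctendsD => //; exact: ctendsN. Qed.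

Lemma ctendsJ f a : ctends F f a -> ctends F (fun t => (f t)^*) a^*.
Proof. by move=> fa e /fa; apply: filterS => t; rewrite -rmorphB cabsJ. Qed.

Lemma ctends_neq0 f a : a != 0 -> ctends F f a -> \forall t \near F, f t != 0.
Proof.
move=> a0 /(_ (cabs a)) fa; have : 0 < cabs a.
  by rewrite lt_neqAle cabs_ge0 eq_sym cabs_eq0 a0.
by move=> /fa; apply: filterS => t; apply: contraTneq => ->; rewrite sub0r cabsN ltxx.
Qed.

Lemma ctends_near f g a : (\forall t \near F, f t = g t) -> ctends F f a -> ctends F g a.
Proof. by move=> fg fa e /fa; apply: filterS2 fg => t ->. Qed.

Lemma ctendsV f a : a != 0 -> ctends F f a -> ctends F (fun t => (f t)^-1) a^-1.
Proof.
move=> a0 fa e e0; have ca : 0 < cabs a.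
  by rewrite lt_neqAle cabs_ge0 eq_sym cabs_eq0 a0.
have h1 : 0 < cabs a / 2 by rewrite divr_gt0.
have h2 : 0 < e * (cabs a / 2) * cabs a by rewrite !mulr_gt0.
have fn0 := ctends_neq0 a0 fa.
near=> t.
have ft0 : f t != 0 by near: t.
have ht : cabs a / 2 < cabs (f t).
  have : cabs (f t - a) < cabs a / 2 by near: t; exact: fa.
  have : cabs a <= cabs (f t - a) + cabs (f t).
    by rewrite cabsB -{1}(subrK (f t) a); exact: cabsD.
  lra.
have -> : (f t)^-1 - a^-1 = (a - f t) * ((f t)^-1 * a^-1) 
  by rewrite mulrBl [f t * _]mulrA divff // mul1r mulrCA divff // mulr1.
rewrite !cabsM !cabsV cabsB -invfM ltr_pdivrMr; last first.
  by rewrite mulr_gt0 // (lt_trans _ ht).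
apply: (@lt_trans _ _ (e * (cabs a / 2) * cabs a)); first by near: t; exact: fa.
by rewrite -mulrA ltr_pM2l // ltr_pM2r.
Unshelve. all: by end_near. Qed.

Lemma ctends_sum (I : Type) (r : seq I) (P : pred I) (f : I -> T -> R[i]) (a : I -> R[i]) :
  (forall i, P i -> ctends F (f i) (a i)) ->
  ctends F (fun t => \sum_(i <- r | P i) f i t) (\sum_(i <- r | P i) a i).
Proof.
move=> fa; elim: r => [|i r IH].
  by rewrite big_nil; apply: ctends_near (ctends_cst 0); apply: nearW => t; rewrite big_nil.
rewrite big_cons; case: ifP => Pi.
  apply: ctends_near (ctendsD (fa i Pi) IH).
  by apply: nearW => t; rewrite big_cons Pi.
by apply: ctends_near IH; apply: nearW => t; rewrite big_cons Pi.
Qed.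

Lemma ctends_prod (I : Type) (r : seq I) (P : pred I) (f : I -> T -> R[i]) (a : I -> R[i]) :
  (forall i, P i -> ctends F (f i) (a i)) ->
  ctends F (fun t => \prod_(i <- r | P i) f i t) (\prod_(i <- r | P i) a i).
Proof.
move=> fa; elim: r => [|i r IH].
  by rewrite big_nil; apply: ctends_near (ctends_cst 1); apply: nearW => t; rewrite big_nil.
rewrite big_cons; case: ifP => Pi.
  apply: ctends_near (ctendsM (fa i Pi) IH).
  by apply: nearW => t; rewrite big_cons Pi.
by apply: ctends_near IH; apply: nearW => t; rewrite big_cons Pi.
Qed.

Lemma tendsP p q (f : T -> 'M[R[i]]_(p, q)) (A : 'M[R[i]]_(p, q)) :
  tends F f A <-> forall i j, ctends F (fun t => f t i j) (A i j).
Proof.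
split=> [fA i j e /fA|fA e e0].
  apply: filterS => t; apply: le_lt_trans.
  by have := cabs_le_nrm (f t - A) i j; rewrite !mxE.
pose d := e / (p * q).+1%:R.
have d0 : 0 < d by rewrite divr_gt0.
have : \forall t \near F, forall i j, cabs (f t i j - A i j) < d.
  by apply: filter_forall => i; apply: filter_forall => j; exact: fA.
apply: filterS => t ft.
apply: (@le_lt_trans _ _ (\sum_(i < p) \sum_(j < q) d)).
  by apply: ler_sum => i _; apply: ler_sum => j _; rewrite !mxE; exact: ltW.
rewrite !sumr_const !card_ord -mulrnA -[d *+ _]mulr_natr /d mulrAC.
by rewrite ltr_pdivrMr // ltr_pM2l // ltr_nat mulnC.
Qed.

Section Mx.
Context {p q : nat}.
Local Notation mx := 'M[R[i]]_(p, q).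

Lemma tends_cst (A : mx) : tends F (fun=> A) A.
Proof. by apply/tendsP => i j; exact: ctends_cst. Qed.

Lemma tends_near (f g : T -> mx) (A : mx) : (\forall t \near F, f t = g t) -> tends F f A -> tends F g A.
Proof. by move=> fg fa e /fa; apply: filterS2 fg => t ->. Qed.

Lemma tendsD (f g : T -> mx) (A : mx) B : tends F f A -> tends F g B -> tends F (fun t => f t + g t) (A + B).
Proof.
move=> /tendsP fA /tendsP gB; apply/tendsP => i j; rewrite mxE.
by apply: ctends_near (ctendsD (fA i j) (gB i j)); apply: nearW => t; rewrite mxE.
Qed.

Lemma tendsZ (c : T -> R[i]) a (f : T -> mx) (A : mx) :
  ctends F c a -> tends F f A -> tends F (fun t => c t *: f t) (a *: A).
Proof.
move=> ca /tendsP fA; apply/tendsP => i j; rewrite mxE.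
by apply: ctends_near (ctendsM ca (fA i j)); apply: nearW => t; rewrite mxE.
Qed.

Lemma tendsN (f : T -> mx) (A : mx) : tends F f A -> tends F (fun t => - f t) (- A).
Proof. by move=> fA e /fA; apply: filterS => t; rewrite -opprD nrmN. Qed.

Lemma tendsB (f g : T -> mx) (A : mx) B : tends F f A -> tends F g B -> tends F (fun t => f t - g t) (A - B).
Proof. by move=> fa gb; apply: tendsD => //; exact: tendsN. Qed.

Lemma tends_adj (f : T -> mx) (A : mx) : tends F f A -> tends F (fun t => (f t) ^t* ) (A ^t* ).
Proof.
move=> /tendsP fA; apply/tendsP => i j; rewrite !mxE.
by apply: ctends_near (ctendsJ (fA j i)); apply: nearW => t; rewrite !mxE.
Qed.

Lemma tends_le {PF : ProperFilter F} (f : T -> mx) (A : mx) (c : R) : tends F f A ->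
  (\forall t \near F, nrm (f t) <= c) -> nrm A <= c.
Proof.
move=> fA fc; apply/ler_addgt0Pr => e e0.
have [t [h1 h2]] := @filter_ex _ F _ _ (filterI fc (fA e e0)).
rewrite -(subrK (f t) A) addrC; apply: le_trans (nrmD _ _) _.
by apply: lerD => //; rewrite nrmB ltW.
Qed.

Lemma tends_unique {PF : ProperFilter F} (f : T -> mx) (A B : mx) : tends F f A -> tends F f B -> A = B.
Proof.
move=> fA fB; apply/eqP; rewrite -subr_eq0 -nrm_eq0 eq_le nrm_ge0 andbT.
apply: (@tends_le _ (fun t => f t - f t)); first exact: tendsB.
by apply: nearW => t; rewrite subrr nrm0.
Qed.

End Mx.

Lemma tends_mulmx p q r (f : T -> 'M[R[i]]_(p, q)) (g : T -> 'M[R[i]]_(q, r)) A B :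
  tends F f A -> tends F g B -> tends F (fun t => f t *m g t) (A *m B).
Proof.
move=> /tendsP fA /tendsP gB; apply/tendsP => i j; rewrite mxE.
apply: ctends_near (ctends_sum _ (fun k _ => ctendsM (fA i k) (gB k j))).
by apply: nearW => t; rewrite mxE.
Qed.

Lemma ctends_det n (f : T -> 'M[R[i]]_n) A :
  tends F f A -> ctends F (fun t => \det (f t)) (\det A).
Proof.
move=> /tendsP fA; apply: ctends_sum => s _; apply: ctendsM; first exact: ctends_cst.
by apply: ctends_prod => i _.
Qed.

Lemma ctends_tr n (f : T -> 'M[R[i]]_n) A :
  tends F f A -> ctends F (fun t => \tr (f t)) (\tr A).
Proof. by move=> /tendsP fA; apply: ctends_sum. Qed.

Lemma tends_unit n (f : T -> 'M[R[i]]_n) A :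
  A \in unitmx -> tends F f A -> \forall t \near F, f t \in unitmx.
Proof.
rewrite unitmxE unitfE => A0 /ctends_det/(ctends_neq0 A0).
by apply: filterS => t; rewrite unitmxE unitfE.
Qed.

Lemma tends_invmx n (f : T -> 'M[R[i]]_n) A :
  A \in unitmx -> tends F f A -> tends F (fun t => invmx (f t)) (invmx A).
Proof.
move=> A0 fA; rewrite /invmx A0.
apply: (@tends_near _ _ (fun t => (\det (f t))^-1 *: \adj (f t))).
  by apply: filterS (tends_unit A0 fA) => t ->.
apply: tendsZ; first by apply: ctendsV (ctends_det fA); rewrite -unitfE -unitmxE.
apply/tendsP => i j; rewrite mxE /cofactor.
apply: (@ctends_near (fun t => (-1) ^+ (j + i) * \det (row' j (col' i (f t))))).
  by apply: nearW => t; rewrite mxE.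
apply: ctendsZ; apply: ctends_det; apply/tendsP => k l; rewrite !mxE.
apply: (@ctends_near (fun t => f t (lift j k) (lift i l))).
  by apply: nearW => t; rewrite !mxE.
by move/tendsP: fA; exact.
Qed.

End Limits.

Lemma tends_id {R : realType} p q (A : 'M[R[i]]_(p, q)) : tends (nbhs A) id A.
Proof. by move=> e e0; apply/nbhs_nrmP; exists e. Qed.

Lemma tends_sub {R : realType} {T : Type} (F G : set_system T) p q
    (f : T -> 'M[R[i]]_(p, q)) (A : 'M[R[i]]_(p, q)) :
  (forall P, F P -> G P) -> tends F f A -> tends G f A.
Proof. by move=> FG fA e /fA /FG. Qed.

(** * The exponential and closed subgroups *)

(** Every bounded sequence converges along such a filter, which replaces the extraction of
    subsequences. *)
Lemma ultra_seq : exists F : set_system nat, UltraFilter F /\ (forall P, (\oo)%classic P -> F P).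
Proof. by have [G [GU sFG]] := @ultraFilterLemma nat \oo _; exists G. Qed.

Section Ultra.
Context {R : realType} {T : Type} {F : set_system T} {FU : UltraFilter F}.

Lemma ultra_real (f : T -> R) (B : R) : (\forall t \near F, `|f t| <= B) ->
  exists a : R, forall e, 0 < e -> \forall t \near F, `|f t - a| < e.
Proof.
move=> fB; have FB : (f @ F) [set` `[- B, B]].
  by apply: filterS fB => t; rewrite /= in_itv /= ler_norml.
have [p [_ pF]] := @segment_compact R (- B) B (f @ F) _ FB.
exists p => e e0; have [//|Fn] := in_ultra_setVsetC [set t | `|f t - p| < e] FU.
have pe : nbhs p [set x | `|x - p| < e].
  by apply/nbhs_ballP; exists e => // x /=; rewrite -ball_normE /= distrC.
have [x []] := pF (~` [set x | `|x - p| < e]) _ Fn pe.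
by [].
Qed.

Lemma ultra_ctends (f : T -> R[i]) (B : R) : (\forall t \near F, cabs (f t) <= B) ->
  exists a, ctends F f a.
Proof.
move=> fB.
have [a ha] : exists a : R, forall e, 0 < e -> \forall t \near F, `|complex.Re (f t) - a| < e.
  apply: (ultra_real (B := B)); apply: filterS fB => t; apply: le_trans; exact: cabs_Re.
have [b hb] : exists a : R, forall e, 0 < e -> \forall t \near F, `|complex.Im (f t) - a| < e.
  apply: (ultra_real (B := B)); apply: filterS fB => t; apply: le_trans; exact: cabs_Im.
exists (a +i* b)%C => e e0; have e20 : 0 < e / 2 by rewrite divr_gt0.
apply: filterS2 (ha _ e20) (hb _ e20) => t h1 h2.
apply: le_lt_trans (cabs_le_ReIm _) _; rewrite [e]splitr.
by move: h1 h2; case: (f t) => x y /= h1 h2; apply: ltrD.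
Qed.

Lemma ultra_tends p q (f : T -> 'M[R[i]]_(p, q)) (B : R) :
  (\forall t \near F, nrm (f t) <= B) -> exists A, tends F f A.
Proof.
move=> fB.
have h i j : exists a, ctends F (fun t => f t i j) a.
  apply: (ultra_ctends (B := B)); apply: filterS fB => t; apply: le_trans.
  exact: cabs_le_nrm.
exists (\matrix_(i, j) sval (cid (h i j))); apply/tendsP => i j; rewrite mxE.
by case: cid.
Qed.

End Ultra.

(** * The exponential series as a limit of powers *)

Section Exponential.
Context {R : realType} {n : nat}.
Local Notation M := 'M[R[i]]_n.+1.
Implicit Types (X Y Z : M).

(** Absorbs the term of degree 0: the norm of 1 is the size of the matrices, not 1. *)
Let c : R := nrm (1 : M) + 1.

Let c_gt0 : 0 < c. Proof. by rewrite ltr_wpDl // nrm_ge0. Qed.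

Lemma nrm_pow X k : nrm (X ^+ k) <= c * nrm X ^+ k.
Proof.
case: k => [|k]; first by rewrite !expr0 mulr1 lerDl.
apply: le_trans (nrm_exp _ _) _; rewrite ler_peMl ?exprn_ge0 ?nrm_ge0 //.
by rewrite lerDr nrm_ge0.
Qed.

Lemma nrm_1D_pow X k : nrm ((1 + X) ^+ k) <= c * (1 + nrm X) ^+ k.
Proof.
rewrite ![1 + _]addrC !exprD1n mulr_sumr; apply: le_trans (nrm_sum _) _.
apply: ler_sum => i _; rewrite -[_ *+ _]scaler_nat nrmZ -[X in _ <= c * X]mulr_natl.
have -> : cabs ('C(k, i)%:R : R[i]) = 'C(k, i)%:R.
  by rewrite -(rmorph_nat (real_complex R)) cabsR ger0_norm.
rewrite mulrCA; apply: ler_wpM2l => //; exact: nrm_pow.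
Qed.

Let E (x : R) k : R := series (exp_coeff x) k.
Let S X k : M := series (fun k : nat => (k`!%:R)^-1 *: X ^+ k) k.

Let E_le x k : 0 <= x -> E x k <= expR x.
Proof.
move=> x0; apply: nondecreasing_cvgn_le; last exact: is_cvg_series_exp_coeff.
by apply: nondecreasing_series => i _ _; exact: exp_coeff_ge0.
Qed.

Let cabs_factV k : cabs ((k`!%:R)^-1 : R[i]) = (k`!%:R)^-1.
Proof. by rewrite cabsV -(rmorph_nat (real_complex R)) cabsR ger0_norm. Qed.

Let S_sub X k m : nrm (S X (k + m)%N - S X k) <= c * (E (nrm X) (k + m)%N - E (nrm X) k).
Proof.
elim: m => [|m IH]; first by rewrite addn0 !subrr nrm0 mulr0.
rewrite addnS /S /E /series /= !big_nat_recr //= -/(series _ _) -/(series _ _).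
rewrite [X in nrm X]addrAC [X in c * X]addrAC mulrDr.
apply: le_trans (nrmD _ _) _; apply: lerD; first exact: IH.
rewrite nrmZ cabs_factV /exp_coeff /= [leRHS]mulrA [leLHS]mulrC ler_wpM2r ?invr_ge0 //.
exact: nrm_pow.
Qed.

(** A limit exists along an ultrafilter because the partial sums are bounded; the tail estimate,
    inherited from the real exponential, then upgrades it to convergence at infinity. *)
Let expm_lim X : exists2 A, tends \oo (S X) A &
  forall k, nrm (A - S X k) <= c * (expR (nrm X) - E (nrm X) k).
Proof.
have [F [FU ooF]] := ultra_seq.
have x0 := nrm_ge0 X.
have bound k m : (k <= m)%N -> nrm (S X m - S X k) <= c * (expR (nrm X) - E (nrm X) k).
  move=> km; rewrite -(subnKC km); apply: le_trans (S_sub _ _ _) _.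
  by rewrite ler_pM2l // lerD2r E_le.
have [A SA] : exists A, tends F (S X) A.
  apply: (ultra_tends (B := c * (expR (nrm X) - E (nrm X) 0))).
  by apply: nearW => m; have := bound 0%N m isT; rewrite {2}/S /series /= big_geq // subr0.
have tail k : nrm (A - S X k) <= c * (expR (nrm X) - E (nrm X) k).
  apply: (@tends_le _ _ F _ _ _ _ (fun m => S X m - S X k)).
    by apply: tendsB => //; exact: tends_cst.
  by apply: ooF; near=> m; apply: bound; near: m; exact: nbhs_infty_ge.
exists A => // e e0.
have ec : 0 < e / c by rewrite divr_gt0.
have : series (exp_coeff (nrm X)) @ \oo --> expR (nrm X).
  exact: is_cvg_series_exp_coeff.
move=> /cvgrPdist_lt/(_ _ ec); apply: filterS => k hk.
rewrite nrmB; apply: le_lt_trans (tail k) _.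
by rewrite mulrC -ltr_pdivlMr //; apply: le_lt_trans hk; exact: ler_norm.
Unshelve. all: by end_near. Qed.

Let expmE X A : tends \oo (S X) A -> expm X = A.
Proof.
move=> SA; have cvgA : S X @ \oo --> A.
  by move=> P /nbhs_nrmP[e e0 eP]; apply: filterS (SA e e0) => k; exact: eP.
have limA : S X @ \oo --> expm X by apply: (cvgP A cvgA).
have : tends \oo (S X) (expm X).
  by move=> e e0; apply: (limA [set B | nrm (B - expm X) < e]); apply/nbhs_nrmP; exists e.
by move=> /tends_unique; apply.
Qed.

Let expm_tail X k : nrm (expm X - S X k) <= c * (expR (nrm X) - E (nrm X) k).
Proof. by have [A SA tail] := expm_lim X; rewrite (expmE SA). Qed.

(** With y = x/m one has 1 + y >= exp (y - y^2); its m-th power gives exp x * exp (- x^2/m), which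
    is at least exp x * (1 - x^2/m). *)
Let expR_pow_bound (x : R) (m : nat) : 0 <= x -> (0 < m)%N ->
  expR x - (1 + x / m%:R) ^+ m <= expR x * (x ^+ 2 / m%:R).
Proof.
move=> x0 m0; have m1 : 0 < m%:R :> R by rewrite ltr0n.
have mn0 : m%:R != 0 :> R by rewrite gt_eqF.
have y0 : 0 <= x / m%:R by rewrite divr_ge0 // ltW.
set y := x / m%:R in y0 *.
have y1 : 0 < 1 + y by rewrite ltr_wpDr.
have h : expR (y - y ^+ 2) <= 1 + y.
  apply: (@le_trans _ _ (expR (y / (1 + y)))).
    rewrite ler_expR ler_pdivlMr //.
    have -> : (y - y ^+ 2) * (1 + y) = y - y ^+ 3 by ring.
    by rewrite gerBl exprn_ge0.
  rewrite -lef_pV2 ?posrE ?expR_gt0 // -expRN; apply: le_trans (expR_ge1Dx _).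
  by rewrite le_eqVlt; apply/orP; left; apply/eqP; field; rewrite gt_eqF.
have : expR x * (1 - x ^+ 2 / m%:R) <= (1 + y) ^+ m.
  apply: (@le_trans _ _ (expR (y - y ^+ 2) ^+ m)); last first.
    by apply: lerXn2r => //; rewrite nnegrE ?expR_ge0 // ltW.
  rewrite -expRM_natr.
  have -> : (y - y ^+ 2) * m%:R = x - x ^+ 2 / m%:R by rewrite /y; field.
  rewrite expRD ler_pM2l ?expR_gt0 //; exact: expR_ge1Dx.
lra.
Qed.

Let ffact_le_exp m k : (m ^_ k <= m ^ k)%N.
Proof.
elim: k => [|k IH]; first by rewrite ffactn0 expn0.
by rewrite ffactnSr expnSr leq_mul // leq_subr.
Qed.

Let coef_ge0 m i : 0 <= (i`!%:R)^-1 - 'C(m, i)%:R / m%:R ^+ i :> R.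
Proof.
have [->|m0] := posnP m.
  case: i => [|i]; first by rewrite bin0 expr0 fact0 !invr1 mulr1 subrr.
  by rewrite bin0n mul0r subr0 invr_ge0.
rewrite subr_ge0 ler_pdivrMr ?exprn_gt0 ?ltr0n // mulrC ler_pdivlMr ?ltr0n ?fact_gt0 //.
by rewrite -natrM -natrX ler_nat bin_ffact ffact_le_exp.
Qed.

(** As power series in X, the difference has nonnegative coefficients, so its norm is at most [c]
    times the same difference evaluated at the real number [nrm X]. *)
Lemma expm_pow_bound X m : (0 < m)%N ->
  nrm (expm X - (1 + m%:R^-1 *: X) ^+ m) <= c * (expR (nrm X) * (nrm X ^+ 2 / m%:R)).
Proof.
move=> m0; have x0 := nrm_ge0 X.
apply: (@le_trans _ _ (c * (expR (nrm X) - (1 + nrm X / m%:R) ^+ m))); last first.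
  by rewrite ler_pM2l // expR_pow_bound.
have SE : expm X - (1 + m%:R^-1 *: X) ^+ m =
    (expm X - S X m.+1) + \sum_(i < m.+1)
      ((i`!%:R)^-1 - 'C(m, i)%:R / m%:R ^+ i) *: X ^+ i.
  rewrite [1 + _]addrC exprD1n /S /series /= big_mkord -[RHS]addrA; congr (_ + _).
  rewrite -!sumrN -big_split /=; apply: eq_bigr => i _.
  rewrite exprZn scalerBl addKr; congr (- _).
  by rewrite -[_ *+ _]scaler_nat scalerA exprVn.
have EE : expR (nrm X) - (1 + nrm X / m%:R) ^+ m =
    (expR (nrm X) - E (nrm X) m.+1) + \sum_(i < m.+1)
      ((i`!%:R)^-1 - 'C(m, i)%:R / m%:R ^+ i) * nrm X ^+ i.
  rewrite [1 + _]addrC exprD1n /E /series /= big_mkord -[RHS]addrA; congr (_ + _).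
  rewrite -!sumrN -big_split /=; apply: eq_bigr => i _.
  by rewrite mulrBl /exp_coeff /= expr_div_n -[in LHS]mulr_natl; ring.
rewrite SE EE mulrDr; apply: le_trans (nrmD _ _) _; apply: lerD; first exact: expm_tail.
rewrite mulr_sumr; apply: le_trans (nrm_sum _) _; apply: ler_sum => i _.
have -> : (i`!%:R)^-1 - 'C(m, i)%:R / m%:R ^+ i =
    (((i`!%:R)^-1 - 'C(m, i)%:R / m%:R ^+ i : R)%:C)%C :> R[i].
  by rewrite rmorphB rmorphM !fmorphV rmorphXn !rmorph_nat.
rewrite nrmZ cabsR ger0_norm; first by rewrite mulrCA ler_wpM2l // ?nrm_pow // coef_ge0.
exact: coef_ge0.
Qed.

Lemma expm_first X : nrm (expm X - (1 + X)) <= c * (expR (nrm X) * nrm X ^+ 2).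
Proof. by have := @expm_pow_bound X 1 isT; rewrite invr1 scale1r expr1 divr1. Qed.

Lemma expm0 : expm (0 : M) = 1.
Proof.
apply/eqP; rewrite -subr_eq0 -nrm_eq0 eq_le nrm_ge0 andbT.
by have := expm_first 0; rewrite nrm0 expr0n /= !mulr0 addr0.
Qed.

Let pow_sub (A B : M) m :
  A ^+ m - B ^+ m = \sum_(i < m) A ^+ i * (A - B) * B ^+ (m.-1 - i).
Proof.
elim: m => [|m IH]; first by rewrite big_ord0 !expr0 subrr.
rewrite big_ord_recr /= subnn expr0 mulr1.
have -> : A ^+ m.+1 - B ^+ m.+1 = (A ^+ m - B ^+ m) * B + A ^+ m * (A - B).
  by rewrite mulrBl mulrBr -!exprSr [RHS]addrC addrA subrK.
rewrite IH mulr_suml; congr (_ + _); apply: eq_bigr => i _.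
rewrite -mulrA -exprSr; congr (_ * _ ^+ _).
by case: m i {IH} => [[]//|m] i /=; rewrite subSn // -ltnS.
Qed.

(** The telescoping sum has m terms, each with a factor 1/m, so the Lipschitz constant is
    independent of m. *)
Let nrm_1D_pow_sub Y Z m b : (0 < m)%N -> nrm Y <= b -> nrm Z <= b ->
  nrm ((1 + m%:R^-1 *: Y) ^+ m - (1 + m%:R^-1 *: Z) ^+ m) <=
    c ^+ 2 * expR b * nrm (Y - Z).
Proof.
move=> m0 Yb Zb; have m1 : 0 < m%:R :> R by rewrite ltr0n.
have b0 : 0 <= b by apply: le_trans Yb; exact: nrm_ge0.
have cm : cabs (m%:R^-1 : R[i]) = m%:R^-1.
  by rewrite cabsV -(rmorph_nat (real_complex R)) cabsR ger0_norm // ltW.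
have pw (W : M) i : nrm W <= b -> nrm ((1 + m%:R^-1 *: W) ^+ i) <= c * (1 + b / m%:R) ^+ i.
  move=> Wb; apply: le_trans (nrm_1D_pow _ _) _; rewrite ler_pM2l //.
  apply: lerXn2r; rewrite ?nnegrE ?addr_ge0 ?nrm_ge0 ?divr_ge0 ?ler0n //.
  by rewrite lerD2l nrmZ cm mulrC ler_pM2r // invr_gt0.
have eb : (1 + b / m%:R) ^+ m <= expR b.
  apply: (@le_trans _ _ (expR (b / m%:R) ^+ m)).
    apply: lerXn2r; rewrite ?nnegrE ?addr_ge0 ?expR_ge0 ?divr_ge0 ?ler0n //.
    exact: expR_ge1Dx.
  by rewrite -expRM_natr divfK // gt_eqF.
have b1 : 1 <= 1 + b / m%:R by rewrite lerDl divr_ge0 // ltW.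
rewrite pow_sub; apply: le_trans (nrm_sum _) _.
apply: (@le_trans _ _ (\sum_(i < m) c ^+ 2 * expR b * nrm (Y - Z) / m%:R)); last first.
  by rewrite sumr_const card_ord -[X in X <= _]mulr_natr divfK // gt_eqF.
apply: ler_sum => i _.
apply: le_trans (nrmM _ _) _; apply: le_trans (ler_wpM2r (nrm_ge0 _) (nrmM _ _)) _.
rewrite opprD addrACA subrr add0r -scalerBr nrmZ cm.
have h1 := pw Y i Yb; have h2 := pw Z (m.-1 - i)%N Zb.
apply: (@le_trans _ _ (c * (1 + b / m%:R) ^+ i * (m%:R^-1 * nrm (Y - Z)) *
   (c * (1 + b / m%:R) ^+ (m.-1 - i)))).
  apply: ler_pM => //; rewrite ?mulr_ge0 ?nrm_ge0 ?invr_ge0 ?ler0n //.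
  by rewrite ler_wpM2r // mulr_ge0 ?nrm_ge0 ?invr_ge0 ?ler0n.
have -> : c * (1 + b / m%:R) ^+ i * (m%:R^-1 * nrm (Y - Z)) *
    (c * (1 + b / m%:R) ^+ (m.-1 - i)) =
    c ^+ 2 * ((1 + b / m%:R) ^+ (i + (m.-1 - i))) * nrm (Y - Z) / m%:R.
  by rewrite exprD; ring.
rewrite ler_pM2r ?invr_gt0 // ler_wpM2r ?nrm_ge0 // ler_pM2l ?exprn_gt0 //.
apply: le_trans eb; apply: ler_weXn2l => //.
by rewrite subnKC ?leq_pred // -ltnS prednK.
Qed.

(** The base may be any perturbation of 1 + Z/m and the exponent may vary along any filter: this
    serves both the identities of the exponential and the construction of one-parameter subgroups
    from powers of small elements. *)
Lemma tends_pow T (F : set_system T) {FF : Filter F} (h : T -> M) (m : T -> nat) Z :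
  (forall k, \forall t \near F, (k <= m t)%N) ->
  tends F (fun t => (m t)%:R *: (h t - 1)) Z ->
  tends F (fun t => h t ^+ m t) (expm Z).
Proof.
move=> mo hZ e e0; set z := nrm Z.
have e20 : 0 < e / 2 by rewrite divr_gt0.
have C1 : 0 < c ^+ 2 * expR (z + 1) by rewrite mulr_gt0 ?exprn_gt0 ?expR_gt0.
set C2 := c * (expR z * z ^+ 2).
have C20 : 0 <= C2 by rewrite !mulr_ge0 ?expR_ge0 ?exprn_ge0 ?nrm_ge0 // ltW.
have e1 : 0 < e / 2 / (c ^+ 2 * expR (z + 1)) by rewrite divr_gt0.
near=> t.
have m0 : (0 < m t)%N by near: t; exact: mo.
have mn0 : (m t)%:R != 0 :> R[i] by rewrite pnatr_eq0 -lt0n.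
have m1 : 0 < (m t)%:R :> R by rewrite ltr0n.
have YZ1 : nrm ((m t)%:R *: (h t - 1) - Z) < 1 by near: t; exact: hZ.
have YZ : nrm ((m t)%:R *: (h t - 1) - Z) < e / 2 / (c ^+ 2 * expR (z + 1)).
  by near: t; exact: hZ.
set Y := (m t)%:R *: (h t - 1) in YZ1 YZ.
have hE : h t = 1 + (m t)%:R^-1 *: Y by rewrite /Y scalerA mulVf // scale1r addrC subrK.
have zz : z <= z + 1 by rewrite lerDl.
have Yb : nrm Y <= z + 1.
  rewrite -(subrK Z Y) addrC; apply: le_trans (nrmD _ _) _.
  by rewrite lerD2l ltW.
rewrite hE; apply: le_lt_trans (nrm_triangle ((1 + (m t)%:R^-1 *: Z) ^+ m t) _ _) _.
rewrite [e]splitr; apply: ler_ltD.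
  apply: le_trans (nrm_1D_pow_sub m0 Yb zz) _.
  by rewrite mulrC -ler_pdivlMr // ltW.
rewrite nrmB; apply: le_lt_trans (expm_pow_bound _ m0) _.
rewrite -/z mulrA mulrA -[c * _ * _]mulrA -/C2 ltr_pdivrMr // mulrC -ltr_pdivrMr //.
apply: (@lt_le_trans _ _ (Num.truncn (C2 / (e / 2))).+1%:R).
  by apply: truncnS_gt.
rewrite ler_nat; near: t; exact: mo.
Unshelve. all: by end_near. Qed.

End Exponential.

Section Adjoint.
Context {C : numClosedFieldType}.

Lemma adj1 n : (1 : 'M[C]_n.+1) ^t* = 1.
Proof. by rewrite trmx1 map_mx1. Qed.

Lemma adjK p q (A : 'M[C]_(p, q)) : A ^t* ^t* = A.
Proof. exact: trmxCK. Qed.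

Lemma adjM p q r (A : 'M[C]_(p, q)) (B : 'M[C]_(q, r)) : (A *m B) ^t* = B ^t* *m A ^t*.
Proof. by rewrite trmx_mul map_mxM. Qed.

Lemma adjD p q (A B : 'M[C]_(p, q)) : (A + B) ^t* = A ^t* + B ^t*.
Proof. by apply/matrixP => i j; rewrite !mxE rmorphD. Qed.

Lemma adjZ p q (a : C) (A : 'M[C]_(p, q)) : (a *: A) ^t* = a^* *: A ^t*.
Proof. by apply/matrixP => i j; rewrite !mxE rmorphM. Qed.

Lemma adj_pow n (A : 'M[C]_n.+1) k : (A ^+ k) ^t* = (A ^t* ) ^+ k.
Proof.
elim: k => [|k IH]; first by rewrite !expr0 adj1.
by rewrite exprSr exprS -IH -[RHS]adjM.
Qed.

End Adjoint.

(* Unfolding expm sends the conversion test into the topology of matrices. *)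
#[global] Opaque expm.

Section ExpmTheory.
Context {R : realType} {n : nat}.
Local Notation M := 'M[R[i]]_n.+1.
Implicit Types (X Y Z A : M).

Lemma ctends_invn : ctends \oo (fun m : nat => (m%:R^-1 : R[i])) 0.
Proof.
move=> e e0; near=> m; rewrite subr0 cabsV -(rmorph_nat (real_complex R)) cabsR.
have m1 : (0 < m)%N by near: m; exists 1%N.
rewrite ger0_norm // invf_plt ?posrE ?ltr0n //.
apply: (@lt_le_trans _ _ (Num.truncn e^-1).+1%:R); first exact: truncnS_gt.
rewrite ler_nat; near: m; exact: nbhs_infty_ge.
Unshelve. all: by end_near. Qed.

Lemma near_ge_id k : \forall m \near \oo, (k <= m)%N.
Proof. exact: nbhs_infty_ge. Qed.

Lemma natmxK m X : (0 < m)%N -> m%:R *: (m%:R^-1 *: X) = X.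
Proof. by move=> m0; rewrite scalerA divff ?scale1r // pnatr_eq0 -lt0n. Qed.

Lemma tends_pow_id (h : nat -> M) Z :
  tends \oo (fun m : nat => m%:R *: (h m - 1)) Z -> tends \oo (fun m => h m ^+ m) (expm Z).
Proof. exact: (tends_pow near_ge_id). Qed.

Lemma tends_1DV X : tends \oo (fun m : nat => (1 + m%:R^-1 *: X) ^+ m) (expm X).
Proof.
apply: tends_pow_id; apply: tends_near (tends_cst X).
by near=> m; rewrite [1 + _]addrC addrK natmxK //; near: m; exists 1%N.
Unshelve. all: by end_near. Qed.

Lemma expmD_comm X Y : X * Y = Y * X -> expm (X + Y) = expm X * expm Y.
Proof.
move=> XY; pose h m : M := (1 + m%:R^-1 *: X) * (1 + m%:R^-1 *: Y).
have hE : tends \oo (fun m => h m ^+ m) (expm X * expm Y).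
  apply: tends_near (tends_mulmx (tends_1DV X) (tends_1DV Y)).
  apply: nearW => m; rewrite /h exprMn_comm //.
  rewrite /GRing.comm mulrDl [RHS]mulrDl !mulrDr !mulr1 !mul1r.
  rewrite -!scalerAl -!scalerAr XY.
  by rewrite -!addrA; congr (_ + _); rewrite addrCA.
apply: tends_unique (tends_pow_id _) hE.
have -> : X + Y = (X + Y) + 0 *: (X * Y) by rewrite scale0r addr0.
apply: (@tends_near _ _ _ _ _ _ (fun m : nat => (X + Y) + m%:R^-1 *: (X * Y))).
  near=> m; have m0 : (0 < m)%N by near: m; exists 1%N.
  have -> : h m - 1 = m%:R^-1 *: (X + Y + m%:R^-1 *: (X * Y)); last by rewrite natmxK.
  rewrite /h mulrDl mul1r mulrDr mulr1 -[1 + _ + _]addrA [1 + _]addrC addrK.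
  by rewrite -scalerAl -scalerAr !scalerDr addrA [m%:R^-1 *: Y + _]addrC.
apply: tendsD; first exact: tends_cst.
by apply: tendsZ; [exact: ctends_invn | exact: tends_cst].
Unshelve. all: by end_near. Qed.

Lemma expm_mulN X : expm X * expm (- X) = 1.
Proof. by rewrite -expmD_comm ?subrr ?expm0 // mulrN mulNr. Qed.

Lemma expm_unit X : expm X \in unitmx.
Proof.
rewrite unitmxE; apply/unitrPr; exists (\det (expm (- X))).
by rewrite -det_mulmx -[_ *m _]/(expm X * expm (- X)) expm_mulN det1.
Qed.

Lemma expmN X : expm (- X) = (expm X)^-1.
Proof. by apply: (mulrI (expm_unit X)); rewrite expm_mulN divrr // expm_unit. Qed.

Lemma expmMn X k : expm X ^+ k = expm (k%:R *: X).
Proof.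
elim: k => [|k IH]; first by rewrite expr0 scale0r expm0.
rewrite exprSr IH -expmD_comm; last by rewrite -scalerAl -scalerAr.
by congr expm; rewrite mulrSr scalerDl scale1r.
Qed.

Lemma expm_root X m : (0 < m)%N -> expm (m%:R^-1 *: X) ^+ m = expm X.
Proof. by move=> m0; rewrite expmMn natmxK. Qed.

Lemma expm_conj A X : A \in unitmx -> A * expm X * A^-1 = expm (A * X * A^-1).
Proof.
move=> Au.
have hE : tends \oo (fun m : nat => (A * (1 + m%:R^-1 *: X) * A^-1) ^+ m) (A * expm X * A^-1).
  apply: (@tends_near _ _ _ _ _ _ (fun m : nat => A * (1 + m%:R^-1 *: X) ^+ m * A^-1)).
    apply: nearW => m; elim: m {1 3}m => [|k IH] m; first by rewrite !expr0 mulr1 divrr.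
    by rewrite !exprS -IH !mulrA divrK.
  apply: tends_mulmx; last exact: tends_cst.
  apply: tends_mulmx; [exact: tends_cst | exact: tends_1DV].
apply: tends_unique hE _; apply: tends_pow_id.
apply: (@tends_near _ _ _ _ _ _ (fun=> A * X * A^-1)); last exact: tends_cst.
near=> m; have m0 : (0 < m)%N by near: m; exists 1%N.
rewrite mulrDr mulr1 mulrDl divrr // [1 + _]addrC addrK -scalerAr -scalerAl.
by rewrite natmxK.
Unshelve. all: by end_near. Qed.

Lemma expm_adj X : (expm X) ^t* = expm (X ^t* ).
Proof.
have hE : tends \oo (fun m : nat => ((1 + m%:R^-1 *: X) ^+ m) ^t* ) ((expm X) ^t* ).
  by apply: tends_adj; exact: tends_1DV.
suff hE' : tends \oo (fun m : nat => ((1 + m%:R^-1 *: X) ^+ m) ^t* ) (expm (X ^t* )).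
  exact: (tends_unique hE hE').
apply: (@tends_near _ _ _ _ _ _ (fun m : nat => (1 + m%:R^-1 *: X ^t* ) ^+ m)); last first.
  exact: tends_1DV.
apply: nearW => m.
have -> : 1 + m%:R^-1 *: X ^t* = (1 + m%:R^-1 *: X) ^t*.
  by rewrite adjD adjZ adj1 fmorphV rmorph_nat.
by rewrite -adj_pow.
Qed.

Lemma expm_small X : exists2 C, 0 <= C & forall a, cabs a <= 1 ->
  nrm (expm (a *: X) - (1 + a *: X)) <= C * cabs a ^+ 2.
Proof.
pose c : R := nrm (1 : M) + 1; have c0 : 0 <= c by rewrite addr_ge0 ?nrm_ge0.
have x0 := nrm_ge0 X.
exists (c * (expR (nrm X) * nrm X ^+ 2)).
  by rewrite !mulr_ge0 ?expR_ge0 ?exprn_ge0.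
move=> a a1; apply: le_trans (expm_first _) _; rewrite -/c nrmZ.
have -> : c * (expR (nrm X) * nrm X ^+ 2) * cabs a ^+ 2 =
    c * (expR (nrm X) * (cabs a * nrm X) ^+ 2) by ring.
rewrite ler_wpM2l // ler_wpM2r ?exprn_ge0 ?mulr_ge0 ?cabs_ge0 //.
by rewrite ler_expR ler_piMl.
Qed.

Lemma tends_expm_diff X : tends \oo (fun m : nat => m%:R *: (expm (m%:R^-1 *: X) - 1)) X.
Proof.
have [C C0 hC] := expm_small X.
move=> e e0; near=> m; have m0 : (0 < m)%N by near: m; exists 1%N.
have m1 : 0 < m%:R :> R by rewrite ltr0n.
have cm : cabs (m%:R^-1 : R[i]) = m%:R^-1.
  by rewrite cabsV -(rmorph_nat (real_complex R)) cabsR ger0_norm // ltW.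
rewrite -{2}(natmxK X m0) -scalerBr -addrA -opprD nrmZ.
have -> : cabs (m%:R : R[i]) = m%:R.
  by rewrite -[m%:R]invrK cabsV cm invrK.
have hm : m%:R^-1 <= 1 :> R by rewrite invf_le1 // ler1n.
apply: le_lt_trans (ler_wpM2l (ltW m1) (hC _ _)) _; first by rewrite cm.
have -> : m%:R * (C * cabs (m%:R^-1 : R[i]) ^+ 2) = C / m%:R.
  by rewrite cm; field; rewrite gt_eqF.
rewrite ltr_pdivrMr // mulrC -ltr_pdivrMr //.
apply: (@lt_le_trans _ _ (Num.truncn (C / e)).+1%:R); first exact: truncnS_gt.
rewrite ler_nat; near: m; exact: nbhs_infty_ge.
Unshelve. all: by end_near. Qed.

Lemma real_invn m : ((m%:R^-1 : R)%:C)%C = m%:R^-1 :> R[i].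
Proof. by rewrite fmorphV rmorph_nat. Qed.

Lemma expm_inj X Y : (forall t : R, expm ((t%:C)%C *: X) = expm ((t%:C)%C *: Y)) -> X = Y.
Proof.
move=> h; apply: tends_unique (tends_expm_diff X) _.
apply: tends_near (tends_expm_diff Y); apply: nearW => m.
by rewrite -real_invn h.
Qed.

End ExpmTheory.

(** * Subgroups near 1 and connectedness *)

Section Subgroups.
Context {R : realType} {n : nat}.
Local Notation M := 'M[R[i]]_n.+1.
Implicit Types (X Y Z A g h : M) (G H : set M).

Definition subgroup G : Prop :=
  [/\ G 1, forall g h, G g -> G h -> G (g * h), forall g, G g -> G g^-1
    & forall g, G g -> g \in unitmx].

Lemma subgroupX G g k : subgroup G -> G g -> G (g ^+ k).
Proof.
case=> G1 GM _ _ Gg; elim: k => [|k IH]; first by rewrite expr0.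
by rewrite exprS; exact: GM.
Qed.

(** Relative closedness is tested with all proper filters on [nat], so that ultrafilter limits are
    included. *)
Definition limit_closed_in G H : Prop :=
  forall (F : set_system nat) (f : nat -> M) A, ProperFilter F ->
    tends F f A -> (\forall t \near F, H (f t)) -> G A -> H A.

Lemma tends_shrink (f : nat -> M) A :
  (forall k, nrm (f k - A) < k.+1%:R^-1) -> tends \oo f A.
Proof.
move=> fA e e0; near=> k; apply: lt_le_trans (fA k) _.
rewrite invf_ple ?posrE ?ltr0n //.
apply: (@le_trans _ _ (Num.truncn e^-1).+1%:R); first exact/ltW/truncnS_gt.
rewrite ler_nat; near: k; exact: (near_ge_id (Num.truncn e^-1)).
Unshelve. all: by end_near. Qed.

Lemma near_subgroup G H : subgroup G -> subgroup H -> H `<=` G ->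
  limit_closed_in [set A | A \in unitmx] G -> limit_closed_in G H ->
  (forall X, (forall t : R, G (expm ((t%:C)%C *: X))) ->
     forall t : R, H (expm ((t%:C)%C *: X))) ->
  exists2 d : R, 0 < d & forall g, G g -> nrm (g - 1) < d -> H g.
Proof.
move=> gG gH HG clG clH lieH; apply: contrapT => Hn.
have [G1 GM GV Gu] := gG; have [H1 HM HV Hu] := gH.
have step k : exists h, [/\ G h, ~ H h, nrm (h - 1) < k.+1%:R^-1 &
    forall x, H x -> nrm (h - 1) / 2 <= nrm (x * h - 1)].
  have [g [Gg Hg gk]] : exists g, [/\ G g, ~ H g & nrm (g - 1) < k.+1%:R^-1].
    apply: contrapT => hn; apply: Hn; exists k.+1%:R^-1; first by rewrite invr_gt0.
    by move=> g Gg gk; apply: contrapT => Hg; apply: hn; exists g.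
  pose D := [set nrm (x * g - 1) | x in H].
  have D1 : D (nrm (g - 1)) by exists 1; rewrite ?mul1r.
  have lbD : lbound D 0 by move=> _ [x _ <-]; exact: nrm_ge0.
  have iD : has_inf D by split; [exists (nrm (g - 1)) | exists 0].
  pose d := inf D.
  have dle x : H x -> d <= nrm (x * g - 1).
    by move=> Hx; apply: ge_inf; [exists 0 | exists x].
  (* If the infimum were 0, elements of H would converge to g^-1, which would then lie in H because
     H is closed in G. *)
  have d0 : 0 < d.
    rewrite lt_neqAle lb_le_inf //; last by exists (nrm (g - 1)).
    rewrite andbT eq_sym; apply/eqP => dE; apply: Hg.
    have ex j : exists x, H x /\ nrm (x * g - 1) < j.+1%:R^-1.
      have j0 : 0 < j.+1%:R^-1 :> R by rewrite invr_gt0.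
      by have [_ [x Hx <-]] := inf_adherent j0 iD; rewrite -/d dE add0r => xj; exists x.
    have [x hx] := choice ex.
    have gV : tends \oo x g^-1.
      have : tends \oo x (1 *m g^-1).
        apply: (tends_near _ (tends_mulmx (tends_shrink (fun j => (hx j).2)) (tends_cst g^-1))).
        apply: nearW => j.
        by have gu := Gu g Gg; rewrite -[LHS]/(x j * g * g^-1) mulrK.
      by rewrite mul1mx.
    have : H g^-1.
      apply: clH gV _ (GV _ Gg).
      by apply: nearW => j; case: (hx j).
    by move=> /HV; rewrite invrK.
  (* A tolerance of at most d makes the chosen distance less than 2 d, hence the factor 2; the other
     bound keeps it below 1/(k+1). *)
  have e0 : 0 < Num.min d (k.+1%:R^-1 - d).
    by rewrite lt_min d0 subr_gt0 (le_lt_trans _ gk) // -[g]mul1r dle.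
  have [_ [x Hx <-]] := inf_adherent e0 iD.
  rewrite -/d -ltrBlDl lt_min !ltrBlDl subrKC => /andP[xd xk].
  exists (x * g); split=> //; first exact/GM/Gg/HG.
    move=> Hxg; apply: Hg; rewrite -[g](mulKr (Hu _ Hx)).
    by apply: HM => //; exact: HV.
  move=> y Hy; rewrite mulrA; apply: le_trans (dle _ (HM _ _ Hy Hx)).
  by rewrite ler_pdivrMr // mulr_natr mulr2n ltW.
have {step} [h hP] := choice step.
have h1 : tends \oo h 1 by apply: tends_shrink => k; case: (hP k).
pose r k := nrm (h k - 1).
have r0 k : 0 < r k.
  rewrite nrm_gt0 subr_eq0; apply/eqP => hk.
  by case: (hP k) => _ + _ _; rewrite hk.
pose Z k : M := ((r k)^-1%:C)%C *: (h k - 1).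
have rcp (a : R) : 0 < a -> cabs (a%:C)%C = a by move=> a0; rewrite cabsR gtr0_norm.
have Z1 k : nrm (Z k) = 1.
  by rewrite /Z nrmZ rcp ?invr_gt0 // mulVf // gt_eqF.
have hZ k : h k - 1 = ((r k)%:C)%C *: Z k.
  by rewrite /Z scalerA -rmorphM /= divff ?gt_eqF // scale1r.
have [F [FU ooF]] := ultra_seq.
have [W ZW] : exists W, tends F Z W.
  by apply: (ultra_tends (B := 1)); apply: nearW => k; rewrite Z1.
have h1F := tends_sub ooF h1.
have rF e : 0 < e -> \forall k \near F, r k < e by move=> e0; exact: h1F.
have posG (t : R) : 0 < t -> G (expm ((t%:C)%C *: W)).
  (* With this exponent m r tends to t, so m (h - 1) tends to t W and h^m to exp (t W). *)
  move=> t0; pose m k := Num.truncn (t / r k).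
  have mr k : (m k)%:R * r k <= t < (m k).+1%:R * r k.
    rewrite -ler_pdivlMr // -ltr_pdivrMr // truncnS_gt andbT.
    by rewrite truncn_le // divr_ge0 // ltW.
  apply: (clG F (fun k => h k ^+ m k)); last exact: expm_unit.
    apply: tends_pow => [j|].
      have e0 : 0 < t / j.+1%:R by rewrite divr_gt0.
      apply: filterS (rF _ e0) => k rk.
      rewrite -ltnS -(ltr_nat R) -(ltr_pM2r (r0 k)).
      apply: lt_trans (andP (mr k)).2.
      rewrite ltr_pdivlMr // in rk; apply: le_lt_trans rk.
      by rewrite mulrC ler_pM2l // ler_nat.
    apply: (@tends_near _ _ _ _ _ _ (fun k => (((m k)%:R * r k)%:C)%C *: Z k)).
      by apply: nearW => k; rewrite [in RHS]hZ scalerA rmorphM rmorph_nat.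
    apply: tendsZ => // e e0; apply: filterS (rF _ e0) => k rk.
    rewrite -rmorphB cabsR distrC ger0_norm; last by rewrite subr_ge0 (andP (mr k)).1.
    apply: lt_trans rk; rewrite ltrBlDr; have := (andP (mr k)).2.
    by rewrite -addn1 natrD mulrDl mul1r addrC.
  by apply: nearW => k; apply: subgroupX => //; case: (hP k).
have lieW (t : R) : G (expm ((t%:C)%C *: W)).
  have [t0|t0|<-] := ltgtP 0 t; [exact: posG| |by rewrite scale0r expm0].
  rewrite -[t]opprK rmorphN scaleNr expmN; apply: GV; apply: posG.
  by rewrite oppr_gt0.
have HW := lieH W lieW.
have [C C0 hC] := expm_small W.
have B0 : 0 < C * 2 * (nrm (1 : M) + 1) + 1.
  by rewrite ltr_wpDl // !mulr_ge0 // addr_ge0 ?nrm_ge0.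
have W0 := nrm_ge0 W.
(* Three error terms, each at most r/8, stay together below the r/2 that the choice of [h k]
   forbids. *)
have e1 : 0 < 1 / 8 / (C * (nrm (1 : M) + 1) + 1) :> R.
  by rewrite !divr_gt0 // ltr_wpDl // mulr_ge0 // addr_ge0 ?nrm_ge0.
have e2 : 0 < 1 / 8 / (nrm W + 1) :> R by rewrite !divr_gt0 // ltr_wpDl.
have e3 : 0 < 1 / 8 :> R by rewrite divr_gt0.
have e4 : 0 < 1 :> R by [].
have [k [[k1 k2] [k3 k4]]] := @filter_ex _ F _ _
  (filterI (filterI (rF _ e1) (rF _ e2)) (filterI (ZW _ e3) (rF _ e4))).
have [_ _ _ hmin] := hP k.
have := hmin (expm (((- r k)%:C)%C *: W)) (HW _).
rewrite -/(r k) leNgt => /negP; apply.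
pose E : M := expm (((- r k)%:C)%C *: W) - (1 + ((- r k)%:C)%C *: W).
have Eb : nrm E <= C * r k ^+ 2.
  by have := hC ((- r k)%:C)%C; rewrite cabsR normrN gtr0_norm // => /(_ (ltW k4)).
have hb : nrm (h k) <= nrm (1 : M) + 1.
  rewrite -(subrK 1 (h k)) addrC; apply: le_trans (nrmD _ _) _.
  by rewrite lerD2l ltW.
have -> : expm (((- r k)%:C)%C *: W) * h k - 1 =
    E * h k + (((r k)%:C)%C *: (Z k - W) - ((r k)%:C)%C *: (W * (h k - 1))).
  rewrite /E mulrBl mulrDl mul1r scalerBr -hZ rmorphN !scaleNr !mulNr.
  rewrite mulrBr mulr1 scalerBr scalerAl; set a := _ *: W.
  move: (h k) a (a * h k) (expm _ * _) => v a w u.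
  by rewrite !opprD !opprK !addrA; apply/matrixP => ? ?; rewrite !mxE; ring.
apply: le_lt_trans (nrmD _ _) _; apply: le_lt_trans (lerD (nrmM _ _) (nrmD _ _)) _.
rewrite nrmN !nrmZ !rcp // -/(r k).
have h2 : nrm (W * (h k - 1)) <= nrm W * r k by exact: nrmM.
have h3 : nrm E * nrm (h k) <= C * r k ^+ 2 * (nrm (1 : M) + 1).
  by apply: ler_pM; rewrite ?nrm_ge0.
rewrite ltr_pdivlMr ?ltr_wpDl // in k1; last by rewrite mulr_ge0 // addr_ge0 ?nrm_ge0.
rewrite ltr_pdivlMr ?ltr_wpDl // in k2.
have h4 : C * r k ^+ 2 * (nrm (1 : M) + 1) <= r k * (1 / 8).
  apply: (@le_trans _ _ (r k * (r k * (C * (nrm (1 : M) + 1) + 1)))).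
    have -> : C * r k ^+ 2 * (nrm (1 : M) + 1) = r k * (r k * (C * (nrm (1 : M) + 1))) by ring.
    by rewrite ler_pM2l // ler_pM2l // lerDl.
  by rewrite ler_pM2l // ltW.
have h5 : r k * (nrm W * r k) <= r k * (1 / 8).
  rewrite ler_pM2l // mulrC; apply: le_trans (ltW k2).
  by rewrite ler_pM2l // lerDl.
have h6 : r k * nrm (Z k - W) < r k * (1 / 8) by rewrite ltr_pM2l.
have h7 : r k * nrm (W * (h k - 1)) <= r k * (nrm W * r k) by rewrite ler_pM2l.
have := r0 k; lra.
Qed.

(** The equivalence in the hypothesis makes both P and its complement relatively open in G. *)
Lemma connected_subgroup G (P : set M) : connected G -> subgroup G -> P 1 ->
  (exists2 d : R, 0 < d & forall g h, G g -> G h -> nrm (h - 1) < d -> P g <-> P (g * h)) ->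
  G `<=` P.
Proof.
move=> cG gG P1 [d d0 dP]; have [G1 GM GV Gu] := gG.
have near g : G g -> exists2 e : R, 0 < e &
    forall h, G h -> nrm (h - g) < e -> (P g <-> P h).
  move=> Gg; exists (d / (nrm g^-1 + 1)); first by rewrite divr_gt0 // ltr_wpDl ?nrm_ge0.
  move=> h Gh hg; have -> : h = g * (g^-1 * h) by rewrite mulVKr ?Gu.
  apply: dP => //; first by apply: GM => //; exact: GV.
  have -> : g^-1 * h - 1 = g^-1 * (h - g) by rewrite mulrBr mulVr ?Gu.
  apply: le_lt_trans (nrmM _ _) _; rewrite ltr_pdivlMr ?ltr_wpDl ?nrm_ge0 // in hg.
  by apply: le_lt_trans hg; rewrite mulrC ler_wpM2l ?nrm_ge0 // lerDl.
have op (Q : set M) : (forall g, G g -> exists2 e : R, 0 < e &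
    forall h, G h -> nrm (h - g) < e -> (Q g <-> Q h)) ->
    exists2 C, open C & G `&` Q = G `&` C.
  move=> Qn; pose C := [set x | exists g, [/\ G g, Q g & exists2 e : R, 0 < e &
     nrm (x - g) < e /\ forall h, G h -> nrm (h - g) < e -> Q h]].
  exists C.
    rewrite openE => x [g [Gg Qg [e e0 [xg eQ]]]].
    apply/nbhs_nrmP; exists (e - nrm (x - g)); first by rewrite subr_gt0.
    move=> y yx; exists g; split=> //; exists e => //; split=> //.
    apply: le_lt_trans (nrm_triangle x _ _) _.
    by rewrite -ltrBrDr.
  apply/seteqP; split=> [g [Gg Qg]|g [Gg [h [_ _ [e e0 [gh eQ]]]]]]; split=> //.
    exists g; split=> //; have [e e0 eQ] := Qn g Gg; exists e => //.
    by rewrite subrr nrm0; split=> // h Gh /(eQ _ Gh) <-.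
  exact: eQ.
have [C oC PC] := op P near.
have [D oD PD] : exists2 C, open C & G `&` ~` P = G `&` C.
  apply: op => g Gg; have [e e0 eP] := near g Gg; exists e => // h Gh hg.
  by have [h1 h2] := eP h Gh hg; split=> nP q; apply: nP; [exact: h2 | exact: h1].
suff -> : G = G `&` P by move=> g [].
apply/esym/cG; first by exists 1.
  by exists C.
exists (~` D); first exact: open_closedC.
apply/seteqP; split=> g [Gg Pg]; split=> //.
  by move=> Dg; have [_] : (G `&` ~` P) g by rewrite PD.
by apply: contrapT => nPg; apply: Pg; have [] : (G `&` D) g by rewrite -PD.
Qed.

End Subgroups.

(** * Differentials of regular maps *)

Section Differentials.
Context {R : realType} {n : nat}.
Local Notation M := 'M[R[i]]_n.+1.
Implicit Types (X Y Z A g h : M) (G H : set M).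

Lemma mx_norm_le_nrm X : mx_norm X <= ((nrm X)%:C)%C.
Proof.
rewrite mx_normE; have h0 : 0 <= ((nrm X)%:C)%C by rewrite ler0c nrm_ge0.
rewrite -[leRHS]/((NngNum h0)%:num) num_le; apply/bigmax_leP; split=> [|[i j] _].
  by rewrite -num_le /=.
by rewrite -num_le /= normcE lecR cabs_le_nrm.
Qed.

Lemma entry_le_mx_norm X i j : `|X i j| <= mx_norm X.
Proof.
rewrite mx_normE; have h0 : 0 <= `|X i j| by [].
rewrite -[leLHS]/((NngNum h0)%:num) num_le.
by apply/bigmax_geP; right; exists (i, j) => //; rewrite -num_le /=.
Qed.

Lemma nrm_le_mx_norm X : ((nrm X)%:C)%C <= (n.+1 * n.+1)%:R * mx_norm X.
Proof.
rewrite /nrm rmorph_sum /=.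
apply: (@le_trans _ _ (\sum_(i < n.+1) \sum_(j < n.+1) mx_norm X)).
  apply: ler_sum => i _; rewrite rmorph_sum /=; apply: ler_sum => j _.
  exact: entry_le_mx_norm.
by rewrite !sumr_const !card_ord -mulrnA mulr_natl.
Qed.

Lemma differentiable_nrm (F : M -> M) A : differentiable F A ->
  exists L : {linear M -> M}, forall e : R, 0 < e ->
    exists2 d : R, 0 < d & forall X, nrm X < d ->
      nrm (F (X + A) - (F A + L X)) <= e * nrm X.
Proof.
move=> dF; exists ('d F A) => e e0.
pose e' := e / (n.+1 * n.+1)%:R.
have e'0 : 0 < e' by rewrite divr_gt0 // ltr0n.
have := diff_locally dF => /eqaddoP.
have e'C : 0 < (e'%:C)%C :> R[i] by rewrite ltcR.
move=> /(_ _ e'C) /nbhs_nrmP[d d0 dP]; exists d => // X Xd.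
have := dP X; rewrite subr0 => /(_ Xd) h.
rewrite -lecR; apply: le_trans (nrm_le_mx_norm _) _.
rewrite -ler_pdivlMl ?ltr0n //; apply: le_trans h _.
apply: le_trans (ler_wpM2l (ltW e'C) (mx_norm_le_nrm X)) _.
by rewrite -(rmorph_nat (real_complex R)) -fmorphV -!rmorphM lecR /e' mulrAC mulrC.
Qed.

Lemma tends_1 (h : nat -> M) X : tends \oo (fun m : nat => m%:R *: (h m - 1)) X ->
  tends \oo h 1.
Proof.
move=> hX; have : tends \oo (fun m : nat => 1 + m%:R^-1 *: (m%:R *: (h m - 1))) (1 + 0 *: X).
  by apply: tendsD; [exact: tends_cst | apply: tendsZ; [exact: ctends_invn |]].
rewrite scale0r addr0; apply: tends_near; near=> m.
rewrite scalerA mulVf ?scale1r 1?addrC ?subrK // pnatr_eq0 -lt0n.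
by near: m; exists 1%N.
Unshelve. all: by end_near. Qed.

(* The differential at 1, along sequences that approach 1 in a given direction. *)
Definition cdiff1 (f : M -> R[i]) (l : M -> R[i]) : Prop :=
  forall (h : nat -> M) X, tends \oo (fun m : nat => m%:R *: (h m - 1)) X ->
    ctends \oo (fun m : nat => m%:R * (f (h m) - f 1)) (l X).

Lemma cdiff1_ctends f l (h : nat -> M) X : cdiff1 f l ->
  tends \oo (fun m : nat => m%:R *: (h m - 1)) X -> ctends \oo (f \o h) (f 1).
Proof.
move=> fl hX; have : ctends \oo (fun m : nat => f 1 + m%:R^-1 * (m%:R * (f (h m) - f 1))) (f 1 + 0 * l X).
  apply: ctendsD; first exact: ctends_cst.
  by apply: ctendsM; [exact: ctends_invn | exact: fl].
rewrite mul0r addr0; apply: ctends_near; near=> m.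
rewrite mulKf; first by rewrite addrC subrK.
by rewrite pnatr_eq0 -lt0n; near: m; exists 1%N.
Unshelve. all: by end_near. Qed.

Lemma cdiff1_cst c : cdiff1 (fun=> c) (fun=> 0).
Proof.
move=> h X hX; apply: ctends_near (ctends_cst 0).
by apply: nearW => m; rewrite subrr mulr0.
Qed.

Lemma cdiff1_coef i j : cdiff1 (fun g => g i j) (fun X => X i j).
Proof.
move=> h X /tendsP/(_ i j); apply: ctends_near.
by apply: nearW => m; rewrite !mxE.
Qed.

Lemma cdiff1D f1 f2 l1 l2 : cdiff1 f1 l1 -> cdiff1 f2 l2 ->
  cdiff1 (fun g => f1 g + f2 g) (fun X => l1 X + l2 X).
Proof.
move=> d1 d2 h X hX; apply: ctends_near (ctendsD (d1 h X hX) (d2 h X hX)).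
by apply: nearW => m; rewrite -mulrDr opprD addrACA.
Qed.

Lemma cdiff1M f1 f2 l1 l2 : cdiff1 f1 l1 -> cdiff1 f2 l2 ->
  cdiff1 (fun g => f1 g * f2 g) (fun X => f1 1 * l2 X + f2 1 * l1 X).
Proof.
move=> d1 d2 h X hX.
apply: (ctends_near _ (ctendsD (ctendsM (cdiff1_ctends d1 hX) (d2 h X hX))
  (ctendsZ (f2 1) (d1 h X hX)))).
by apply: nearW => m /=; ring.
Qed.

Lemma cdiff1V f l : f 1 != 0 -> cdiff1 f l ->
  cdiff1 (fun g => (f g)^-1) (fun X => (- (f 1)^-1 ^+ 2) * l X).
Proof.
move=> f0 d h X hX; have fc := cdiff1_ctends d hX.
rewrite expr2; apply: (ctends_near _ (ctendsM (ctendsN (ctendsZ (f 1)^-1 (ctendsV f0 fc)))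
  (d h X hX))).
apply: filterS (ctends_neq0 f0 fc) => m /= fm0.
by field; rewrite fm0 f0.
Qed.

Lemma cdiff1_sum (I : Type) (r : seq I) (f l : I -> M -> R[i]) :
  (forall i, cdiff1 (f i) (l i)) ->
  cdiff1 (fun g => \sum_(i <- r) f i g) (fun X => \sum_(i <- r) l i X).
Proof.
move=> d; elim: r => [|i r IH].
  move=> h X hX; rewrite [X in ctends _ _ X]big_nil; apply: ctends_near (ctends_cst 0).
  by apply: nearW => m; rewrite !big_nil subrr mulr0.
move=> h X hX; rewrite [X in ctends _ _ X]big_cons; apply: ctends_near (cdiff1D (d i) IH hX).
by apply: nearW => m; rewrite !big_cons.
Qed.

Definition scalar_linear (l : M -> R[i]) : Prop :=
  forall a X Y, l (a *: X + Y) = a * l X + l Y.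

Lemma cdiff1_prod (I : Type) (r : seq I) (f l : I -> M -> R[i]) :
  (forall i, cdiff1 (f i) (l i)) -> (forall i, scalar_linear (l i)) ->
  exists2 l', scalar_linear l' & cdiff1 (fun g => \prod_(i <- r) f i g) l'.
Proof.
move=> d ll; elim: r => [|i r [l' ll' IH]].
  exists (fun=> 0); first by move=> a X Y; rewrite mulr0 addr0.
  move=> h X hX; apply: ctends_near (cdiff1_cst 1 hX).
  by apply: nearW => m; rewrite !big_nil.
exists (fun X => f i 1 * l' X + (\prod_(j <- r) f j 1) * l i X).
  by move=> a X Y; rewrite ll' ll; ring.
move=> h X hX; apply: ctends_near (cdiff1M (d i) IH hX).
by apply: nearW => m; rewrite !big_cons.
Qed.

Lemma cdiff1_det : exists2 l, scalar_linear l & cdiff1 (fun g => \det g) l.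
Proof.
have H (s : 'S_n.+1) : exists2 l, scalar_linear l &
    cdiff1 (fun g : M => (-1) ^+ s * \prod_i g i (s i)) l.
  have sl i : scalar_linear (fun X => X i (s i)) by move=> a X Y; rewrite !mxE.
  have [l ll dl] := cdiff1_prod (index_enum _) (fun i => cdiff1_coef i (s i)) sl.
  exists (fun X => (-1) ^+ s * l X + (\prod_i (1 : M) i (s i)) * 0).
    by move=> a X Y; rewrite ll !mulr0 !addr0 mulrDr mulrCA.
  exact: cdiff1M (cdiff1_cst _) dl.
have [l lP] := choice (fun s => let: ex_intro2 l a b := H s in
  ex_intro (fun l => scalar_linear l /\ _) l (conj a b)).
exists (fun X => \sum_(s : 'S_n.+1) l s X).
  move=> a X Y; rewrite mulr_sumr -big_split; apply: eq_bigr => s _.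
  by case: (lP s).
by apply: cdiff1_sum => s; case: (lP s).
Qed.

Lemma regular_cdiff1 f : regular_fun f -> exists2 l, scalar_linear l & cdiff1 f l.
Proof.
elim=> [c|i j||f1 f2 _ [l1 s1 d1] _ [l2 s2 d2]|f1 f2 _ [l1 s1 d1] _ [l2 s2 d2]].
- by exists (fun=> 0); [move=> a X Y; rewrite mulr0 addr0 | exact: cdiff1_cst].
- by exists (fun X => X i j); [move=> a X Y; rewrite !mxE | exact: cdiff1_coef].
- have [l sl dl] := cdiff1_det; exists (fun X => (- (\det (1 : M))^-1 ^+ 2) * l X).
    by move=> a X Y; rewrite sl; ring.
  by apply: cdiff1V => //; rewrite det1 oner_eq0.
- exists (fun X => l1 X + l2 X); first by move=> a X Y; rewrite s1 s2; ring.
  exact: cdiff1D.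
exists (fun X => f1 1 * l2 X + f2 1 * l1 X).
  by move=> a X Y; rewrite s1 s2; ring.
exact: cdiff1M.
Qed.

Lemma regular_tends f T (F : set_system T) {FF : Filter F} (h : T -> M) A :
  regular_fun f -> A \in unitmx -> tends F h A -> ctends F (fun t => f (h t)) (f A).
Proof.
move=> rf Au hA; elim: rf => [c|i j||f1 f2 _ h1 _ h2|f1 f2 _ h1 _ h2].
- exact: ctends_cst.
- by move/tendsP: hA; exact.
- by apply: ctendsV (ctends_det hA); rewrite -unitfE -unitmxE.
- exact: ctendsD.
exact: ctendsM.
Qed.

End Differentials.

(** * Homomorphisms of matrix groups and their differentials *)

Section GroupMaps.
Context {R : realType} {n : nat}.
Local Notation M := 'M[R[i]]_n.+1.
Implicit Types (X Y Z A g h : M) (G H : set M).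

Definition in_lie G X : Prop := forall t : R, G (expm ((t%:C)%C *: X)).

Lemma zariski_unit G : zariski_closed G -> G `<=` [set A | A \in unitmx].
Proof. by case=> I _ -> g []. Qed.

Lemma zariski_limit_closed G : zariski_closed G -> limit_closed_in [set A | A \in unitmx] G.
Proof.
case=> I regI -> F f A PF fA nG /= Au; split=> // p Ip.
have h : ctends F (fun t => p (f t)) (p A) by exact: regular_tends (regI _ Ip) Au fA.
have h0 : ctends F (fun t => p (f t)) 0.
  by apply: (ctends_near _ (ctends_cst 0)); apply: filterS nG => t [_ ->].
apply/eqP; rewrite -cabs_eq0 -[p A]subr0 eq_le cabs_ge0 andbT.
apply/ler_addgt0Pr => e e0; have e20 : 0 < e / 2 by rewrite divr_gt0.
have [t [h1 h2]] := @filter_ex _ F _ _ (filterI (h _ e20) (h0 _ e20)).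
rewrite add0r -(subrKA (p (f t))); apply: le_trans (cabsD _ _) _.
by rewrite [e]splitr cabsB; apply: lerD; exact: ltW.
Qed.

Lemma algebraic_is_subgroup G : algebraic_subgroup G -> subgroup G.
Proof. by case=> zG G1 GM GV; split=> // g /(zariski_unit zG). Qed.

(** Only sequences inside G are tested, so no manifold structure on G enters. *)
Definition diff_at_1 G (phi L : M -> M) : Prop :=
  forall (h : nat -> M) X, (forall m, G (h m)) ->
    tends \oo (fun m : nat => m%:R *: (h m - 1)) X ->
    tends \oo (fun m : nat => m%:R *: (phi (h m) - 1)) (L X).

Lemma involution1 G phi : subgroup G -> group_involution G phi -> phi 1 = 1.
Proof.
case=> G1 GM GV Gu [pG pM _]; have /Gu u1 := pG _ G1.
by apply: (mulrI u1); rewrite mulr1 -pM // mulr1.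
Qed.

Lemma involutionX G phi g k : subgroup G -> group_involution G phi -> G g ->
  phi (g ^+ k) = phi g ^+ k.
Proof.
move=> gG pG Gg; elim: k => [|k IH]; first by rewrite !expr0 (involution1 gG).
by rewrite !exprS -IH; case: pG => _ -> //; exact: subgroupX.
Qed.

(** phi (exp X) is the m-th power of phi (exp (X/m)) for every m > 0, and these powers converge to
    exp (L X) by [tends_pow]. *)
Lemma diff_expm G phi L X : subgroup G -> group_involution G phi -> diff_at_1 G phi L ->
  in_lie G X -> phi (expm X) = expm (L X).
Proof.
move=> gG pG dL lX; pose h m := expm (m%:R^-1 *: X).
have Gh m : G (h m) by rewrite /h -real_invn.
apply: tends_unique (tends_pow_id (dL h X Gh (tends_expm_diff X))).
apply: (@tends_near _ _ _ _ _ _ (fun=> phi (expm X))); last exact: tends_cst.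
near=> m; have m0 : (0 < m)%N by near: m; exists 1%N.
by rewrite -(involutionX _ gG pG) // /h expm_root.
Unshelve. all: by end_near. Qed.

Lemma regular_diff_at_1 G phi : subgroup G -> group_involution G phi ->
  (forall i j, regular_on G (fun g => phi g i j)) ->
  exists2 L, (forall a X Y, L (a *: X + Y) = a *: L X + L Y) & diff_at_1 G phi L.
Proof.
move=> gG pG regp.
have G1 : G 1 by case: gG.
have H (ij : 'I_n.+1 * 'I_n.+1) : exists l, scalar_linear l /\
    forall (h : nat -> M) X, (forall m, G (h m)) -> tends \oo (fun m : nat => m%:R *: (h m - 1)) X ->
    ctends \oo (fun m : nat => m%:R * (phi (h m) ij.1 ij.2 - (1 : M) ij.1 ij.2)) (l X).
  case: ij => i j /=; have [f rf fE] := regp i j.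
  have [l sl dl] := regular_cdiff1 rf; exists l; split=> // h X Gh hX.
  apply: ctends_near (dl h X hX); apply: nearW => m.
  by rewrite -!fE // (involution1 gG pG).
have [l lP] := choice H.
exists (fun X => \matrix_(i, j) l (i, j) X).
  by move=> a X Y; apply/matrixP => i j; rewrite !mxE; case: (lP (i, j)) => ->.
move=> h X Gh hX; apply/tendsP => i j; rewrite mxE.
have [_ d] := lP (i, j); apply: ctends_near (d h X Gh hX).
by apply: nearW => m; rewrite !mxE.
Qed.

Lemma tends_linear T (F : set_system T) {FF : Filter F} p q (L : {linear M -> 'M[R[i]]_(p, q)})
    (f : T -> M) A : tends F f A -> tends F (fun t => L (f t)) (L A).
Proof.
move=> /tendsP fA.
have LE B : L B = \sum_(i < n.+1) \sum_(j < n.+1) B i j *: L (delta_mx i j).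
  rewrite {1}[B]matrix_sum_delta linear_sum; apply: eq_bigr => i _.
  by rewrite linear_sum; apply: eq_bigr => j _; rewrite linearZ.
apply/tendsP => a b; rewrite LE summxE.
apply: (@ctends_near _ _ _ _ (fun t =>
    \sum_(i < n.+1) (\sum_(j < n.+1) f t i j *: L (delta_mx i j)) a b)).
  by apply: nearW => t; rewrite LE summxE.
apply: ctends_sum => i _; rewrite summxE.
apply: (@ctends_near _ _ _ _ (fun t =>
    \sum_(j < n.+1) f t i j * L (delta_mx i j) a b)).
  by apply: nearW => t; rewrite summxE; apply: eq_bigr => j _; rewrite mxE.
by apply: ctends_sum => j _; rewrite mxE; apply: ctendsM => //; exact: ctends_cst.
Qed.

(** Near 1, phi is the conjugate of a complex differentiable map; conjugating the complex-linear
    differential of that map makes L conjugate-linear. *)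
Lemma antiholomorphic_diff_at_1 G phi : subgroup G -> group_involution G phi ->
  antiholomorphic_on G phi ->
  exists2 L, (forall a X Y, L (a *: X + Y) = a^* *: L X + L Y) & diff_at_1 G phi L.
Proof.
move=> gG pG ah; have G1 : G 1 by case: gG.
have [F /nbhs_nrmP[d0 d00 FP]] := ah 1 G1.
have [dF F1] := FP 1 (ltac:(by rewrite subrr nrm0)).
have [L LP] := differentiable_nrm dF.
exists (fun X => map_mx Num.conj (L X)).
  by move=> a X Y; rewrite linearP; apply/matrixP => i j; rewrite !mxE rmorphD rmorphM.
move=> h X Gh hX; have h1 := tends_1 hX.
have F1E : map_mx Num.conj (F 1) = 1 by rewrite -(F1 G1) (involution1 gG).
have main : tends \oo (fun m : nat => m%:R *: (F (h m) - F 1)) (L X).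
  have LhX : tends \oo (fun m : nat => L (m%:R *: (h m - 1))) (L X) by exact: tends_linear.
  have rest : tends \oo (fun m : nat => m%:R *: (F (h m) - (F 1 + L (h m - 1)))) 0.
    move=> e e0; have X1 : 0 < nrm X + 1 by rewrite ltr_wpDl ?nrm_ge0.
    have e1 : 0 < e / 2 / (nrm X + 1) by rewrite !divr_gt0.
    have [d dgt0 dP] := LP _ e1.
    have ee : e / 2 < e by rewrite ltr_pdivrMr // ltr_pMr // ltr1n.
    have hX1 := hX _ ltr01.
    apply: filterS2 (h1 _ dgt0) hX1 => m hm hXm; rewrite subr0 nrmZ.
    have := dP _ hm; rewrite subrK => le.
    apply: le_lt_trans ee; apply: le_trans (ler_wpM2l (cabs_ge0 _) le) _.
    rewrite mulrCA -nrmZ -[leRHS](divfK (lt0r_neq0 X1)) ler_pM2l //.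
    rewrite -(subrK X (_ *: _)); apply: le_trans (nrmD _ _) _.
    by rewrite addrC lerD2l ltW.
  apply: (@tends_near _ _ _ _ _ _ (fun m : nat => m%:R *: (F (h m) - (F 1 + L (h m - 1)))
     + L (m%:R *: (h m - 1)))).
    apply: nearW => m; rewrite [L (_ *: _)]linearZ -scalerDr; congr (_ *: _).
    by rewrite opprD addrA subrK.
  by rewrite -[X in tends _ _ X]add0r; exact: tendsD.
have conjE (A B : M) (m : nat) : m%:R *: (map_mx Num.conj A - map_mx Num.conj B) =
    map_mx Num.conj (m%:R *: (A - B)).
  by apply/matrixP => i j; rewrite !mxE rmorphM rmorphB rmorph_nat.
apply: (@tends_near _ _ _ _ _ _ (fun m : nat => map_mx Num.conj (m%:R *: (F (h m) - F 1)))).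
  apply: filterS (h1 _ d00) => m hm; rewrite -conjE F1E; congr (_ *: (_ - _)).
  by have [_ ->] := FP _ hm.
move/tendsP: main => main; apply/tendsP => i j; rewrite mxE.
by apply: ctends_near (ctendsJ (main i j)); apply: nearW => m; rewrite [RHS]mxE.
Qed.

Lemma diff_at_1_comp G phi psi L L' : (forall g, G g -> G (phi g)) ->
  diff_at_1 G phi L -> diff_at_1 G psi L' -> diff_at_1 G (psi \o phi) (L' \o L).
Proof. by move=> pG dL dL' h X Gh hX; apply: (dL' (phi \o h)) => [m|]; [exact/pG/Gh | exact: dL]. Qed.

End GroupMaps.

(** * Invariant Hermitian forms *)

Section Hermitian.
Context {C : numClosedFieldType} {n : nat}.
Local Notation M := 'M[C]_n.+1.
Implicit Types (h q A B T : M) (x y : 'cV[C]_n.+1).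

Definition qform h x : C := (x ^t* *m h *m x) 0 0.
Definition herm h : Prop := h ^t* = h.
Definition posdef h : Prop := herm h /\ forall x, x != 0 -> 0 < qform h x.

Lemma herm_congr h A : herm h -> herm (A ^t* *m h *m A).
Proof. by move=> hh; rewrite /herm !adjM adjK hh mulmxA. Qed.

Lemma qformM h A x : qform (A ^t* *m h *m A) x = qform h (A *m x).
Proof. by rewrite /qform adjM !mulmxA. Qed.

Lemma qformD h q x : qform (h + q) x = qform h x + qform q x.
Proof. by rewrite /qform mulmxDr mulmxDl mxE. Qed.

Lemma qformZ a h x : qform (a *: h) x = a * qform h x.
Proof. by rewrite /qform -scalemxAr -scalemxAl mxE. Qed.

Lemma qform1 x : qform 1 x = \sum_i `|x i 0| ^+ 2.
Proof.
rewrite /qform mulmx1 mxE; apply: eq_bigr => i _.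
by rewrite !mxE mulrC -normCK.
Qed.

Lemma qform_diag (D : 'rV[C]_n.+1) x : qform (diag_mx D) x = \sum_i D 0 i * `|x i 0| ^+ 2.
Proof.
rewrite /qform mul_mx_diag mxE; apply: eq_bigr => i _.
by rewrite !mxE [_ * D 0 i]mulrC -mulrA [_ * x i 0]mulrC -normCK.
Qed.

Lemma qform_diag_delta (D : 'rV[C]_n.+1) i : qform (diag_mx D) (delta_mx i 0) = D 0 i.
Proof.
rewrite qform_diag (bigD1 i) //= big1 ?addr0; last first.
  by move=> j ji; rewrite mxE (negbTE ji) normr0 expr0n mulr0.
by rewrite mxE !eqxx normr1 expr1n mulr1.
Qed.

Lemma delta_neq0 (i : 'I_n.+1) : (delta_mx i 0 : 'cV[C]_n.+1) != 0.
Proof.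
by apply/eqP => /matrixP/(_ i 0); rewrite !mxE !eqxx; apply/eqP; rewrite oner_eq0.
Qed.

Lemma mulmx_neq0 A x : A \in unitmx -> x != 0 -> A *m x != 0.
Proof. by move=> Au; apply: contra_neq => Ax; rewrite -(mulKmx Au x) Ax mulmx0. Qed.

Lemma herm_diag h : herm h -> exists P (D : 'rV[C]_n.+1),
  [/\ P \in unitmx, P ^t* *m P = 1%:M & h = P ^t* *m diag_mx D *m P].
Proof.
move=> hh; have hn : h \is normalmx by apply/normalmxP; rewrite hh.
have Pu := spectral_unitarymx h.
exists (spectralmx h), (spectral_diag h); split.
- exact: unitarymx_unit.
- by rewrite -invmx_unitary // mulVmx // unitarymx_unit.
by have /orthomx_spectralP {1}-> := hn; rewrite invmx_unitary.
Qed.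

Lemma posdef_factor h : posdef h -> exists2 T, T \in unitmx & h = T ^t* *m T.
Proof.
case=> hh hp; have [P [D [Pu PP hE]]] := herm_diag hh.
have D0 i : 0 < D 0 i.
  have := hp (invmx P *m delta_mx i 0) (mulmx_neq0 _ (delta_neq0 i)).
  by rewrite unitmx_inv hE qformM mulKVmx // qform_diag_delta; apply.
pose E := \row_i sqrtC (D 0 i).
have EE : (diag_mx E) ^t* *m diag_mx E = diag_mx D.
  rewrite tr_diag_mx map_diag_mx mulmx_diag; congr diag_mx.
  apply/rowP => i; rewrite !mxE; have Dge := ltW (D0 i).
  by rewrite /= conj_Creal ?ger0_real ?sqrtC_ge0 // -expr2 sqrtCK.
exists (diag_mx E *m P); last by rewrite hE -EE adjM !mulmxA.
rewrite unitmx_mul Pu andbT unitmxE det_diag unitfE; apply/prodf_neq0 => i _.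
by rewrite mxE sqrtC_eq0 gt_eqF.
Qed.

(** With h = L^* L, the form q read in the frame L is diagonalized by a unitary W, and T = W L. *)
Lemma simultaneous_diag h q : posdef h -> herm q ->
  exists T (D : 'rV[C]_n.+1),
    [/\ T \in unitmx, h = T ^t* *m T & q = T ^t* *m diag_mx D *m T].
Proof.
move=> /posdef_factor[L Lu hE] hq.
have q'h : herm ((invmx L) ^t* *m q *m invmx L).
  by rewrite /herm !adjM adjK hq mulmxA.
have [W [D [Wu WW q'E]]] := herm_diag q'h.
exists (W *m L), D; split; first by rewrite unitmx_mul Wu.
  by rewrite adjM mulmxA -(mulmxA (L ^t* )) WW mulmx1.
have LL : L ^t* *m (invmx L) ^t* = 1%:M by rewrite -adjM mulVmx // adj1.
rewrite adjM !mulmxA -[X in X *m L]mulmxA -[X in X *m L]mulmxA (mulmxA (W ^t* )) -q'E.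
by rewrite !mulmxA LL mul1mx -mulmxA mulVmx // mulmx1.
Qed.

(** In a frame where h is the identity and B a diagonal D, A becomes E with E^2 = D^2, and X = E - D
    satisfies E X = - X D. A nonzero column of X would be an eigenvector of the nonnegative E with
    eigenvalue - D_j < 0. *)
Lemma psd_root_unique h A B : posdef h -> herm (h *m A) -> herm (h *m B) ->
  (forall x, 0 <= qform (h *m A) x) -> (forall x, 0 <= qform (h *m B) x) ->
  B \in unitmx -> A *m A = B *m B -> A = B.
Proof.
move=> hp hA hB pA pB Bu AB.
have [T [D [Tu hE BE]]] := simultaneous_diag hp hB.
have Tau : T ^t* \in unitmx.
  by rewrite unitmxE det_map_mx det_tr unitfE conjC_eq0 -unitfE -unitmxE.
have BD : B = invmx T *m diag_mx D *m T.
  apply: (can_inj (mulKmx Tu)); apply: (can_inj (mulKmx Tau)).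
  by rewrite -mulmxA mulKVmx // !mulmxA -hE BE.
have D0 i : 0 < D 0 i.
  rewrite lt_neqAle eq_sym; apply/andP; split.
    move: Bu; rewrite BD !unitmx_mul => /andP[/andP[_]]; rewrite unitmxE det_diag unitfE.
    by move=> /prodf_neq0/(_ i isT).
  have := pB (invmx T *m delta_mx i 0).
  by rewrite BE qformM mulKVmx // qform_diag_delta.
pose E := T *m A *m invmx T.
have AC : A = invmx T *m E *m T by rewrite /E -!mulmxA mulVmx // mulmx1 mulKmx.
have hAC : h *m A = T ^t* *m E *m T by rewrite hE /E -!mulmxA mulVmx // mulmx1.
have pE x : 0 <= qform E x.
  by have := pA (invmx T *m x); rewrite hAC qformM mulKVmx.
have CC : E *m E = diag_mx D *m diag_mx D.
  have conj (Z W : M) : (invmx T *m Z *m T) *m (invmx T *m W *m T) = invmx T *m (Z *m W) *m T.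
    by rewrite !mulmxA mulmxK.
  move: AB; rewrite AC BD !conj => /(can_inj (mulmxK Tu)).
  have iTu : invmx T \in unitmx by rewrite unitmx_inv.
  by move/(can_inj (mulKmx iTu)).
pose X := E - diag_mx D.
have CX : E *m X = - (X *m diag_mx D).
  by rewrite /X mulmxBr mulmxBl CC opprB.
suff X0 : X = 0 by rewrite AC BD; move/eqP: X0; rewrite subr_eq0 => /eqP->.
apply/matrixP => i j; rewrite [RHS]mxE.
pose x : 'cV[C]_n.+1 := col j X.
have Cx : E *m x = (- D 0 j) *: x.
  have -> : E *m x = col j (E *m X) by rewrite /x !colE mulmxA.
  by apply/matrixP => a b; rewrite CX mul_mx_diag !mxE mulNr mulrC.
have qx : qform E x = - D 0 j * qform 1 x.
  by rewrite /qform -mulmxA Cx -scalemxAr mxE mulmx1.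
have q0 : qform 1 x <= 0.
  have := pE x; rewrite qx mulNr oppr_ge0; rewrite pmulr_rle0 //.
have x0 : qform 1 x = 0.
  apply/eqP; rewrite eq_le q0 qform1; apply: sumr_ge0 => k _; exact: exprn_ge0.
move: x0; rewrite qform1 => /eqP; rewrite psumr_eq0; last by move=> k _; exact: exprn_ge0.
by move=> /allP/(_ i (mem_index_enum _)); rewrite /= expf_eq0 /= normr_eq0 mxE => /eqP.
Qed.

End Hermitian.

(** * Invariant forms of bounded groups *)

Section Loewner.
Context {R : realType} {n : nat}.
Local Notation M := 'M[R[i]]_n.+1.
Implicit Types (h q A B : M) (x y : 'cV[R[i]]_n.+1).

(** An inequality in R[i] also says that the imaginary parts are equal, so both components are
    passed to the limit. *)
Lemma ctends_le T (F : set_system T) {PF : ProperFilter F} (f : T -> R[i]) a c :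
  ctends F f a -> (\forall t \near F, f t <= c) -> a <= c.
Proof.
move=> fa fc; rewrite lecE; apply/andP; split.
  rewrite eq_sym -subr_eq0 -normr_eq0 eq_le normr_ge0 andbT.
  apply/ler_addgt0Pr => e e0; have [t [h1 h2]] := @filter_ex _ F _ _ (filterI (fa _ e0) fc).
  move: h2; rewrite lecE => /andP[/eqP imE _]; rewrite add0r imE -raddfB.
  by apply: le_trans (cabs_Im _) _; rewrite cabsB ltW.
apply/ler_addgt0Pr => e e0; have [t [h1 h2]] := @filter_ex _ F _ _ (filterI (fa _ e0) fc).
move: h2; rewrite lecE => /andP[_ h2].
rewrite -(subrK (complex.Re (f t)) (complex.Re a)) addrC; apply: lerD => //.
rewrite -raddfB; apply: le_trans (ler_norm _) _; apply: le_trans (cabs_Re _) _.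
by rewrite cabsB ltW.
Qed.

Lemma ctends_ge T (F : set_system T) {PF : ProperFilter F} (f : T -> R[i]) a c :
  ctends F f a -> (\forall t \near F, c <= f t) -> c <= a.
Proof.
move=> fa fc; rewrite -lerN2; apply: (ctends_le (ctendsN fa)).
by apply: filterS fc => t; rewrite lerN2.
Qed.

Lemma ctends_qform T (F : set_system T) {FF : Filter F} (f : T -> M) A x :
  tends F f A -> ctends F (fun t => qform (f t) x) (qform A x).
Proof.
move=> fA; have : tends F (fun t => x ^t* *m f t *m x) (x ^t* *m A *m x).
  by apply: tends_mulmx (tends_cst x); exact: tends_mulmx (tends_cst _) fA.
by move/tendsP; exact.
Qed.

(** The extreme value theorem: a maximizing sequence, or one along which f is unbounded, converges
    along the ultrafilter to a point of Q. *)
Lemma ultra_max (Q : set M) (f : M -> R) (B : R) : Q !=set0 -> (forall h, Q h -> nrm h <= B) ->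
  (forall (F : set_system nat) (g : nat -> M) A, ProperFilter F -> tends F g A ->
     (forall k, Q (g k)) -> Q A /\ forall e, 0 < e -> \forall t \near F, `|f (g t) - f A| < e) ->
  exists2 h, Q h & forall h', Q h' -> f h' <= f h.
Proof.
move=> [h0 Qh0] QB Qf; have [F [FU ooF]] := ultra_seq.
have lim (g : nat -> M) : (forall k, Q (g k)) -> exists A, tends F g A.
  by move=> Qg; apply: (ultra_tends (B := B)); apply: nearW => k; exact: QB.
have hs : has_sup (f @` Q).
  split; first by exists (f h0), h0.
  apply: contrapT => nub.
  have ex k : exists h, Q h /\ k%:R < f h.
    apply: contrapT => nh; apply: nub; exists k%:R => _ [h Qh <-]; rewrite leNgt.
    by apply/negP => hk; apply: nh; exists h.
  have [g gP] := choice ex; have [A gA] := lim g (fun k => (gP k).1).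
  have [QA cf] := Qf F g A _ gA (fun k => (gP k).1).
  have big : \forall k \near F, (Num.truncn (`|f A| + 1)).+1%:R <= k%:R :> R.
    by apply: ooF; apply: filterS (near_ge_id (Num.truncn (`|f A| + 1)).+1) => k; rewrite ler_nat.
  have [k [h1 h2]] := @filter_ex _ F _ _ (filterI (cf 1 ltr01) big).
  have h3 := (gP k).2; have h4 : `|f A| + 1 < k%:R.
    by apply: lt_le_trans h2; exact: truncnS_gt.
  have := lt_trans (le_lt_trans (lerD (ler_norm (f A)) (lexx 1)) h4) h3.
  have h5 := le_lt_trans (ler_norm _) h1.
  by rewrite -ltrBrDl ltNge (ltW h5).
have ex k : exists h, Q h /\ sup (f @` Q) - k.+1%:R^-1 < f h.
  have e0 : 0 < k.+1%:R^-1 :> R by rewrite invr_gt0.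
  by have [_ [h Qh <-] hk] := sup_adherent e0 hs; exists h.
have [g gP] := choice ex; have [A gA] := lim g (fun k => (gP k).1).
have [QA cf] := Qf F g A _ gA (fun k => (gP k).1).
exists A => // h' Qh'; apply/ler_addgt0Pr => e e0.
have e20 : 0 < e / 2 by rewrite divr_gt0.
have small : \forall k \near F, k.+1%:R^-1 <= e / 2.
  apply: ooF; apply: filterS (near_ge_id (Num.truncn (e / 2)^-1)) => k hk.
  rewrite invf_ple ?posrE ?ltr0n //; apply: (@le_trans _ _ (Num.truncn (e / 2)^-1).+1%:R).
    exact/ltW/truncnS_gt.
  by rewrite ler_nat.
have [k [h1 h2]] := @filter_ex _ F _ _ (filterI (cf _ e20) small).
have h3 := (gP k).2; have h4 : f h' <= sup (f @` Q).
  by apply: ub_le_sup; [case: hs | exists h'].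
have h5 := le_lt_trans (ler_norm _) h1.
apply: (le_trans h4); rewrite ltrBlDr in h3; apply: (le_trans (ltW h3)).
rewrite ltrBlDl in h5; rewrite [e]splitr addrA; by apply: lerD; [exact: ltW | exact: h2].
Qed.

Lemma prod_ge1_eq1 (I : finType) (F : I -> R) :
  (forall i, 1 <= F i) -> \prod_i F i <= 1 -> forall i, F i = 1.
Proof.
move=> F1 P1 i; apply/eqP; rewrite eq_le F1 andbT; apply: le_trans P1.
rewrite (bigD1 i) //= ler_peMr ?(le_trans ler01) //.
by apply: (big_ind (fun z => 1 <= z)) => // x y x1 y1; rewrite mulr_ege1.
Qed.

(** Strict log-concavity of the determinant in coordinates: each ((1 + D)/2)^2 / D is at least 1,
    with equality only for D = 1, while the product of these factors is at most 1. *)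
Lemma amgm_eq1 (I : finType) (D : I -> R) : (forall i, 0 < D i) ->
  \prod_i D i = 1 -> \prod_i ((1 + D i) / 2) <= 1 -> forall i, D i = 1.
Proof.
move=> D0 P1 P2 i.
have F1 j : 1 <= ((1 + D j) / 2) ^+ 2 / D j.
  rewrite ler_pdivlMr // mul1r -subr_ge0.
  have -> : ((1 + D j) / 2) ^+ 2 - D j = ((1 - D j) / 2) ^+ 2 by field.
  exact: sqr_ge0.
have PF : \prod_j (((1 + D j) / 2) ^+ 2 / D j) <= 1.
  rewrite big_split /= prodfV P1 invr1 mulr1 prodrXl exprn_ile1 //.
  by apply: prodr_ge0 => j _; rewrite divr_ge0 // addr_ge0 // ltW.
have := prod_ge1_eq1 F1 PF i; have Di := D0 i => /(congr1 ( *%R^~ (D i))).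
rewrite divfK ?gt_eqF // mul1r => E; apply/eqP; rewrite -subr_eq0 -sqrf_eq0.
apply/eqP; have -> : (D i - 1) ^+ 2 = 4 * (((1 + D i) / 2) ^+ 2 - D i) by field.
by rewrite E subrr mulr0.
Qed.

Lemma qform_adj h x y : (x ^t* *m h *m y) 0 0 = ((y ^t* *m h ^t* *m x) 0 0)^*.
Proof.
have -> : ((y ^t* *m h ^t* *m x) 0 0)^* = ((y ^t* *m h ^t* *m x) ^t* ) 0 0 by rewrite !mxE.
by rewrite !adjM !adjK mulmxA.
Qed.

Lemma polarization_bound (qx qy qxy r B : R) : 0 <= qx <= B -> 0 <= qy <= B ->
  0 <= qxy <= B * 2 ^+ 2 -> qxy = qx + qy + 2 * r -> `|r| <= 2 * B.
Proof. by move=> h1 h2 h3 E; rewrite ler_norml; apply/andP; split; lra. Qed.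

Lemma qformDv h x y : herm h ->
  qform h (x + y) = qform h x + qform h y + ((x ^t* *m h *m y) 0 0 + ((x ^t* *m h *m y) 0 0)^*).
Proof.
move=> hh.
have -> : ((x ^t* *m h *m y) 0 0)^* = (y ^t* *m h *m x) 0 0 by rewrite [RHS]qform_adj hh.
rewrite /qform.
have -> : (x + y) ^t* *m h *m (x + y) = (x ^t* *m h *m x + y ^t* *m h *m y) +
   (x ^t* *m h *m y + y ^t* *m h *m x).
  rewrite adjD mulmxDl mulmxDr !mulmxDl.
  move: (x ^t* *m h *m x) (y ^t* *m h *m y) (x ^t* *m h *m y) (y ^t* *m h *m x) => a b c d.
  by rewrite [c + b]addrC addrACA [d + c]addrC.
by rewrite [LHS]mxE [X in X + _]mxE [X in _ + X]mxE.
Qed.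

Lemma psd_Re_bound h (B : R) x y : herm h -> (forall z, 0 <= qform h z) -> 0 <= B ->
  (forall z, qform h z <= ((B * nrm z ^+ 2)%:C)%C) -> nrm x <= 1 -> nrm y <= 1 ->
  `|complex.Re ((x ^t* *m h *m y) 0 0)| <= 2 * B.
Proof.
move=> hh h0 B0 hB x1 y1; have := qformDv x y hh; move: (_ 0 0) => s sE.
have re z (c : R) : 0 <= c -> nrm z <= c -> 0 <= complex.Re (qform h z) <= B * c ^+ 2.
  move=> c0 zc; have := h0 z; have := hB z; rewrite !lecE => /andP[_ le] /andP[_ -> /=].
  by apply: le_trans le _; rewrite /= ler_wpM2l // lerXn2r ?nnegrE ?nrm_ge0.
have sR : complex.Re (s + s^*) = 2 * complex.Re s.
  by rewrite addcJ -(rmorph_nat (real_complex R)) -rmorphM.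
have xy2 : nrm (x + y) <= 2 by apply: le_trans (nrmD _ _) _; rewrite -[2]/(1 + 1) lerD.
have := re x 1 ler01 x1; have := re y 1 ler01 y1; rewrite expr1n mulr1 => p1 p2.
apply: (polarization_bound p2 p1 (re (x + y) 2 (ler0n _ _) xy2)).
by rewrite sE raddfD /= raddfD /= sR.
Qed.

(** Polarization bounds the real part of an entry by 2 B, and its imaginary part likewise after the
    second vector is multiplied by i. *)
Lemma psd_entry_bound h (B : R) : herm h -> (forall x, 0 <= qform h x) -> 0 <= B ->
  (forall x, qform h x <= ((B * nrm x ^+ 2)%:C)%C) ->
  nrm h <= \sum_(i < n.+1) \sum_(j < n.+1) (4 * B).
Proof.
move=> hh h0 B0 hB; apply: ler_sum => i _; apply: ler_sum => j _.
have nd (k : 'I_n.+1) : nrm (delta_mx k 0 : 'cV[R[i]]_n.+1) <= 1.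
  rewrite /nrm (bigD1 k) //= big_ord1 mxE !eqxx cabs1 big1 ?addr0 // => l lk.
  by rewrite big_ord1 mxE (negbTE lk) cabs0.
have nid (k : 'I_n.+1) : nrm ('i%C *: (delta_mx k 0 : 'cV[R[i]]_n.+1)) <= 1.
  rewrite nrmZ; apply: le_trans (nd k); rewrite ler_piMl ?nrm_ge0 //.
  by rewrite /cabs /= expr0n expr1n add0r sqrtr1.
have ent k l : ((delta_mx k 0 : 'cV[R[i]]_n.+1) ^t* *m h *m delta_mx l 0) 0 0 = h k l.
  have -> : (delta_mx k 0 : 'cV[R[i]]_n.+1) ^t* = delta_mx 0 k.
    by rewrite trmx_delta map_delta_mx.
  rewrite -rowE mxE (bigD1 l) //= big1 ?addr0 => [|t tl]; rewrite !mxE ?eqxx ?mulr1 //.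
  by rewrite (negbTE tl) mulr0.
have := psd_Re_bound hh h0 B0 hB (nd i) (nd j); rewrite ent => b1.
have := psd_Re_bound hh h0 B0 hB (nd i) (nid j).
rewrite -scalemxAr mxE ent mulrC ReiNIm normrN => b2.
by apply: le_trans (cabs_le_ReIm _) _; lra.
Qed.

Context (U : set M) (gU : subgroup U) (B : R) (UB : forall u, U u -> nrm u <= B).

(* This replaces averaging over U: the form of largest determinant in the compact convex U-stable
   set Q is unique, hence U-invariant. *)
Let Q : set M := [set h | [/\ herm h, forall x, 0 <= qform h x &
  forall x c, (forall u, U u -> qform 1 (u *m x) <= c) -> qform h x <= c]].

(** The last clause of [Q] bounds h by the supremum of the forms u^* u over U, expressed through
    upper bounds c. It survives the action of U, midpoints and limits, and [UB] turns it into a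
    bound on [Q]. *)
Let Q1 : Q 1.
Proof.
split; first exact: adj1.
  by move=> x; rewrite qform1 sumr_ge0 // => i _; rewrite exprn_ge0.
by move=> x c /(_ 1); rewrite mul1mx; apply; case: gU.
Qed.

Let QU h u : Q h -> U u -> Q (u ^t* *m h *m u).
Proof.
case=> hh h0 hc Uu; split.
- by rewrite /herm !adjM adjK hh mulmxA.
- by move=> x; rewrite qformM.
move=> x c xc; rewrite qformM; apply: hc => v Uv; rewrite mulmxA.
by apply: xc; case: gU => _ GM _ _; exact: GM.
Qed.

Let Qmid h q : Q h -> Q q -> Q (2^-1 *: (h + q)).
Proof.
have h20 : 0 <= 2^-1 :> R[i] by rewrite invr_ge0.
case=> hh h0 hc [qh q0 qc]; split.
- rewrite /herm adjZ adjD hh qh; congr (_ *: _).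
  by rewrite conj_Creal // ger0_real.
- by move=> x; rewrite qformZ qformD mulr_ge0 // addr_ge0.
move=> x c xc; rewrite qformZ qformD ler_pdivrMl //.
by rewrite mulr_natl mulr2n; apply: lerD; [exact: hc | exact: qc].
Qed.

Let B0 : 0 <= B.
Proof. by case: gU => U1 _ _ _; apply: le_trans (UB U1); exact: nrm_ge0. Qed.

Let qform1_le (y : 'cV[R[i]]_n.+1) : qform 1 y <= ((nrm y ^+ 2)%:C)%C.
Proof.
rewrite qform1 expr2 {1}/nrm mulr_suml rmorph_sum /=; apply: ler_sum => i _.
rewrite normcE -rmorphXn lecR expr2 big_ord1.
by rewrite ler_wpM2l ?cabs_ge0 // cabs_le_nrm.
Qed.

Let QB h : Q h -> nrm h <= \sum_(i < n.+1) \sum_(j < n.+1) (4 * B ^+ 2).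
Proof.
case=> hh h0 hc; apply: psd_entry_bound => //; first by rewrite exprn_ge0.
move=> x; apply: hc => u Uu; apply: le_trans (qform1_le _) _; rewrite lecR -exprMn.
rewrite lerXn2r ?nnegrE ?mulr_ge0 ?nrm_ge0 //.
by apply: le_trans (nrmM _ _) _; rewrite ler_wpM2r ?nrm_ge0 // UB.
Qed.

Let Qlim (F : set_system nat) (g : nat -> M) A : ProperFilter F -> tends F g A ->
  (forall k, Q (g k)) -> Q A.
Proof.
move=> PF gA Qg; split.
- apply: (tends_unique (tends_adj gA)).
  by apply: tends_near gA; apply: nearW => k; case: (Qg k) => -> _ _.
- by move=> x; apply: (ctends_ge (ctends_qform x gA)); apply: nearW => k; case: (Qg k).
move=> x c xc; apply: (ctends_le (ctends_qform x gA)).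
by apply: nearW => k; case: (Qg k) => _ _; exact.
Qed.

Let psd_posdef h : herm h -> (forall x, 0 <= qform h x) -> h \in unitmx -> posdef h.
Proof.
move=> hh h0 hu; split=> // x x0; have [P [D [Pu PP hE]]] := herm_diag hh.
have D0 i : 0 <= D 0 i.
  have := h0 (invmx P *m delta_mx i 0).
  by rewrite hE qformM mulKVmx // qform_diag_delta.
have Du i : D 0 i != 0.
  move: hu; rewrite hE !unitmx_mul => /andP[/andP[_]]; rewrite unitmxE det_diag unitfE.
  by move=> /prodf_neq0/(_ i isT).
have [i xi] : exists i, (P *m x) i 0 != 0.
  apply: contrapT => nx; move/negP: (mulmx_neq0 Pu x0); apply; apply/eqP/matrixP => i j.
  by rewrite ord1 [RHS]mxE; apply: contrapT => Px; apply: nx; exists i; apply/eqP.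
rewrite hE qformM qform_diag (bigD1 i) //= ltr_wpDr //.
  by apply: sumr_ge0 => j _; rewrite mulr_ge0 // exprn_ge0.
by rewrite mulr_gt0 ?exprn_gt0 ?normr_gt0 // lt_neqAle eq_sym Du D0.
Qed.

Let det_adj A : \det (A ^t* ) = (\det A)^*.
Proof. by rewrite det_map_mx det_tr. Qed.

Let det_conj T A : \det (T ^t* *m A *m T) = `|\det T| ^+ 2 * \det A.
Proof. by rewrite !det_mulmx det_adj normCKC mulrAC. Qed.

Lemma invariant_form_exists : exists2 h, posdef h & forall u, U u -> u ^t* *m h *m u = h.
Proof.
have [U1 UM UV Uu] := gU.
have [||h Qh hmax] := @ultra_max Q (fun h => complex.Re (\det h)) _ _ QB.
- by exists 1.
- move=> F g A PF gA Qg; split; first exact: Qlim gA Qg.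
  move=> e e0; apply: filterS (ctends_det gA e0) => k; apply: le_lt_trans.
  by rewrite -raddfB cabs_Re.
have [hh h0 hc] := Qh.
(* The maximal determinant is at least that of 1, so the maximizing form is nondegenerate. *)
have hp : posdef h.
  apply: psd_posdef => //; rewrite unitmxE unitfE; apply/eqP => d0.
  by have := hmax 1 Q1; rewrite det1 d0 /= ler10.
exists h => // u Vu.
have [T hT hE] := posdef_factor hp.
have dpos : exists2 r : R, 0 < r & \det h = (r%:C)%C.
  exists (cabs (\det T) ^+ 2).
    by rewrite exprn_gt0 // lt_neqAle cabs_ge0 eq_sym cabs_eq0 -unitfE -unitmxE hT.
  by rewrite hE det_mulmx det_adj -normCKC normcE rmorphXn.
have [r r0 rE] := dpos.
have dle v : U v -> cabs (\det v) <= 1.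
  move=> Uv; have := hmax _ (QU Qh Uv); rewrite det_conj rE normcE -rmorphXn -rmorphM /=.
  by rewrite ger_pMl // expr_le1 // cabs_ge0.
(* Neither u nor its inverse can enlarge the maximal determinant. *)
have du : `|\det u| ^+ 2 = 1.
  have h1 := dle _ Vu; have := dle _ (UV _ Vu).
  rewrite det_inv cabsV invf_le1; last first.
    by rewrite lt_neqAle cabs_ge0 eq_sym cabs_eq0 -unitfE -unitmxE Uu.
  move=> h2; have E : cabs (\det u) = 1 by apply/eqP; rewrite eq_le h1 h2.
  by rewrite normcE E expr1n.
pose h1 := u ^t* *m h *m u.
have Q1' : Q h1 by exact: QU.
have d1 : \det h1 = \det h by rewrite det_conj du mul1r.
have [T' [D [Tu hT' h1E]]] := simultaneous_diag hp (let: And3 a _ _ := Q1' in a).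
have D0 i : 0 < D 0 i.
  have x0 : invmx T' *m (delta_mx i 0 : 'cV[R[i]]_n.+1) != 0.
    by apply: mulmx_neq0; [rewrite unitmx_inv | exact: delta_neq0].
  have : 0 < qform h1 (invmx T' *m delta_mx i 0).
    by rewrite qformM; apply: (proj2 hp); apply: mulmx_neq0 => //; exact: Uu.
  by rewrite h1E qformM mulKVmx // qform_diag_delta.
pose ri i := complex.Re (D 0 i).
have riE i : D 0 i = ((ri i)%:C)%C by rewrite RRe_real // gtr0_real.
have ri0 i : 0 < ri i by rewrite -ltcR -riE.
have dT : `|\det T'| ^+ 2 = (r%:C)%C by rewrite -rE hT' -[T' ^t* ]mulmx1 det_conj det1 mulr1.
have rn0 : (r%:C)%C != 0 :> R[i] by rewrite gt_eqF // ltcR.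
have pr1 : \prod_i ri i = 1.
  apply: (@complexI R); rewrite rmorph_prod rmorph1.
  apply: (mulfI rn0); rewrite mulr1 -{2}rE -d1 h1E det_conj dT det_diag.
  by congr (_ * _); apply: eq_bigr => i _.
have diag_mid : 2^-1 *: (1%:M + diag_mx D) = diag_mx (\row_i (((1 + ri i) / 2)%:C)%C).
  apply/matrixP => i j; rewrite !mxE riE rmorphM rmorphD rmorph1 fmorphV rmorph_nat.
  by case: (i == j); rewrite ?mulr1n ?mulr0n ?addr0 ?mulr0 // mulrC.
have mid : 2^-1 *: (h + h1) = T' ^t* *m diag_mx (\row_i (((1 + ri i) / 2)%:C)%C) *m T'.
  rewrite h1E {1}hT' -{1}[T' ^t* ]mulmx1 -mulmxDl -mulmxDr scalemxAl scalemxAr.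
  by rewrite diag_mid.
(* The midpoint of the two maximizers h and [h1] lies in [Q], so its determinant relative to h is at
   most 1; strict concavity then forces h = [h1]. *)
have pr2 : \prod_i ((1 + ri i) / 2) <= 1.
  have := hmax _ (Qmid Qh Q1'); rewrite mid det_conj dT det_diag.
  have -> : \prod_i (\row_i (((1 + ri i) / 2)%:C)%C : 'rV[R[i]]_n.+1) 0 i =
     ((\prod_i ((1 + ri i) / 2))%:C)%C.
    by rewrite rmorph_prod; apply: eq_bigr => i _; rewrite mxE.
  by rewrite rE -rmorphM /= ger_pMr.
have ri1 := amgm_eq1 ri0 pr1 pr2.
rewrite -/h1 h1E hT' -[in RHS](mulmx1 (T' ^t* )); congr (_ *m _ *m _).
by apply/matrixP => i j; rewrite !mxE riE ri1.
Qed.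

End Loewner.

(** * Polar decomposition and generation of K *)

Section ExponentialSums.
Context {R : realType}.
Implicit Types (phi psi : nat -> R[i]).

Definition exp_sum phi : Prop := exists2 r : seq (R[i] * R), (forall p, p \in r -> 0 < p.2) &
  forall k, phi k = \sum_(p <- r) p.1 * ((p.2%:C)%C) ^+ k.

Lemma exp_sum_ext phi psi : phi =1 psi -> exp_sum phi -> exp_sum psi.
Proof. by move=> E [r r0 rE]; exists r => // k; rewrite -E. Qed.

Lemma exp_sum_monomial c (x : R) : 0 < x -> exp_sum (fun k => c * ((x%:C)%C) ^+ k).
Proof.
move=> x0; exists [:: (c, x)]; first by move=> p; rewrite inE => /eqP->.
by move=> k; rewrite big_seq1.
Qed.

Lemma exp_sum_cst c : exp_sum (fun=> c).
Proof.
apply: (exp_sum_ext _ (exp_sum_monomial c ltr01)) => k.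
by rewrite rmorph1 expr1n mulr1.
Qed.

Lemma exp_sumD phi psi : exp_sum phi -> exp_sum psi -> exp_sum (fun k => phi k + psi k).
Proof.
move=> [r r0 rE] [s s0 sE]; exists (r ++ s).
  by move=> p; rewrite mem_cat => /orP[/r0|/s0].
by move=> k; rewrite big_cat rE sE.
Qed.

Lemma exp_sumM phi psi : exp_sum phi -> exp_sum psi -> exp_sum (fun k => phi k * psi k).
Proof.
move=> [r r0 rE] [s s0 sE]; exists [seq (p.1 * q.1, p.2 * q.2) | p <- r, q <- s].
  by move=> _ /allpairsP[[p q] [/r0 p0 /s0 q0 ->]]; exact: mulr_gt0.
move=> k; rewrite rE sE mulr_suml big_allpairs_dep; apply: eq_bigr => p _.
rewrite mulr_sumr; apply: eq_bigr => q _ /=.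
by rewrite rmorphM exprMn mulrACA.
Qed.

Lemma exp_sum_sum (I : Type) (r : seq I) (f : I -> nat -> R[i]) :
  (forall i, exp_sum (f i)) -> exp_sum (fun k => \sum_(i <- r) f i k).
Proof.
move=> fE; elim: r => [|i r IH].
  by apply: (exp_sum_ext _ (exp_sum_cst 0)) => k; rewrite big_nil.
by apply: (exp_sum_ext _ (exp_sumD (fE i) IH)) => k; rewrite big_cons.
Qed.

Lemma interpolation (I : eqType) (s : seq I) (x y : I -> R[i]) :
  {in s &, injective x} -> exists p : {poly R[i]}, forall i, i \in s -> p.[x i] = y i.
Proof.
elim: s => [|i s IH] inj; first by exists 0.
have [p pP] := IH (sub_in2 (fun a sa => @mem_behead _ (i :: s) a sa) inj).
have [si|si] := boolP (i \in s).
  by exists p => j; rewrite inE => /orP[/eqP->|]; exact: pP.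
pose q := \prod_(j <- s) ('X - (x j)%:P).
have qx : q.[x i] != 0.
  rewrite horner_prod prodf_seq_neq0; apply/allP => j sj /=.
  rewrite !hornerE subr_eq0; apply: contraNneq si => /inj ->//; first exact: mem_head.
  by rewrite inE sj orbT.
exists (p + ((y i - p.[x i]) / q.[x i])%:P * q) => j.
rewrite !hornerE inE => /orP[/eqP->|sj]; first by rewrite divfK // addrC subrK.
have -> : q.[x j] = 0; last by rewrite mulr0 addr0 pP.
apply/eqP; rewrite horner_prod prodf_seq_eq0; apply/hasP; exists j => //=.
by rewrite !hornerE subrr.
Qed.

(** The bases x are positive, so distinct bases have distinct m-th powers, and some polynomial p
    satisfies p(x^m) = x^k at all of them. Thus phi k is a combination of values phi (m i). *)
Lemma exp_sum_zero phi m : exp_sum phi -> (0 < m)%N -> (forall k, phi (m * k)%N = 0) ->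
  forall k, phi k = 0.
Proof.
move=> [r r0 rE] m0 phi0 k.
have [|p pP] := @interpolation _ [seq q.2 | q <- r]
    (fun x => ((x%:C)%C) ^+ m) (fun x => ((x%:C)%C) ^+ k).
  move=> _ _ /mapP[[a1 a] /r0 /= a0 ->] /mapP[[b1 b] /r0 /= b0 ->].
  rewrite -!(rmorphXn (real_complex R)) => /complexI E.
  by apply/eqP; rewrite -(eqrXn2 m0 (ltW a0) (ltW b0)) E.
have -> : phi k = \sum_(q <- r) q.1 * p.[((q.2%:C)%C) ^+ m].
  by rewrite rE; apply: eq_big_seq => q qr; rewrite pP // map_f.
under eq_bigr => q _ do rewrite horner_coef mulr_sumr.
rewrite exchange_big big1 //= => i _.
transitivity (p`_i * phi (m * i)%N); last by rewrite phi0 mulr0.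
rewrite rE mulr_sumr; apply: eq_bigr => q _.
by rewrite mulrCA exprM.
Qed.

End ExponentialSums.

(** * Real powers of positive matrices *)

Section Roots.
Context {R : realType} {n : nat}.
Local Notation M := 'M[R[i]]_n.+1.
Implicit Types (h g A B T : M) (x y : 'cV[R[i]]_n.+1) (l : 'I_n.+1 -> R).

Definition dexp l (t : R) : M := diag_mx (\row_i ((expR (t * l i))%:C)%C).

(** The t-th power of the positive diagonalizable matrix whose eigenvalues have logarithms [l] in
    the frame T. *)
Definition pwr T l (t : R) : M := invmx T *m dexp l t *m T.

Lemma dexpD l a b : dexp l (a + b) = dexp l a *m dexp l b.
Proof.
rewrite /dexp mulmx_diag; congr diag_mx; apply/rowP => i.
by rewrite !mxE mulrDl expRD rmorphM.
Qed.

Lemma dexp0 l : dexp l 0 = 1%:M.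
Proof.
apply/matrixP => i j; rewrite !mxE mul0r expR0 rmorph1.
by case: (i == j).
Qed.

Lemma pwrD T l a b : T \in unitmx -> pwr T l (a + b) = pwr T l a * pwr T l b.
Proof.
by move=> Tu; rewrite /pwr dexpD -[RHS]/(_ *m _) !mulmxA mulmxK.
Qed.

Lemma pwr0 T l : T \in unitmx -> pwr T l 0 = 1.
Proof. by move=> Tu; rewrite /pwr dexp0 mulmx1 mulVmx. Qed.

Lemma pwrX T l a k : T \in unitmx -> pwr T l a ^+ k = pwr T l (a *+ k).
Proof.
move=> Tu; elim: k => [|k IH]; first by rewrite expr0 mulr0n pwr0.
by rewrite exprS IH mulrS pwrD.
Qed.

Lemma pwr_unit T l a : T \in unitmx -> pwr T l a \in unitmx.
Proof.
move=> Tu; rewrite unitmxE; apply/unitrPr; exists (\det (pwr T l (- a))).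
by rewrite -det_mulmx -[_ *m _]/(_ * _) -pwrD // subrr pwr0 // det1.
Qed.

Lemma pwrN T l a : T \in unitmx -> pwr T l (- a) = (pwr T l a)^-1.
Proof.
move=> Tu; apply: (mulrI (pwr_unit l a Tu)).
by rewrite -pwrD // subrr pwr0 // divrr // pwr_unit.
Qed.

Lemma exp_sum_regular f T l : T \in unitmx -> regular_fun f ->
  forall t, exp_sum (fun k : nat => f (pwr T l (t *+ k))).
Proof.
move=> Tu rf t.
have eE i k : ((expR (t *+ k * l i))%:C)%C = ((expR (t * l i))%:C)%C ^+ k :> R[i].
  by rewrite -(rmorphXn (real_complex R)) -expRM_natl mulrA mulr_natl.
elim: rf => [c|i j||f1 f2 _ h1 _ h2|f1 f2 _ h1 _ h2].
- exact: exp_sum_cst.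
- apply: (@exp_sum_ext _ (fun k => \sum_a (invmx T i a * T a j) * ((expR (t * l a))%:C)%C ^+ k)).
    move=> k; rewrite /pwr mxE; apply: eq_bigr => a _.
    by rewrite mul_mx_diag !mxE eE mulrAC.
  by apply: exp_sum_sum => a; apply: exp_sum_monomial; exact: expR_gt0.
- apply: (@exp_sum_ext _ (fun k => 1 * ((\prod_a expR (- (t * l a)))%:C)%C ^+ k)).
    move=> k; rewrite mul1r /pwr !det_mulmx mulrAC -det_mulmx mulVmx // det1 mul1r det_diag.
    rewrite -prodfV rmorph_prod -prodrXl; apply: eq_bigr => a _.
    by rewrite mxE eE -exprVn expRN fmorphV.
  by apply: exp_sum_monomial; apply: prodr_gt0 => a _; exact: expR_gt0.
- exact: exp_sumD.
exact: exp_sumM.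
Qed.

(* The Zariski closure of the powers of a positive diagonalizable matrix contains
   its roots: a sum of exponentials that vanishes on m N vanishes. *)
Lemma zariski_root (H : set M) T l m : algebraic_subgroup H -> T \in unitmx -> (0 < m)%N ->
  H (pwr T l 1) -> H (pwr T l m%:R^-1).
Proof.
move=> aH Tu m0 H1; have gH := algebraic_is_subgroup aH.
have [[I regI HE] _ _ _] := aH.
have Hk k : H (pwr T l (m%:R^-1 *+ (m * k)%N)).
  have -> : m%:R^-1 *+ (m * k) = 1 *+ k :> R.
    by rewrite mulrnA -[m%:R^-1 *+ m]mulr_natr mulVf // pnatr_eq0 -lt0n.
  by rewrite -pwrX //; exact: subgroupX.
rewrite HE; split; first exact: pwr_unit.
move=> f If; have := exp_sum_zero (exp_sum_regular l Tu (regI _ If) m%:R^-1) m0.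
move=> /(_ _ 1%N); rewrite mulr1n; apply=> k.
by have := Hk k; rewrite HE => -[_ ->].
Qed.

Lemma pwr_adj T l a : T \in unitmx -> (pwr T l a) ^t* *m (T ^t* *m T) = (T ^t* *m T) *m pwr T l a.
Proof.
move=> Tu; rewrite /pwr !adjM.
have -> : (dexp l a) ^t* = dexp l a.
  rewrite /dexp tr_diag_mx map_diag_mx; congr diag_mx; apply/rowP => i; rewrite !mxE.
  exact: conjc_real.
have LL : (invmx T) ^t* *m T ^t* = 1%:M by rewrite -adjM mulmxV // adj1.
by rewrite -!mulmxA (mulmxA ((invmx T) ^t* )) LL mul1mx mulKVmx.
Qed.

Lemma tends_pwr T l : T \in unitmx -> tends \oo (fun m : nat => pwr T l m%:R^-1) 1.
Proof.
move=> Tu; rewrite -(pwr0 l Tu) /pwr.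
apply: tends_mulmx (tends_cst T); apply: tends_mulmx (tends_cst _) _.
apply/tendsP => i j; rewrite mxE.
apply: (@ctends_near _ _ _ _ (fun m : nat => ((expR (m%:R^-1 * l i))%:C)%C *+ (i == j))).
  by apply: nearW => m; rewrite !mxE.
case: (i == j); rewrite ?mulr0n ?mulr1n; last first.
  by apply: (ctends_near _ (ctends_cst 0)); apply: nearW => m; rewrite mulr0n.
rewrite !mxE mul0r => e e0.
have := @continuous_expR R 0 => /cvgrPdist_lt/(_ e e0) /nbhs_ballP[d d0 dP].
apply: filterS (near_ge_id (Num.truncn (`|l i| / d)).+1) => m hm.
have m0 : 0 < m%:R :> R by rewrite ltr0n (leq_trans _ hm).
have : `|expR 0 - expR (m%:R^-1 * l i)| < e.
  apply: dP; rewrite -ball_normE /= sub0r normrN normrM gtr0_norm ?invr_gt0 //.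
  rewrite mulrC ltr_pdivrMr // mulrC -ltr_pdivrMr //.
  by apply: lt_le_trans (truncnS_gt _) _; rewrite ler_nat.
by rewrite mulr1n -rmorphB cabsR distrC.
Qed.

End Roots.

(** * Compact sets of matrices *)

Section Compact.
Context {R : realType} {n : nat}.
Local Notation M := 'M[R[i]]_n.+1.
Implicit Types (U G : set M).

Lemma compact_cluster_seq U (F : set_system nat) (u : nat -> M) : compact U -> ProperFilter F ->
  (forall k, U (u k)) -> exists2 p, U p & forall (e : R) (P : set nat), 0 < e -> F P ->
    exists2 k, P k & nrm (u k - p) < e.
Proof.
move=> cU PF Uu; have FU : (u @ F) U by apply: (@filterS _ F _ setT) => [k _|]; [exact: Uu | exact: filterT].
have [p [Up pF]] := cU (u @ F) _ FU.
exists p => // e P e0 FP.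
have [_ [[k Pk <-] pe]] : (u @` P) `&` [set x | nrm (x - p) < e] !=set0.
  apply: pF; last by apply/nbhs_nrmP; exists e.
  by apply: (@filterS _ F _ P) FP => k Pk; exists k.
by exists k.
Qed.

Lemma compact_bounded U : compact U -> exists B : R, forall u, U u -> nrm u <= B.
Proof.
move=> cU; apply: contrapT => nB.
have ex k : exists u, U u /\ k%:R < nrm u.
  apply: contrapT => nh; apply: nB; exists k%:R => u Uu; rewrite leNgt.
  by apply/negP => hk; apply: nh; exists u.
have [u uP] := choice ex.
have [p Up pc] := @compact_cluster_seq U \oo u cU _ (fun k => (uP k).1).
have [k hk] := pc 1 _ ltr01 (near_ge_id (Num.truncn (nrm p + 1)).+1).
apply/negP; rewrite -leNgt; apply: ltW.
have h1 : nrm p + 1 < k%:R.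
  by apply: lt_le_trans (truncnS_gt _) _; rewrite ler_nat.
have h2 := lt_trans h1 (uP k).2.
rewrite -(ltrD2l (nrm p)); apply: lt_le_trans h2 _.
by rewrite -{1}(subrK p (u k)) addrC nrmD.
Qed.

Lemma compact_limit U (F : set_system nat) (u : nat -> M) A : compact U -> ProperFilter F ->
  (forall k, U (u k)) -> tends F u A -> U A.
Proof.
move=> cU PF Uu uA; have [p Up pc] := compact_cluster_seq cU PF Uu.
suff -> : A = p by [].
apply/eqP; rewrite -subr_eq0 -nrm_eq0 eq_le nrm_ge0 andbT; apply/ler_addgt0Pr => e e0.
have e20 : 0 < e / 2 by rewrite divr_gt0.
have [k hk1 hk2] := pc _ _ e20 (uA _ e20).
rewrite add0r; apply: le_trans (nrm_triangle (u k) _ _) _.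
by rewrite [e]splitr nrmB; apply: lerD; exact: ltW.
Qed.

End Compact.

(** * The groups and involutions of a Cartan datum *)

Section CartanDatum.
Context {R : realType} {n : nat} (s : cartan_datum R n).
Local Notation M := 'M[R[i]]_n.+1.
Local Notation G := (cG s).
Local Notation sigma := (csigma s).
Local Notation theta := (ctheta s).
Local Notation c := (sigma \o theta).
Implicit Types (X Y g h : M).

Lemma cG_subgroup : subgroup G.
Proof. exact/algebraic_is_subgroup/cG_algebraic. Qed.

Lemma cK_algebraic : algebraic_subgroup (cK s).
Proof.
have [[I regI GE] G1 GM GV] := cG_algebraic s.
have gG := cG_subgroup; have tG := ctheta_involution s; have [tG' tM tK] := tG.
have [f fP] := choice (fun ij => let: ex_intro2 f a b := ctheta_regular s ij.1 ij.2 in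
  ex_intro (fun f => regular_fun f /\ forall g, G g -> theta g ij.1 ij.2 = f g) f (conj a b)).
split.
(* The regular functions [f] agree with theta only on G, so the equations of G are kept beside those
   of theta g = g. *)
- exists (I `|` [set p | exists ij, p = fun g => f ij g + (-1) * g ij.1 ij.2]).
    move=> p [/regI //|[ij ->]]; apply: RegAdd; first by case: (fP ij).
    by apply: RegMul; [exact: RegCst | exact: RegCoef].
  apply/seteqP; split=> g.
    move=> [Gg tg]; split; first by case: gG => _ _ _; exact.
    move=> p [Ip|[ij ->]]; first by move: Gg; rewrite GE => -[_]; exact.
    by case: (fP ij) => _ <- //; rewrite tg mulN1r subrr.
  move=> [gu gI]; have Gg : G g by rewrite GE; split=> // p Ip; apply: gI; left.
  split=> //; apply/matrixP => i j; case: (fP (i, j)) => _ /= -> //.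
  have := gI _ (or_intror (ex_intro _ (i, j) erefl)).
  by rewrite /= mulN1r => /eqP; rewrite subr_eq0 => /eqP.
- by split=> //; exact: involution1 gG tG.
- by move=> g h [Gg tg] [Gh th]; split; [exact: GM | rewrite tM // tg th].
move=> g [Gg tg]; split; first exact: GV.
have gu : g \in unitmx by case: gG => _ _ _; exact.
by apply: (mulrI gu); rewrite -{1}tg -tM ?divrr ?(involution1 gG tG) //; exact: GV.
Qed.

Lemma cK_subgroup : subgroup (cK s).
Proof. exact/algebraic_is_subgroup/cK_algebraic. Qed.

Lemma sigma1 : sigma 1 = 1.
Proof. exact: involution1 cG_subgroup (csigma_involution s). Qed.

Lemma theta_tends (F : set_system nat) (u : nat -> M) (A : M) : Filter F -> (forall j, G (u j)) ->
  G A -> tends F u A -> tends F (theta \o u) (theta A).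
Proof.
move=> FF Gu GA uA; apply/tendsP => i j.
have [f rf fE] := ctheta_regular s i j; rewrite fE //.
have Au : A \in unitmx by case: cG_subgroup => _ _ _; exact.
by apply: ctends_near (regular_tends rf Au uA); apply: nearW => k /=; rewrite fE.
Qed.

Lemma sigma_tends (F : set_system nat) (u : nat -> M) (A : M) : Filter F -> (forall j, G (u j)) ->
  G A -> tends F u A -> tends F (sigma \o u) (sigma A).
Proof.
move=> FF Gu GA uA.
have [f /nbhs_nrmP[d d0 dP]] := csigma_antiholomorphic GA.
have [df fA] := dP A (ltac:(by rewrite subrr nrm0)).
rewrite fA //; have [L LP] := differentiable_nrm df.
have [d1 d10 d1P] := LP 1 ltr01.
have fu : tends F (f \o u) (f A).
  have Lu : tends F (fun k => L (u k - A)) (L 0).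
    by apply: tends_linear; rewrite -(subrr A); apply: tendsB => //; exact: tends_cst.
  rewrite linear0 in Lu => e e0; have e20 : 0 < e / 2 by rewrite divr_gt0.
  apply: filterS3 (uA _ d10) (uA _ e20) (Lu _ e20) => k h1 h2 h3.
  have := d1P _ h1; rewrite subrK mul1r => h4.
  have -> : (f \o u) k - f A = (f (u k) - (f A + L (u k - A))) + L (u k - A).
    by rewrite opprD addrA subrK.
  apply: le_lt_trans (nrmD _ _) _; rewrite [e]splitr; apply: ltrD.
    exact: le_lt_trans h4 h2.
  by rewrite subr0 in h3.
move/tendsP: fu => fu; apply/tendsP => i j; rewrite mxE.
apply: ctends_near (ctendsJ (fu i j)); apply: filterS (uA _ d0) => k hk /=.
by have [_ ->] := dP _ hk; rewrite ?mxE.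
Qed.

Lemma c_involution : group_involution G c.
Proof.
have [tG tM tK] := ctheta_involution s; have [sG sM sK] := csigma_involution s.
split=> [g Gg|g h Gg Gh|g Gg] /=; first exact/sG/tG.
  by rewrite tM // sM //; exact: tG.
by rewrite ctheta_csigma ?tK ?sK //; exact: tG.
Qed.

Lemma c_tends (F : set_system nat) (u : nat -> M) (A : M) : Filter F -> (forall j, G (u j)) ->
  G A -> tends F u A -> tends F (c \o u) (c A).
Proof.
move=> FF Gu GA uA; have [tG _ _] := ctheta_involution s.
apply: (@sigma_tends F (theta \o u)) => //; last exact: theta_tends.
  by move=> k; exact/tG/Gu.
exact: tG.
Qed.

Lemma sigma_diff : exists2 L, (forall a X Y, L (a *: X + Y) = a^* *: L X + L Y) &
  diff_at_1 G sigma L.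
Proof.
exact: antiholomorphic_diff_at_1 cG_subgroup (csigma_involution s)
  (@csigma_antiholomorphic _ _ s).
Qed.

Lemma cgE X : (X \in cg s) <-> in_lie G X.
Proof. exact: cgP. Qed.

Lemma c_diff : exists2 L, (forall a X Y, L (a *: X + Y) = a^* *: L X + L Y) &
  diff_at_1 G c L.
Proof.
have [L Ll dL] := sigma_diff.
have [L' Ll' dL'] := regular_diff_at_1 cG_subgroup (ctheta_involution s) (@ctheta_regular _ _ s).
exists (L \o L'); first by move=> a X Y /=; rewrite Ll' Ll.
by apply: diff_at_1_comp dL' dL; case: (ctheta_involution s).
Qed.

End CartanDatum.

Lemma adj_skew_complex (C : numClosedFieldType) n (h X Y : 'M[C]_n.+1) :
  X ^t* = - (h * X * h^-1) -> Y ^t* = - (h * Y * h^-1) ->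
  (X + 'i *: Y) ^t* = - (h * (X - 'i *: Y) * h^-1).
Proof.
move=> XE YE; rewrite adjD adjZ conjCi XE YE.
by rewrite mulrBr mulrBl opprB scalerN scaleNr opprK -scalerAr -scalerAl addrC.
Qed.

(** * The Hermitian form of a Cartan involution *)

Section PolarDecomposition.
Context {R : realType} {n : nat} (s : cartan_datum R n).
Local Notation M := 'M[R[i]]_n.+1.
Local Notation G := (cG s).
Local Notation sigma := (csigma s).
Local Notation theta := (ctheta s).
Local Notation c := (sigma \o theta).
Implicit Types (X Y g h : M).

Lemma adjR (A B : M) : (A * B) ^t* = B ^t* * A ^t*.
Proof. exact: adjM. Qed.

Lemma cG_unit g : G g -> g \is a GRing.unit.
Proof. by case: (cG_subgroup s) => _ _ _; exact. Qed.

Lemma posdef_unit h : posdef h -> h \is a GRing.unit.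
Proof.
move=> /posdef_factor[T Tu ->]; rewrite -[_ \is a _]/(_ \in unitmx) unitmx_mul Tu andbT.
by rewrite unitmxE det_map_mx det_tr unitfE conjC_eq0 -unitfE -unitmxE.
Qed.

Lemma fixed_c_subgroup : subgroup (fixed G c).
Proof.
have [G1 GM GV Gu] := cG_subgroup s; have gc := c_involution s; have [cG' cM cK'] := gc.
split.
- by split=> //; exact: involution1 (cG_subgroup s) gc.
- by move=> g h [Gg cg] [Gh ch]; split; [exact: GM | rewrite cM // cg ch].
- move=> g [Gg cg]; split; first exact: GV.
  apply: (mulrI (Gu _ Gg)); rewrite -{1}cg -cM ?divrr ?(involution1 (cG_subgroup s) gc) //.
    exact: Gu.
  exact: GV.
by move=> g [Gg _]; exact: Gu.
Qed.

(** The equation says that c sends g to the inverse of its h-adjoint. On the compact group of fixed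
    points of c it is invariance of h. Its differential extends from the fixed vectors to Lie(G),
    because both sides are conjugate-linear. So it holds on exponentials, hence near 1 by
    [near_subgroup], hence on the connected group G. *)
Lemma cartan_form : exists2 h, posdef h & forall g, G g -> g ^t* * h * c g = h.
Proof.
have gG := cG_subgroup s; have [G1 GM GV Gu] := gG.
have gc := c_involution s; have [cG' cM cK'] := gc.
have [B UB] := compact_bounded (@ctheta_cartan _ _ s).
have [h hp hU] := invariant_form_exists fixed_c_subgroup UB.
exists h => // g0 Gg0; have hu := posdef_unit hp.
have [L Ll dL] := c_diff s.
have L0 : L 0 = 0 by have := Ll (-1) 0 0; rewrite scaler0 addr0 rmorphN1 scaleN1r addNr.
have LZ (a : R[i]) X : L (a *: X) = a^* *: L X by rewrite -[a *: X]addr0 Ll L0 addr0.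
have LD X Y : L (X + Y) = L X + L Y by rewrite -[X]scale1r Ll rmorph1 !scale1r.
have LR (t : R) X : L ((t%:C)%C *: X) = (t%:C)%C *: L X.
  by rewrite LZ; congr (_ *: _); exact: conjc_real.
have lieZ (t : R) X : X \in cg s -> in_lie G ((t%:C)%C *: X) by move=> Xg; apply/cgE/rpredZ.
have cexp X : X \in cg s -> c (expm X) = expm (L X).
  by move=> /cgE lX; apply: diff_expm dL lX.
have Lg X : X \in cg s -> L X \in cg s.
  move=> Xg; apply/cgE => t; rewrite -LR -cexp ?rpredZ //; apply: cG'.
  by move/cgE: Xg; exact.
have LL X : X \in cg s -> L (L X) = X.
  move=> Xg; apply: expm_inj => t; have tXg : (t%:C)%C *: X \in cg s by rewrite rpredZ.
  rewrite -LR -LR -(cexp _ (Lg _ tXg)) -(cexp _ tXg) cK' //.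
  by move/cgE: Xg; exact.
(* A vector fixed by L generates a one-parameter group of h-unitary elements; [expm_inj]
   differentiates this. *)
have fixE W : W \in cg s -> L W = W -> W ^t* = - (h * W * h^-1).
  move=> Wg LW; apply: expm_inj => t.
  have -> : (t%:C)%C *: W ^t* = ((t%:C)%C *: W) ^t*.
    by rewrite adjZ; congr (_ *: _); exact/esym/conjc_real.
  have -> : (t%:C)%C *: - (h * W * h^-1) = h * (- ((t%:C)%C *: W)) * h^-1.
    by rewrite scalerN mulrN mulNr scalerAl scalerAr.
  rewrite -expm_adj -expm_conj // expmN.
  have Uexp : fixed G c (expm ((t%:C)%C *: W)).
    split; first by move/cgE: Wg; exact.
    by rewrite (cexp _ (rpredZ _ Wg)) LR LW.
  have := hU _ Uexp; rewrite -[_ *m _]/(_ * _) -[_ *m _]/(_ * _) => E.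
  have Eu := expm_unit ((t%:C)%C *: W).
  by rewrite -{1}E mulrK // mulrK.
have half (X : M) : 2^-1 *: (X + X) = X.
  by rewrite -mulr2n -[X *+ 2]scaler_nat scalerA mulVf ?scale1r // pnatr_eq0.
have adjE X : X \in cg s -> X ^t* = - (h * L X * h^-1).
  move=> Xg; have LXg := Lg _ Xg.
  (* Real and imaginary parts of X for the conjugation L. *)
  pose Xu := 2^-1 *: (X + L X); pose Xv := (2 * 'i)^-1 *: (X - L X).
  have XE : X = Xu + 'i *: Xv.
    rewrite /Xu /Xv scalerA invfM mulrCA divff ?neq0Ci // mulr1 -scalerDr addrACA subrr addr0.
    by rewrite half.
  have LXE : L X = Xu - 'i *: Xv.
    rewrite /Xu /Xv scalerA invfM mulrCA divff ?neq0Ci // mulr1 -scalerBr opprB.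
    by rewrite [X + L X]addrC addrA addrAC addrK half.
  have Xug : Xu \in cg s by rewrite rpredZ // rpredD.
  have Xvg : Xv \in cg s by rewrite rpredZ // rpredB.
  have LXu : L Xu = Xu.
    rewrite /Xu LZ LD LL // addrC; congr (_ *: _).
    by rewrite conj_Creal // ger0_real // invr_ge0.
  have LXv : L Xv = Xv.
    rewrite /Xv LZ LD -scaleN1r LZ LL // rmorphN1 scaleN1r.
    rewrite fmorphV rmorphM /= conjCi rmorph_nat mulrN invrN scaleNr -scalerN.
    by rewrite scaleN1r opprB.
  rewrite {1}XE LXE; exact: adj_skew_complex (fixE _ Xug LXu) (fixE _ Xvg LXv).
pose G' : set M := [set g | G g /\ g ^t* * h * c g = h].
have gG' : subgroup G'.
  split.
  - by split=> //; rewrite adj1 mul1r (involution1 gG gc) mulr1.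
  - move=> g k [Gg gE] [Gk kE]; split; first exact: GM.
    by rewrite cM // adjR !mulrA -(mulrA (k ^t* )) -(mulrA (k ^t* )) gE kE.
  - move=> g [Gg gE]; split; first exact: GV.
    have gV : (g^-1) ^t* * g ^t* = 1 by rewrite -adjR divrr ?adj1 ?Gu.
    rewrite -{1}gE !mulrA gV mul1r -mulrA -cM ?divrr ?Gu //; last exact: GV.
    by rewrite (involution1 gG gc) mulr1.
  by move=> g [Gg _]; exact: Gu.
have clG' : limit_closed_in G G'.
  move=> F f A PF fA nG' GA; split=> //.
  (* The values of f lie in [G'] only along F, while [c_tends] asks for every term to lie in G; the
     default 1 does. *)
  pose f' k := if `[< G' (f k) >] then f k else 1.
  have f'E : \forall k \near F, f k = f' k.
    by apply: filterS nG' => k Gk; rewrite /f'; case: asboolP.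
  have f'G k : G' (f' k) by rewrite /f'; case: asboolP => // _; case: gG'.
  have f'A : tends F f' A by apply: tends_near f'E fA.
  have cA : tends F (c \o f') (c A) by apply: c_tends => // k; case: (f'G k).
  have hE : tends F (fun k => (f' k) ^t* *m h *m (c \o f') k) (A ^t* *m h *m c A).
    apply: tends_mulmx => //; apply: tends_mulmx; last exact: tends_cst.
    exact: tends_adj.
  apply: tends_unique hE _; apply: tends_near (tends_cst h); apply: nearW => k.
  by case: (f'G k) => _ E; exact: esym E.
have lieG' X : in_lie G X -> in_lie G' X.
  move=> lX t; have Xg : X \in cg s by apply/cgE.
  split; first exact: lX.
  have tXg : (t%:C)%C *: X \in cg s by rewrite rpredZ.
  rewrite (cexp _ tXg) expm_adj (adjE _ tXg) -mulNr -mulrN -expm_conj // expmN.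
  by rewrite (divrK hu) (divrK (expm_unit _)).
have zG : zariski_closed G by case: (cG_algebraic s).
have G'G : G' `<=` G by move=> g [].
have [d d0 dP] := near_subgroup gG gG' G'G (zariski_limit_closed zG) clG' lieG'.
have [G'1 G'M G'V _] := gG'.
suff /(_ _ Gg0)[] : G `<=` G' by [].
apply: (connected_subgroup (@cG_connected _ _ s)) => //.
exists d => // g k Gg Gk k1; have G'k := dP k Gk k1; split=> [G'g|G'gk]; first exact: G'M.
by rewrite -[g](mulrK (Gu _ Gk)); apply: G'M => //; exact: G'V.
Qed.

End PolarDecomposition.

(** * The polar decomposition *)

Section Generation.
Context {R : realType} {n : nat} (s : cartan_datum R n).
Local Notation M := 'M[R[i]]_n.+1.
Local Notation G := (cG s).
Local Notation sigma := (csigma s).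
Local Notation theta := (ctheta s).
Local Notation c := (sigma \o theta).
Local Notation KR := (cKR s).
Implicit Types (X Y g k : M).

Context (h : M) (hp : posdef h) (hG : forall g, G g -> g ^t* * h * c g = h).

Let hu : h \is a GRing.unit := posdef_unit hp.

Let cV_E g : G g -> g ^t* * h = h * (c g)^-1.
Proof.
move=> Gg; have [cG' _ _] := c_involution s.
by rewrite -{2}(hG Gg) mulrK //; exact/(@cG_unit _ _ s)/cG'.
Qed.

Lemma cKRE k : KR k <-> G k /\ sigma k = k /\ c k = k.
Proof.
split=> [[[Gk tk] sk]|[Gk [sk ck]]]; first by rewrite /= tk.
have [sG sM sK] := csigma_involution s; have [tG tM tK] := ctheta_involution s.
by split=> //; split=> //; rewrite -[RHS]sk -[in RHS]ck /= sK //; exact: tG.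
Qed.

Lemma sigma_c g : G g -> c (sigma g) = sigma (c g).
Proof. by move=> Gg /=; rewrite ctheta_csigma. Qed.

(* The square of the positive part of g in its polar decomposition. *)
Let Q g : M := (c g)^-1 * g.

Let hQ g : G g -> h * Q g = g ^t* *m h *m g.
Proof. by move=> Gg; rewrite /Q mulrA -cV_E. Qed.

(** h Q(g) = g^* h g is positive definite, so it is diagonalized together with h; [l] consists of
    the logarithms of the eigenvalues. *)
Lemma polar_frame g : G g -> exists T l, [/\ T \in unitmx, h = T ^t* *m T & Q g = pwr T l 1].
Proof.
move=> Gg; have gu : g \in unitmx by exact: cG_unit Gg.
have hQh : herm (g ^t* *m h *m g) by exact: herm_congr (proj1 hp).
have [T [D [Tu hE QE]]] := simultaneous_diag hp hQh.
have D0 i : 0 < D 0 i.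
  have x0 : invmx T *m (delta_mx i 0 : 'cV[R[i]]_n.+1) != 0.
    by apply: mulmx_neq0; [rewrite unitmx_inv | exact: delta_neq0].
  have : 0 < qform (g ^t* *m h *m g) (invmx T *m delta_mx i 0).
    by rewrite qformM; apply: (proj2 hp); exact: mulmx_neq0.
  by rewrite QE qformM mulKVmx // qform_diag_delta.
exists T, (fun i => ln (complex.Re (D 0 i))); split; [exact: Tu | exact: hE |].
have DE : dexp (fun i => ln (complex.Re (D 0 i))) 1 = diag_mx D.
  congr diag_mx; apply/rowP => i; have := D0 i; rewrite !mxE mul1r => Di.
  rewrite lnK ?RRe_real ?gtr0_real // posrE -ltcR RRe_real ?gtr0_real //.
apply: (mulrI hu); rewrite hQ // QE /pwr DE -[RHS]/(_ *m _) [in RHS]hE.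
by rewrite !mulmxA mulmxK.
Qed.

Definition form_pos (A : M) : Prop := herm (h *m A) /\ forall x, 0 <= qform (h *m A) x.

Lemma form_pos_pwr T l t : T \in unitmx -> h = T ^t* *m T -> form_pos (pwr T l t).
Proof.
move=> Tu hE; have E : h *m pwr T l t = T ^t* *m dexp l t *m T.
  by rewrite [in LHS]hE /pwr !mulmxA mulmxK.
split; first by rewrite /herm adjM (proj1 hp) [in LHS]hE pwr_adj // -hE.
move=> x; rewrite E qformM qform_diag; apply: sumr_ge0 => i _.
by rewrite mxE mulr_ge0 ?exprn_ge0 // ler0c expR_ge0.
Qed.

Lemma form_pos_inj A B : form_pos A -> form_pos B -> B \in unitmx -> A * A = B * B -> A = B.
Proof.
move=> [hA pA] [hB pB] Bu AB; exact: (psd_root_unique hp hA hB pA pB Bu AB).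
Qed.

#[local] Opaque pwr expm.

Section Frame.
Context (g : M) (T : M) (l : 'I_n.+1 -> R).
Context (Gg : G g) (Tu : T \in unitmx) (hE : h = T ^t* *m T) (QE : Q g = pwr T l 1).

(** Needed for two groups: G in the polar decomposition, and K when the positive factor is traversed
    in small steps. *)
Lemma polar_root (H : set M) m : algebraic_subgroup H -> H g -> H (c g) -> (0 < m)%N ->
  H (pwr T l m%:R^-1).
Proof.
move=> aH Hg Hcg m0; apply: zariski_root => //; rewrite -QE /Q.
by have [_ _ HM HV] := aH; apply: HM => //; exact: HV.
Qed.

Let G_root m : (0 < m)%N -> G (pwr T l m%:R^-1).
Proof.
by apply: polar_root => //; [exact: cG_algebraic | case: (c_involution s) => + _ _; exact].
Qed.

(** c is the inverse h-adjoint on G, and powers of Q(g) are h-self-adjoint. The exponents are 1/m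
    because these are the powers that [polar_root] places in G. *)
Lemma c_root m : (0 < m)%N -> c (pwr T l m%:R^-1) = pwr T l (- m%:R^-1).
Proof.
move=> m0; have PA : (pwr T l m%:R^-1) ^t* * h = h * pwr T l m%:R^-1.
  by rewrite hE; exact: pwr_adj.
have := hG (G_root m0); rewrite PA -mulrA => /(canRL (mulKr hu)); rewrite (mulVr hu) => E.
have Pu := pwr_unit l m%:R^-1 Tu.
by rewrite (pwrN l _ Tu); apply: (mulrI Pu); rewrite E mulrV.
Qed.

(** The compact factor g Q(g)^(-1/2) of g. *)
Let k := g * pwr T l (- 2^-1).

Let Gk : G k.
Proof.
have [_ GM GV _] := cG_subgroup s.
by apply: (GM _ _ Gg); rewrite (pwrN _ _ Tu); apply/GV/(@G_root 2).
Qed.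

Lemma polar_c : c k = k.
Proof.
have [cG' cM cK'] := c_involution s; have [G1 GM GV Gu] := cG_subgroup s.
have GP := @G_root 2 isT; have gc := c_involution s.
have Pu := pwr_unit l 2^-1 Tu.
have cP : c (pwr T l (- 2^-1)) = pwr T l 2^-1.
  by rewrite -(@c_root 2 isT); exact: cK'.
have GPV : G (pwr T l (- 2^-1)) by rewrite (pwrN _ _ Tu); exact: GV.
rewrite /k (cM _ _ Gg GPV) cP; have cgE : c g = g * pwr T l (- 1).
  apply: (mulIr (pwr_unit l 1 Tu)); rewrite -mulrA -(pwrD _ _ _ Tu) addNr (pwr0 _ Tu) mulr1 -QE /Q.
  by rewrite (mulVKr (cG_unit (cG' _ Gg))).
by rewrite cgE -mulrA -(pwrD _ _ _ Tu); congr (_ * pwr _ _ _); field.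
Qed.

Lemma polar_pos : form_pos (k^-1 * g).
Proof.
have -> : k^-1 * g = pwr T l 2^-1; last exact: (form_pos_pwr _ _ Tu hE).
have Pu := pwr_unit l (- 2^-1) Tu; have gu := cG_unit Gg.
rewrite /k (invrM gu Pu) (divrK gu) -(pwrN _ _ Tu); congr pwr; exact: opprK.
Qed.

(** sigma commutes with c and fixes g, so Q^(1/2) and its image under sigma are square roots of the
    same element Q(g); both are positive for h, hence equal. *)
Lemma polar_sigma : sigma g = g -> sigma k = k.
Proof.
move=> sg; have [cG' cM cK'] := c_involution s; have [G1 GM GV Gu] := cG_subgroup s.
have si := csigma_involution s; have [sG sM sK] := si.
have GP2 := @G_root 2 isT; have GP4 := @G_root 4 isT.
have P44 : pwr T l 4^-1 * pwr T l 4^-1 = pwr T l 2^-1.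
  by rewrite -(pwrD _ _ _ Tu); congr pwr; field.
have P22 : pwr T l 2^-1 * pwr T l 2^-1 = pwr T l 1.
  by rewrite -(pwrD _ _ _ Tu); congr pwr; field.
(* The fourth root yields positivity of the image: r is h-self-adjoint because c inverts it, so h
   sigma(Q^(1/2)) = r^* h r. *)
pose r := sigma (pwr T l 4^-1).
have Gr : G r by exact: sG.
have sP : sigma (pwr T l 2^-1) = pwr T l 2^-1.
  apply: form_pos_inj.
  - have rE : r ^t* * h = h * r.
      rewrite (cV_E Gr) /r (sigma_c GP4) (@c_root 4 isT); congr (_ * _).
      have GP4V : G (pwr T l (- 4^-1)) by rewrite (pwrN _ _ Tu); exact: GV.
      have E : sigma (pwr T l (- 4^-1)) * r = 1.
        by rewrite -(sM _ _ GP4V GP4) -(pwrD _ _ _ Tu) addNr (pwr0 _ Tu) sigma1.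
      have su := Gu _ (sG _ GP4V).
      by apply: (mulrI su); rewrite (mulrV su) E.
    have E : h *m sigma (pwr T l 2^-1) = r ^t* *m h *m r.
      by rewrite -P44 (sM _ _ GP4 GP4) -/r -[RHS]/(r ^t* * h * r) rE -mulrA.
    split; first by rewrite E; exact: herm_congr (proj1 hp).
    move=> x; rewrite E qformM; have [->|x0] := eqVneq (r *m x) 0.
      by rewrite /qform mulmx0 mxE.
    exact/ltW/(proj2 hp).
  - exact: (form_pos_pwr _ _ Tu hE).
  - exact: pwr_unit.
  rewrite -(sM _ _ GP2 GP2) P22 -QE /Q (sM _ _ (GV _ (cG' _ Gg)) Gg).
  have -> : sigma (c g)^-1 = (c g)^-1.
    have Gcg := cG' _ Gg; have scg : sigma (c g) = c g by rewrite -(sigma_c Gg) sg.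
    have gu := Gu _ Gcg.
    by apply: (mulrI gu); rewrite -{1}scg -(sM _ _ Gcg (GV _ Gcg)) (mulrV gu) sigma1.
  by rewrite sg.
have GPV : G (pwr T l (- 2^-1)) by rewrite (pwrN _ _ Tu); exact: GV.
rewrite /k (sM _ _ Gg GPV) sg; congr (_ * _); apply: (mulrI (pwr_unit l 2^-1 Tu)).
by rewrite -{1}sP -(sM _ _ GP2 GPV) -(pwrD _ _ _ Tu) subrr (pwr0 _ Tu) sigma1.
Qed.

End Frame.

End Generation.

(** * Propagation from 1 to all of K *)

Section Induction.
Context {R : realType} {n : nat} (s : cartan_datum R n).
Local Notation M := 'M[R[i]]_n.+1.
Local Notation G := (cG s).
Local Notation sigma := (csigma s).
Local Notation theta := (ctheta s).
Local Notation c := (sigma \o theta).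
Local Notation KR := (cKR s).
Implicit Types (X Y g k : M).

Context (h : M) (hp : posdef h) (hG : forall g, G g -> g ^t* * h * c g = h).

Let hu : h \is a GRing.unit := posdef_unit hp.

Lemma cKR_subgroup : subgroup KR.
Proof.
have [K1 KM KV Ku] := cK_subgroup s; have [G1 GM GV Gu] := cG_subgroup s.
have [sG sM sK] := csigma_involution s.
split.
- by split=> //; exact: sigma1.
- by move=> g k [Kg sg] [Kk sk]; split; [exact: KM | rewrite sM ?sg ?sk //; [case: Kg | case: Kk]].
- move=> k [Kk sk]; split; first exact: KV.
  have Gk : G k by case: Kk.
  by apply: (mulrI (Gu _ Gk)); rewrite -{1}sk -sM ?(divrr (Gu _ Gk)) ?sigma1 //; exact: GV.
by move=> k [Kk _]; exact: Ku.
Qed.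

Lemma form_pos1 : form_pos h 1.
Proof.
split; first by rewrite mulmx1; case: hp.
move=> x; rewrite mulmx1; have [->|x0] := eqVneq x 0; first by rewrite /qform mulmx0 mxE.
exact/ltW/(proj2 hp).
Qed.

(** Each k is h-unitary, so a self-adjoint k^-1 g has square h^-1 g^* h g, independent of k;
    positive square roots are unique. *)
Lemma polar_unique k1 k2 g : KR k1 -> KR k2 -> G g ->
  form_pos h (k1^-1 * g) -> form_pos h (k2^-1 * g) -> k1 = k2.
Proof.
move=> K1 K2 Gg p1 p2; have [_ _ KV Ku] := cKR_subgroup.
have gu := cG_unit Gg.
have sq k : KR k -> form_pos h (k^-1 * g) -> h * ((k^-1 * g) * (k^-1 * g)) = g ^t* * h * g.
  move=> Kk [hk _]; have [Gk [_ ck]] := (cKRE s _).1 (KV _ Kk).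
  have := hG Gk; rewrite ck => E.
  have hkE : (k^-1 * g) ^t* * h = h * (k^-1 * g).
    by apply: esym; rewrite -[LHS]hk adjM (proj1 hp).
  rewrite (mulrA h (k^-1 * g)) -hkE adjR.
  transitivity (g ^t* * ((k^-1) ^t* * h * k^-1) * g); first by rewrite !mulrA.
  by rewrite E.
have A12 : k1^-1 * g = k2^-1 * g.
  apply: (form_pos_inj hp p1 p2).
    have k2u := Ku _ (KV _ K2).
    by rewrite -[_ \in unitmx]/(_ \is a GRing.unit) unitrMl.
  by apply: (mulrI hu); exact: etrans (sq _ K1 p1) (esym (sq _ K2 p2)).
by have := mulIr gu A12 => /invr_inj.
Qed.

(** Elements whose compact polar factor lies in S. *)
Let E (S : set M) : set M := [set g | exists k, [/\ KR k, S k & form_pos h (k^-1 * g)]].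

(** Compactness gives the polar factors of a convergent sequence a limit in K(R), and the local
    constancy of S at scale d carries S over to that limit. *)
Let E_closed (S : set M) (d : R) : 0 < d ->
  (forall k k', KR k -> KR k' -> nrm (k'^-1 * k - 1) < d -> S k -> S k') -> closed (E S).
Proof.
move=> d0 Sd p cp.
have ex (j : nat) : exists gk : M * M, [/\ nrm (gk.1 - p) < j.+1%:R^-1, KR gk.2, S gk.2 &
    form_pos h (gk.2^-1 * gk.1)].
  have [|g [[k [Kk Sk pk]] gp]] := cp [set g | nrm (g - p) < j.+1%:R^-1].
    by apply/nbhs_nrmP; exists j.+1%:R^-1; rewrite ?invr_gt0.
  by exists (g, k).
have [gk gkP] := choice ex.
have [F [FU ooF]] := ultra_seq.
have gF : tends F (fun j => (gk j).1) p.
  by apply: (tends_sub ooF); apply: tends_shrink => j; case: (gkP j).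
have Uk j : fixed G c (gk j).2.
  by case: (gkP j) => _ /(cKRE s)[Gk [_ ck]] _ _.
have [B UB] := compact_bounded (@ctheta_cartan _ _ s).
have [k0 kF] : exists k0, tends F (fun j => (gk j).2) k0.
  by apply: (ultra_tends (B := B)); apply: nearW => j; exact: UB.
have [Gk0 ck0] := compact_limit (@ctheta_cartan _ _ s) _ Uk kF.
have k0u := cG_unit Gk0.
have [_ tk0] : cK s k0.
  have zK : zariski_closed (cK s) by case: (cK_algebraic s).
  apply: (zariski_limit_closed zK _ kF _ k0u).
  by apply: nearW => j; case: (gkP j) => _ [].
have Kk0 : KR k0 by apply/cKRE; do 2!split=> //; rewrite -{1}tk0.
have kVF : tends F (fun j => (gk j).2^-1) k0^-1 by exact: tends_invmx.
exists k0; split=> //.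
  have k1 : tends F (fun j => k0^-1 *m (gk j).2) (k0^-1 *m k0).
    by apply: tends_mulmx => //; exact: tends_cst.
  have [j hj] := @filter_ex _ F _ _ (k1 _ d0).
  have [_ Kj Sj _] := gkP j; apply: (Sd _ _ Kj Kk0 _ Sj).
  by move: hj; rewrite -[_ *m k0]/(_ * k0) mulVr.
have lim : tends F (fun j => h *m ((gk j).2^-1 *m (gk j).1)) (h *m (k0^-1 *m p)).
  by apply: tends_mulmx; [exact: tends_cst | exact: tends_mulmx].
split.
  apply: (tends_unique (tends_adj lim)); apply: tends_near lim; apply: nearW => j.
  by case: (gkP j) => _ _ _ [hE _]; exact: esym hE.
move=> x; apply: (ctends_ge (ctends_qform x lim)); apply: nearW => j.
by case: (gkP j) => _ _ _ [_]; exact.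
Qed.

Lemma cK_induction_aux (P : M -> Prop) : P 1 ->
  (exists2 d : R, 0 < d & forall g w, cK s g -> cK s w -> nrm (w - 1) < d -> P g <-> P (g * w)) ->
  forall g, cK s g -> P g.
Proof.
move=> P1 [d d0 dP].
have [G1 GM GV Gu] := cG_subgroup s; have [K1 KM KV Ku] := cK_subgroup s.
have [cG' cM cK'] := c_involution s.
have [R1 RM RV Ru] := cKR_subgroup.
have near_eq k k' : KR k -> KR k' -> nrm (k'^-1 * k - 1) < d -> P k' <-> P k.
  move=> Kk Kk' kd; rewrite -[k](mulVKr (Ru _ Kk')); apply: dP => //; first by case: Kk'.
  by apply: KM; [apply: KV; case: Kk' | case: Kk].
have cP : closed (E P).
  by apply: (E_closed d0) => k k' Kk Kk' /(near_eq _ _ Kk Kk')[].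
have cnP : closed (E (~` P)).
  apply: (E_closed d0) => k k' Kk Kk' kd nPk Pk'; apply: nPk.
  by apply/(near_eq _ _ Kk Kk' kd).
have cover g : fixed G sigma g -> exists2 k, KR k & form_pos h (k^-1 * g).
  move=> [Gg sg]; have [T [l [Tu hE QE]]] := polar_frame hp hG Gg.
  exists (g * pwr T l (- 2^-1)); last exact: (@polar_pos _ _ s h hp g T l Gg Tu hE).
  apply/cKRE; split; last split.
  - apply: GM => //; rewrite (pwrN _ _ Tu); apply: GV.
    exact: (polar_root Tu QE (cG_algebraic s) Gg (cG' _ Gg) (isT : (0 < 2)%N)).
  - exact: (polar_sigma hp hG Gg Tu hE QE sg).
  - exact: (polar_c hp hG Gg Tu hE QE).
(* Existence and uniqueness of the compact factor make the closed sets [E] of P and [E] of its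
   complement complementary in the connected group G^sigma. *)
have main : fixed G sigma `&` E P = fixed G sigma.
  apply: (@cGR_connected _ _ s).
  - exists 1; split; first by split; [exact: G1 | exact: sigma1].
    by exists 1; split=> //; rewrite invr1 mulr1; exact: form_pos1.
  - exists (~` E (~` P)); first exact: closed_openC.
    apply/seteqP; split=> g [Fg Eg]; split=> //.
      move=> [k [Kk nPk pk]]; have [k' [Kk' Pk' pk']] := Eg.
      by apply: nPk; rewrite (polar_unique Kk Kk' (proj1 Fg) pk pk').
    have [k Kk pk] := cover g Fg; exists k; split=> //.
    by apply: contrapT => nPk; apply: Eg; exists k.
  - by exists (E P).
have PR k : KR k -> P k.
  move=> Kk; have [Gk [sk ck]] := (cKRE s k).1 Kk.
  have : fixed G sigma k by split.
  rewrite -main => -[_ [k' [Kk' Pk' pk']]].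
  have pk : form_pos h (k^-1 * k) by rewrite (mulVr (Gu _ Gk)); exact: form_pos1.
  by rewrite (polar_unique Kk Kk' Gk pk pk').
(* For general g in K the factor k = g Q^(-1/2) is fixed by theta and c, hence by sigma, so P holds
   at k. From k, the element g is reached by m right multiplications by Q^(1/(2m)), which lies in K
   and is as close to 1 as required. *)
move=> g Kg; have Gg : G g by case: Kg.
have [T [l [Tu hE QE]]] := polar_frame hp hG Gg.
have Kcg : cK s (c g).
  case: Kg => _ tg; split; first exact: cG'.
  by rewrite /= !tg (ctheta_csigma Gg) tg.
have Kroot m : (0 < m)%N -> cK s (pwr T l m%:R^-1).
  by move=> m0; exact: (polar_root Tu QE (cK_algebraic s) Kg Kcg m0).
set k := g * pwr T l (- 2^-1).
have Kk : cK s k.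
  by apply: (KM _ _ Kg); rewrite (pwrN _ _ Tu); apply: KV; exact: (Kroot 2).
have Pk : P k.
  apply: PR; split=> //; have [_ tk] := Kk.
  by have := polar_c hp hG Gg Tu hE QE; rewrite -/k /= tk.
have [m [m0 md]] : exists m, (0 < m)%N /\ nrm (pwr T l (m * 2)%:R^-1 - 1) < d.
  have [N _ NP] := tends_pwr l Tu d0.
  exists N.+1; split=> //; apply: NP => /=; lia.
have Kw : cK s (pwr T l (m * 2)%:R^-1) by apply: Kroot; rewrite muln_gt0 m0.
have Pw j : P (k * pwr T l (m * 2)%:R^-1 ^+ j).
  elim: j => [|j IH]; first by rewrite expr0 mulr1.
  have Kkj := KM _ _ Kk (subgroupX j (cK_subgroup s) Kw).
  by rewrite exprSr mulrA; exact: (dP _ _ Kkj Kw md).1 IH.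
have := Pw m; rewrite (pwrX _ _ _ Tu).
have -> : (m * 2)%:R^-1 *+ m = 2^-1 :> R.
  by rewrite -[_ *+ m]mulr_natr natrM invfM -mulrA mulrCA mulVf ?mulr1 // pnatr_eq0 -lt0n.
by rewrite /k -mulrA -(pwrD _ _ _ Tu) addNr (pwr0 _ Tu) mulr1.
Qed.

End Induction.

(* That is, K is generated by each neighbourhood of 1. *)
Lemma cK_induction {R : realType} {n : nat} (s : cartan_datum R n) (P : 'M[R[i]]_n.+1 -> Prop) :
  P 1 ->
  (exists2 d : R, 0 < d & forall g w, cK s g -> cK s w -> nrm (w - 1) < d -> P g <-> P (g * w)) ->
  forall g, cK s g -> P g.
Proof.
have [h hp hG] := cartan_form s; exact: (cK_induction_aux hp hG).
Qed.

(** * The Dirac operator on a unitary module *)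

Section RealBasis.
Context {R : realType} {n : nat} (s : cartan_datum R n).
Local Notation M := 'M[R[i]]_n.+1.
Local Notation G := (cG s).
Local Notation sigma := (csigma s).
Local Notation theta := (ctheta s).
Context (beta : M -> M -> R[i]) (Hb : invariant_form s beta).
Local Notation b := (beta0 (s := s) beta).
Local Notation p0 := (p0 s).
Implicit Types (X Y Z v w : p0).

Lemma cp_cg (X : M) : X \in cp s -> X \in cg s.
Proof. by move=> /cpP[lX _]; apply/cgP. Qed.

Lemma p0_cg X : vsval X \in cg s.
Proof. exact/cp_cg/subvsP. Qed.

Lemma b_linear Z a X Y : b (a *: X + Y) Z = a * b X Z + b Y Z.
Proof. by rewrite /beta0 linearP (beta_linear Hb) ?p0_cg. Qed.

Lemma b_sym X Y : b X Y = b Y X.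
Proof. by rewrite /beta0 (beta_sym Hb) ?p0_cg. Qed.

Lemma b0 Z : b 0 Z = 0.
Proof.
have := b_linear Z (-1) 0 0; rewrite scaler0 addr0 mulN1r => ->.
by rewrite addNr.
Qed.

Lemma bZ a X Z : b (a *: X) Z = a * b X Z.
Proof. by rewrite -[a *: X]addr0 b_linear b0 addr0. Qed.

Lemma bD X Y Z : b (X + Y) Z = b X Z + b Y Z.
Proof. by rewrite -[X]scale1r b_linear mul1r scale1r. Qed.

Lemma bN X Z : b (- X) Z = - b X Z.
Proof. by rewrite -scaleN1r bZ mulN1r. Qed.

Lemma b_sum (I : Type) (r : seq I) (f : I -> p0) Z :
  b (\sum_(i <- r) f i) Z = \sum_(i <- r) b (f i) Z.
Proof. by elim: r => [|i r IH]; rewrite ?big_nil ?b0 // !big_cons bD IH. Qed.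

Lemma bZr a X Z : b Z (a *: X) = a * b Z X.
Proof. by rewrite b_sym bZ b_sym. Qed.

Lemma bDr X Y Z : b Z (X + Y) = b Z X + b Z Y.
Proof. by rewrite b_sym bD !(b_sym Z). Qed.

Lemma bNr X Z : b Z (- X) = - b Z X.
Proof. by rewrite b_sym bN b_sym. Qed.

Definition real_vec X : Prop := sigma_real s (vsval X).

(** [sigma_real] is expressed through one-parameter groups and is not visibly a linear condition.
    tau is the differential of sigma restricted to p_0. *)
Lemma p0_real_structure : exists tau : p0 -> p0,
  [/\ forall a X Y, tau (a *: X + Y) = a^* *: tau X + tau Y,
      forall X, tau (tau X) = X & forall X, real_vec X <-> tau X = X].
Proof.
have gG := cG_subgroup s; have [G1 GM GV Gu] := gG.
have [sG sM sK] := csigma_involution s.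
have [L Ll dL] := sigma_diff s.
have L0 : L 0 = 0 by have := Ll (-1) 0 0; rewrite scaler0 addr0 rmorphN1 scaleN1r addNr.
have LZ (a : R[i]) (X : M) : L (a *: X) = a^* *: L X by rewrite -[a *: X]addr0 Ll L0 addr0.
have LR (t : R) (X : M) : L ((t%:C)%C *: X) = (t%:C)%C *: L X.
  by rewrite LZ; congr (_ *: _); exact: conjc_real.
have sexp (X : M) (t : R) : X \in cg s ->
    sigma (expm ((t%:C)%C *: X)) = expm ((t%:C)%C *: L X).
  move=> Xg; rewrite -LR; apply: (diff_expm gG (csigma_involution s) dL).
  by apply/cgE/rpredZ.
have expG (X : M) (t : R) : X \in cg s -> G (expm ((t%:C)%C *: X)) by move=> /cgE; exact.
have Lg (X : M) : X \in cg s -> L X \in cg s.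
  by move=> Xg; apply/cgE => t; rewrite -sexp //; exact/sG/expG.
have LLX (X : M) : X \in cg s -> L (L X) = X.
  by move=> Xg; apply: expm_inj => t; rewrite -sexp ?Lg // -sexp // sK //; exact: expG.
have Lp (X : M) : X \in cp s -> L X \in cp s.
  move=> Xp; have Xg := cp_cg Xp; have /cpP[_ tX] := Xp.
  apply/cpP; split; first by apply/cgP/Lg.
  move=> t; rewrite -sexp // ctheta_csigma; last exact: expG.
  have LN : L (- X) = - L X by rewrite -[- X]scaleN1r LZ rmorphN1 scaleN1r.
  have Ng : - X \in cg s by rewrite rpredN.
  by rewrite tX (sexp _ _ Ng) LN.
exists (fun X => vsproj (cp s) (L (vsval X))); split.
- by move=> a X Y; rewrite linearP Ll linearP.
- by move=> X; rewrite vsprojK ?Lp ?subvsP // LLX ?p0_cg // vsvalK.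
move=> X; split=> [rX|XE].
  have -> : L (vsval X) = vsval X; last exact: vsvalK.
  by apply: expm_inj => t; rewrite -sexp ?p0_cg // rX.
have LX : L (vsval X) = vsval X by rewrite -[in RHS]XE vsprojK // Lp // subvsP.
by move=> t; rewrite (sexp _ _ (p0_cg X)) LX.
Qed.

Lemma b_pos X : real_vec X -> X != 0 -> 0 < b X X.
Proof.
move=> rX X0; apply: (beta_pos Hb (subvsP X) rX).
by apply: contra_neq X0 => X0; rewrite -(vsvalK X) X0 linear0.
Qed.

(** No axiom relates the form to sigma directly: b X X is real by positivity, and polarization gives
    b X Y. *)
Lemma b_real X Y : real_vec X -> real_vec Y -> b X Y \is Num.real.
Proof.
have [tau [tl tt tr]] := p0_real_structure.
move=> /tr rX /tr rY.
have rs Z : tau Z = Z -> b Z Z \is Num.real.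
  move=> /tr rZ; have [->|Z0] := eqVneq Z 0; first by rewrite b0 real0.
  exact/gtr0_real/b_pos.
have XY : tau (X + Y) = X + Y.
  by have := tl 1 X Y; rewrite !scale1r rX rY rmorph1 scale1r.
have := rs _ XY; rewrite bD !bDr (b_sym Y X).
have -> : b X X + b X Y + (b X Y + b Y Y) = 2 * b X Y + (b X X + b Y Y) by ring.
have rXY : b X X + b Y Y \is Num.real by rewrite realD ?rs.
rewrite rpredDr // => h2.
by rewrite -[b X Y](mulKf (_ : 2 != 0)) ?pnatr_eq0 // rpredM // rpredV realn.
Qed.

(* Norm 2 means gamma_0(v)^2 = 1. *)
Definition orthogonal_seq (V : seq p0) : Prop :=
  uniq V /\ forall v w, v \in V -> w \in V -> b v w = (if v == w then 2 else 0).

Definition proj (V : seq p0) X : p0 := \sum_(v <- V) (b X v / 2) *: v.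

Lemma proj_cons v V X : proj (v :: V) X = (b X v / 2) *: v + proj V X.
Proof. by rewrite /proj big_cons. Qed.

Lemma proj_linear V a X Y : proj V (a *: X + Y) = a *: proj V X + proj V Y.
Proof.
rewrite /proj scaler_sumr -big_split; apply: eq_bigr => v _ /=.
by rewrite b_linear scalerA -scalerDl mulrA mulrDl.
Qed.

Lemma b_proj V X w : orthogonal_seq V -> w \in V -> b (proj V X) w = b X w.
Proof.
move=> [uV oV] wV; rewrite b_sum (bigD1_seq w) //= big1_seq ?addr0.
  by rewrite bZ (oV w w) // eqxx divfK // pnatr_eq0.
by move=> v /andP[vw vV]; rewrite bZ (oV v w) // (negbTE vw) mulr0.
Qed.

Lemma gram_schmidt (Xs : seq p0) : (forall X, X \in Xs -> real_vec X) ->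
  exists V, [/\ orthogonal_seq V, forall v, v \in V -> real_vec v &
    forall X, X \in Xs -> proj V X = X].
Proof.
have [tau [tl tt tr]] := p0_real_structure.
elim: Xs => [|X Xs IH] rX; first by exists [::].
have [V [oV rV pV]] := IH (fun Y hY => rX Y (@mem_behead _ (X :: Xs) Y hY)).
have rXX := rX X (mem_head _ _).
have [XE|XnE] := eqVneq (proj V X) X.
  by exists V; split=> // Y; rewrite inE => /orP[/eqP->|/pV].
pose Y := X - proj V X.
have Y0 : Y != 0 by rewrite subr_eq0 eq_sym.
have bY w : w \in V -> b Y w = 0.
  by move=> wV; rewrite bD bN b_proj // subrr.
have tau0 : tau 0 = 0.
  by have := tl (-1) 0 0; rewrite scaler0 addr0 rmorphN1 scaleN1r addNr.
have tauZ (a : R[i]) Z : a \is Num.real -> tau Z = Z -> tau (a *: Z) = a *: Z.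
  by move=> ar Zr; rewrite -[a *: Z]addr0 tl tau0 Zr conj_Creal.
have tauD Z W : tau Z = Z -> tau W = W -> tau (Z + W) = Z + W.
  by move=> Zr Wr; rewrite -[Z]scale1r tl rmorph1 Zr Wr scale1r.
have rp : tau (proj V X) = proj V X.
  have : forall W : seq p0, (forall v, v \in W -> real_vec v) -> tau (proj W X) = proj W X.
    elim=> [|v W IHW] rW; first by rewrite /proj big_nil tau0.
    have rv := rW v (mem_head _ _).
    rewrite /proj big_cons; apply: tauD.
      apply: tauZ; last exact/tr.
      by rewrite rpredM ?realV ?realn //; exact: b_real.
    by apply: IHW => w wW; apply: rW; rewrite inE wW orbT.
  exact.
have rY : real_vec Y.
  apply/tr; apply: tauD; first exact/tr.
  by rewrite -scaleN1r; apply: tauZ => //; rewrite rpredN1.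
have bYY := b_pos rY Y0.
(* Real since b Y Y > 0, so the rescaled vector of norm 2 is still sigma-real. *)
pose a := sqrtC (2 / b Y Y).
have a2 : a * a = 2 / b Y Y by rewrite -expr2 sqrtCK.
have ar : a \is Num.real by rewrite ger0_real // sqrtC_ge0 divr_ge0 // ltW.
have vv : b (a *: Y) (a *: Y) = 2.
  by rewrite bZ bZr mulrA a2 divfK // gt_eqF.
have vnV : a *: Y \notin V.
  apply/negP => hv; have := bY _ hv; rewrite bZr => /eqP; rewrite mulf_eq0.
  have a0 : a != 0 by rewrite sqrtC_eq0 mulf_neq0 ?invr_eq0 ?pnatr_eq0 ?gt_eqF.
  by rewrite (negbTE a0) gt_eqF.
exists (a *: Y :: V); split.
- split; first by rewrite /= vnV; case: oV.
  move=> v w; rewrite !inE => /orP[/eqP->|vV] /orP[/eqP->|wV].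
  + by rewrite eqxx.
  + rewrite bZ bY // mulr0; case: eqP => // E.
    by rewrite E wV in vnV.
  + rewrite b_sym bZ bY // mulr0; case: eqP => // E.
    by rewrite -E vV in vnV.
  by case: oV => _; exact.
- by move=> v; rewrite inE => /orP[/eqP->|/rV //]; apply/tr/tauZ => //; exact/tr.
have exX Z : proj (a *: Y :: V) Z = (b Z Y / b Y Y) *: Y + proj V Z.
  have aE : a * b Z Y / 2 * a = b Z Y / b Y Y.
    have -> : a * b Z Y / 2 * a = (a * a) * b Z Y / 2 by ring.
    by rewrite a2; field; rewrite gt_eqF.
  by rewrite proj_cons scalerA bZr aE.
move=> Z; rewrite inE exX => /orP[/eqP->|ZXs].
  have -> : b X Y = b Y Y.
    have -> : b Y Y = b X Y - b (proj V X) Y by rewrite [in LHS]/Y bD bN.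
    rewrite b_sum big1_seq ?subr0 // => v /andP[_ vV].
    by rewrite bZ (b_sym v) bY // mulr0.
  by rewrite divff ?gt_eqF // scale1r subrK.
have -> : b Z Y = 0; last by rewrite mul0r scale0r add0r pV.
rewrite -(pV _ ZXs) b_sum big1_seq // => v /andP[_ vV].
by rewrite bZ (b_sym v) bY // mulr0.
Qed.

Lemma orthogonal_basis : exists V : seq p0, [/\ orthogonal_seq V,
  forall v, v \in V -> real_vec v & forall X, proj V X = X].
Proof.
have [tau [tl tt tr]] := p0_real_structure.
pose re X := X + tau X; pose im X := 'i *: X + tau ('i *: X).
have tauD Z W : tau (Z + W) = tau Z + tau W by rewrite -[Z]scale1r tl rmorph1 !scale1r.
have rre X : real_vec (re X) by apply/tr; rewrite tauD tt addrC.
have rim X : real_vec (im X) by rewrite /im; exact: rre.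
pose E := vbasis (fullv : {vspace p0}).
have [V [oV rV pV]] := @gram_schmidt ([seq re X | X <- E] ++ [seq im X | X <- E]) (ltac:(
  by move=> X; rewrite mem_cat => /orP[/mapP[Y _ ->]|/mapP[Y _ ->]])).
exists V; split=> // X.
have p0E : proj V 0 = 0 by have := proj_linear V (-1) 0 0; rewrite scaler0 addr0 scaleN1r addNr.
have pE Y : Y \in (E : seq p0) -> proj V Y = Y.
  move=> YE; have h1 : proj V (re Y) = re Y.
    by apply: pV; rewrite mem_cat map_f.
  have h2 : proj V (im Y) = im Y.
    by apply: pV; rewrite mem_cat map_f ?orbT.
  (* Every vector is a complex combination of two sigma-real ones, so a projection that fixes these
     fixes everything. *)
  have YEE : Y = 2^-1 *: (re Y) + (- 'i / 2) *: im Y.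
    have tau0 : tau 0 = 0.
      by have := tl (-1) 0 0; rewrite scaler0 addr0 rmorphN1 scaleN1r addNr.
    have tiY : tau ('i *: Y) = - 'i *: tau Y by rewrite -['i *: Y]addr0 tl tau0 addr0 conjCi.
    have ii : - 'i / 2 * 'i = 2^-1 :> R[i] by rewrite mulrAC mulNr -expr2 sqrCi opprK mul1r.
    have ii' : - 'i / 2 * - 'i = - 2^-1 :> R[i] by rewrite mulrN ii.
    rewrite /re /im tiY !scalerDr !scalerA ii ii' scaleNr addrACA subrr addr0.
    by rewrite -scalerDl -[2^-1]mul1r -splitr scale1r.
  have pZ a Z : proj V (a *: Z) = a *: proj V Z by rewrite -[a *: Z]addr0 proj_linear p0E addr0.
  have pD Z W : proj V (Z + W) = proj V Z + proj V W.
    by rewrite -[Z]scale1r proj_linear !scale1r.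
  by rewrite {1}YEE pD !pZ h1 h2 -YEE.
rewrite [X](coord_vbasis (memvf X)).
elim/big_ind: _ => [|Y Z hY hZ|i _].
- exact: p0E.
- by rewrite -[Y]scale1r proj_linear hY hZ.
have Ei : E`_i \in (E : seq p0) by apply: mem_nth; rewrite size_tuple.
by rewrite -[_ *: _]addr0 proj_linear p0E (pE _ Ei).
Qed.

End RealBasis.

Lemma lq_pi0 (F : fieldType) (U : lmodType F) (I : {pred U}) (I_closed : submod_closed I) :
  \pi_(lmod_quot I_closed)%qT 0 = 0.
Proof.
have := lq_scaleE I_closed 0 0; rewrite scale0r => <-.
exact: (@scale0r F (lmod_quot I_closed)).
Qed.

(** * The square of the Dirac operator and the action of p_0 *)

Section Trivial.
Context {R : realType} {n : nat} (s : cartan_datum R n).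
Local Notation M := 'M[R[i]]_n.+1.
Context (beta : M -> M -> R[i]) (Hb : invariant_form s beta).
Local Notation b := (beta0 (s := s) beta).
Local Notation p0 := (p0 s).
Context (d : nat) (e e' : d.-tuple p0) (He : dual_bases beta e e').
Context (m : nat) (S : clifford_module b m).
Context (V : gK_module s).
Implicit Types (X Y Z : p0) (v w : V).

Let T X : {linear V -> V} := actg V (0, X).

Lemma actg0 v : actg V 0 v = 0.
Proof.
have := actgP (-1) 0 0 v; rewrite scaler0 addr0 scaleN1r => ->.
by rewrite addNr.
Qed.

Lemma T_linear a X Y v : T (a *: X + Y) v = a *: T X v + T Y v.
Proof.
rewrite /T -actgP; congr (actg V _ v).
by apply/eqP; rewrite xpair_eqE /= scaler0 addr0 !eqxx.
Qed.

Lemma T0 v : T 0 v = 0. Proof. exact: actg0. Qed.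

Lemma TZ a X v : T (a *: X) v = a *: T X v.
Proof. by rewrite -[a *: X]addr0 T_linear T0 addr0. Qed.

Lemma TD X Y v : T (X + Y) v = T X v + T Y v.
Proof. by rewrite -[X]scale1r T_linear !scale1r. Qed.

Lemma T_sum (I : Type) (r : seq I) (f : I -> p0) v :
  T (\sum_(i <- r) f i) v = \sum_(i <- r) T (f i) v.
Proof. by elim: r => [|i r IH]; rewrite ?big_nil ?T0 // !big_cons TD IH. Qed.

Lemma lieb0l (A : M) : lieb 0 A = 0.
Proof. by rewrite /lieb mul0r mulr0 subrr. Qed.

Lemma lieb0r (A : M) : lieb A 0 = 0.
Proof. by rewrite /lieb mul0r mulr0 subrr. Qed.

Lemma T_comm X Y v : T X (T Y v) = T Y (T X v).
Proof.
apply/eqP; rewrite -subr_eq0; apply/eqP; rewrite /T -actg_bracket.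
have -> : bracket0 (0, X) (0, Y) = 0 :> g0 s.
  by rewrite /bracket0 /= !lieb0l lieb0r addr0 !linear0.
exact: actg0.
Qed.

Let Gm X : 'M[R[i]]_m := S (gamma0 beta X).

Lemma Gm_linear a X Y : Gm (a *: X + Y) = a *: Gm X + Gm Y.
Proof. by rewrite /Gm /gamma0 linearP rmorphD cliff_actZ. Qed.

Lemma Gm_anticomm X Y : Gm X *m Gm Y + Gm Y *m Gm X = (b X Y)%:M.
Proof.
have h U W : Gm U *m Gm W = S (gamma0 beta U * gamma0 beta W) by rewrite rmorphM.
by rewrite !h -rmorphD cliff_gammaP cliff_actZ rmorph1 -scalemx1.
Qed.

Context (B : seq p0) (oB : orthogonal_seq beta B) (rB : forall u : p0, u \in B -> real_vec u)
  (pB : forall X, proj beta B X = X).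

Lemma b_nondeg Z : (forall X, b X Z = 0) -> Z = 0.
Proof.
move=> h; rewrite -(pB Z) /proj big1_seq // => v _.
by rewrite (b_sym Hb) h mul0r scale0r.
Qed.

Lemma dual_expansion X : \sum_i b (tnth e i) X *: tnth e' i = X.
Proof.
apply/eqP; rewrite -subr_eq0; apply/eqP/b_nondeg => Y.
have [/andP[/eqP spE fE] ee'] := He.
have bL : forall Z (I : Type) (r : seq I) (f : I -> p0),
    b Z (\sum_(i <- r) f i) = \sum_(i <- r) b Z (f i).
  move=> Z I r f; rewrite (b_sym Hb) (b_sum Hb); apply: eq_bigr => i _.
  by rewrite (b_sym Hb).
have main j : b (tnth e j) (\sum_i b (tnth e i) X *: tnth e' i - X) = 0.
  rewrite (bDr Hb) (bNr Hb) bL (bigD1 j) //= big1 ?addr0.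
    by rewrite (bZr Hb) ee' eqxx mulr1 subrr.
  by move=> i ij; rewrite (bZr Hb) ee' eq_sym (negbTE ij) mulr0.
have : Y \in <<e>>%VS by rewrite spE memvf.
move=> /coord_span ->; rewrite (b_sum Hb) big1 // => j _.
by rewrite (bZ Hb) -tnth_nth main mulr0.
Qed.

Lemma tensor_opE (f : {linear V -> V}) (A : 'M[R[i]]_m) x a :
  tensor_op f A x a = \sum_j A a j *: f (x j).
Proof. by rewrite ffunE. Qed.

(** Independence of the basis: since b v v = 2, the vector dual to v in [B] is v/2, whence the
    factor 1/2. *)
Lemma dirac_opE x a : @dirac_op _ _ s beta d e e' m S V x a =
  \sum_(v <- B) \sum_j (2^-1 * Gm v a j) *: T v (x j).
Proof.
rewrite /dirac_op sum_ffunE.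
under eq_bigr => i _ do rewrite tensor_opE.
rewrite exchange_big [RHS]exchange_big; apply: eq_bigr => j _ /=.
have GmE X : Gm X a j = \sum_i b (tnth e i) X * Gm (tnth e' i) a j.
  have Gm0 : Gm 0 = 0.
    by have := Gm_linear (-1) 0 0; rewrite scaler0 addr0 scaleN1r addNr.
  have -> : Gm X = \sum_i b (tnth e i) X *: Gm (tnth e' i).
    rewrite -{1}[X]dual_expansion; elim/big_ind2: _ => [|X1 A1 X2 A2 <- <-|i _].
    - exact: Gm0.
    - by rewrite -[A1]scale1r Gm_linear !scale1r.
    - by rewrite -[_ *: tnth e' i]addr0 Gm_linear Gm0 addr0.
  by rewrite summxE; apply: eq_bigr => i _; rewrite mxE.
under [RHS]eq_bigr => v _ do rewrite GmE mulr_sumr scaler_suml.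
rewrite [RHS]exchange_big; apply: eq_bigr => i _ /=.
rewrite -/(Gm _) -/(T _) -{1}(pB (tnth e i)) /proj T_sum scaler_sumr.
by apply: eq_bigr => v _; rewrite TZ scalerA; congr (_ *: _); ring.
Qed.

(** By [dirac_opE], 2 D is the sum of the Gm v T v. As the T v commute, twice its square is the sum
    of (Gm v Gm w + Gm w Gm v) T v T w = b(v,w) T v T w, that is 2 times the sum of the T v^2. *)
Lemma dirac_square x : @dirac_op _ _ s beta d e e' m S V x = 0 -> forall a,
  \sum_(v <- B) T v (T v (x a)) = 0.
Proof.
move=> Dx a; pose A a j : V := \sum_(v <- B) \sum_(w <- B)
  ((Gm v *m Gm w) a j) *: T v (T w (x j)).
have D0 : \sum_j A a j = 0.
  have E : \sum_(v <- B) \sum_k Gm v a k *: T v (2 *: @dirac_op _ _ s beta d e e' m S V x k) = 0.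
    rewrite Dx big1 // => v _; rewrite big1 // => k _.
    by rewrite ffunE scaler0 linear0 scaler0.
  rewrite -[RHS]E /A exchange_big; apply: eq_bigr => v _ /=.
  have Ek k : Gm v a k *: T v (2 *: @dirac_op _ _ s beta d e e' m S V x k) =
      \sum_(w <- B) \sum_j (Gm v a k * Gm w k j) *: T v (T w (x j)).
    rewrite dirac_opE scaler_sumr linear_sum scaler_sumr; apply: eq_bigr => w _.
    rewrite scaler_sumr linear_sum scaler_sumr; apply: eq_bigr => j _.
    rewrite scalerA linearZ scalerA /=; congr (_ *: _).
    by rewrite [2 * _]mulrA mulfV ?pnatr_eq0 // mul1r.
  under [RHS]eq_bigr => k _ do rewrite Ek exchange_big.
  rewrite [RHS]exchange_big; apply: eq_bigr => j _ /=.
  rewrite [RHS]exchange_big; apply: eq_bigr => w _ /=.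
  by rewrite mxE scaler_suml.
have AA j : A a j + A a j = \sum_(v <- B) \sum_(w <- B) (b v w)%:M a j *: T v (T w (x j)).
  have A2 : A a j = \sum_(v <- B) \sum_(w <- B) ((Gm w *m Gm v) a j) *: T v (T w (x j)).
    rewrite /A exchange_big; apply: eq_bigr => v _; apply: eq_bigr => w _ /=.
    by rewrite T_comm.
  rewrite {2}A2 /A -big_split; apply: eq_bigr => v _ /=.
  rewrite -big_split; apply: eq_bigr => w _ /=.
  by rewrite -scalerDl -Gm_anticomm [in RHS]mxE.
have AAa j : A a j + A a j = (j == a)%:R *: (2 *: \sum_(v <- B) T v (T v (x a))).
  rewrite AA !scaler_sumr; apply: eq_big_seq => v vB.
  case: oB => uB oB'; rewrite (bigD1_seq v) //= big1_seq ?addr0.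
    rewrite oB' // eqxx mxE eq_sym; have [->|_] := eqVneq j a.
      by rewrite mulr1n scale1r.
    by rewrite mulr0n !scale0r.
  by move=> w /andP[wv wB]; rewrite oB' // eq_sym (negbTE wv) mxE mul0rn scale0r.
have : \sum_j (A a j + A a j) = 0 by rewrite big_split /= D0 addr0.
under eq_bigr => j _ do rewrite AAa.
rewrite (bigD1 a) //= [X in _ + X]big1 ?addr0 => [|j ja]; last by rewrite (negbTE ja) scale0r.
rewrite eqxx scale1r => /eqP; rewrite scaler_eq0 pnatr_eq0 /= => /eqP.
exact.
Qed.

Lemma unitary_T_kernel v : gK_unitary V -> \sum_(u <- B) T u (T u v) = 0 -> forall X, T X v = 0.
Proof.
case=> h [hl hs hp hK hg] E X.
have h0 w : h 0 w = 0.
  by have := hl (-1) 0 0 w; rewrite scaler0 addr0 mulN1r addNr.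
have hD u1 u2 w : h (u1 + u2) w = h u1 w + h u2 w by rewrite -[u1]scale1r hl mul1r scale1r.
have hge w : 0 <= h w w.
  by have [->|w0] := eqVneq w 0; [rewrite h0 | exact/ltW/hp].
have sr0 : sigma_real s 0.
  by move=> t; rewrite scaler0 expm0 sigma1.
have neg u : u \in B -> h (T u (T u v)) v = - h (T u v) (T u v).
  move=> uB; apply: hg; split; last exact: rB.
  have E0 : vsval (0 : subvs_of (ck s)) = 0 by exact: linear0.
  by change (sigma_real s (vsval (0 : subvs_of (ck s)))); rewrite E0.
have sum0 : \sum_(u <- B) h (T u v) (T u v) = 0.
  have hS : h (\sum_(u <- B) T u (T u v)) v = \sum_(u <- B) h (T u (T u v)) v.
    by elim/big_ind2: _ => // x1 y1 x2 y2 <- <-; rewrite hD.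
  move: hS; rewrite E h0 (eq_big_seq _ neg) sumrN => /esym/eqP.
  by rewrite oppr_eq0 => /eqP.
have Tu u : u \in B -> T u v = 0.
  move=> uB; apply/eqP; apply: contraT => Tn0; have := hp _ Tn0.
  move/eqP: sum0; rewrite psumr_eq0; last by move=> u' _.
  by move=> /allP/(_ u uB) /eqP ->; rewrite ltxx.
rewrite -(pB X) /proj T_sum big1_seq // => u /andP[_ uB].
by rewrite TZ Tu // scaler0.
Qed.

Lemma cp_Ad k (X : M) : cK s k -> X \in cp s -> k * X * k^-1 \in cp s.
Proof.
move=> [Gk tk] /cpP[lX tX]; have [G1 GM GV Gu] := cG_subgroup s.
have [tG tM tK] := ctheta_involution s.
have Kk : cK s k by [].
have [_ _ KV _] := cK_subgroup s; have [_ tkV] := KV _ Kk.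
have cE t (Y : M) : expm ((t%:C)%C *: (k * Y * k^-1)) = k * expm ((t%:C)%C *: Y) * k^-1.
  by rewrite (expm_conj _ (Gu _ Gk)) scalerAl scalerAr.
apply/cpP; split.
  by move=> t; rewrite cE; apply: (GM _ _ (GM _ _ Gk (lX t)) (GV _ Gk)).
move=> t; have -> : - (k * X * k^-1) = k * (- X) * k^-1 by rewrite mulrN mulNr.
rewrite cE [RHS]cE.
rewrite (tM _ _ (GM _ _ Gk (lX t)) (GV _ Gk)) (tM _ _ Gk (lX t)).
by rewrite tk tkV tX.
Qed.

Lemma vsval_Ad k X : cK s k -> vsval (Ad k X) = k * vsval X * k^-1.
Proof. by move=> Kk; rewrite /Ad vsprojK // cp_Ad // subvsP. Qed.

Lemma Ad_inv k X : cK s k -> Ad k (Ad k^-1 X) = X.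
Proof.
move=> Kk; have [_ _ KV Ku] := cK_subgroup s; have ku := Ku _ Kk.
rewrite {1}/Ad vsval_Ad; last exact: KV.
by rewrite invrK !mulrA (mulrV ku) mul1r (mulrK ku) vsvalK.
Qed.

Lemma p0_acts_trivially : dirac_series e e' S V -> forall X v, T X v = 0.
Proof.
move=> [[_ irr] uV [q q0]].
have [x [x0 Dx]] : exists x, x != 0 /\ @dirac_op _ _ s beta d e e' m S V x = 0.
  have := valP (repr q); rewrite inE => /eqP Dx.
  exists (val (repr q)); split=> //; apply: contra_neq q0 => x0.
  rewrite -[q]reprK; have -> : repr q = 0 by exact: val_inj.
  exact: lq_pi0.
have [a xa] : exists a, x a != 0.
  apply: contrapT => nx; move/negP: x0; apply; apply/eqP/ffunP => a.
  by rewrite ffunE; apply: contrapT => xa; apply: nx; exists a; apply/eqP.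
have Txa := unitary_T_kernel uV (dirac_square Dx a).
(* A submodule, because p_0 is a K-stable ideal of g_0. *)
pose W : set V := [set v | forall X, T X v = 0].
have [W0|WT] : W = [set 0] \/ W = setT.
- apply: irr.
  + by move=> X; exact: linear0.
  + by move=> c u v Wu Wv X; rewrite linearP Wu Wv scaler0 addr0.
  + move=> k v Kk Wv X; have [_ _ KV _] := cK_subgroup s.
    have := actK_actg (0, Ad k^-1 X) v Kk.
    have -> : Ad0 k (0, Ad k^-1 X) = (0, X) :> g0 s.
      by rewrite /Ad0 /= Ad_inv // /Ad /= mulr0 mul0r linear0.
    by rewrite /T => <-; rewrite [actg V _ v]Wv linear0.
  move=> Z v Wv X; have := actg_bracket (0, X) Z v.
  have [Y ->] : exists Y, bracket0 (0, X) Z = (0, Y) :> g0 s.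
    rewrite /bracket0 /= lieb0l linear0; by eexists.
  rewrite [actg V (0, _) v]Wv [actg V (0, _) v]Wv linear0 subr0.
  by move=> <-.
- by have : W (x a) by []; rewrite W0 /= => xa0; rewrite xa0 eqxx in xa.
by move=> X v; have : W v by rewrite WT.
Qed.

End Trivial.

(** * Lifts to the spin group near 1 *)

Lemma clifford_scalerAl (F : fieldType) (V : lmodType F) (b : V -> V -> F) a (x y : clifford b) :
  (a *: x) * y = a *: (x * y).
Proof. by rewrite -[LHS]/(tmul (tmul _ x) y) -tmulA. Qed.

Lemma tends_big_seq {R : realType} {T : Type} {F : set_system T} {FF : Filter F} {p q : nat}
    (I : eqType) (r : seq I) (f : I -> T -> 'M[R[i]]_(p, q)) (A : I -> 'M[R[i]]_(p, q)) :
  (forall i, i \in r -> tends F (f i) (A i)) ->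
  tends F (fun t => \sum_(i <- r) f i t) (\sum_(i <- r) A i).
Proof.
elim: r => [|i r IH] h.
  by rewrite big_nil; apply: (tends_near _ (tends_cst _)); apply: nearW => t; rewrite big_nil.
rewrite big_cons; apply: (tends_near _ (tendsD (h i _) (IH _))).
- by apply: nearW => t; rewrite big_cons.
- exact: mem_head.
- by move=> j jr; apply: h; rewrite inE jr orbT.
Qed.

Section SpinLift.
Context {R : realType} {n : nat} (s : cartan_datum R n).
Local Notation M := 'M[R[i]]_n.+1.
Context (beta : M -> M -> R[i]) (Hb : invariant_form s beta).
Local Notation b := (beta0 (s := s) beta).
Local Notation p0 := (p0 s).
Local Notation gam := (gamma0 (s := s) beta).
Context (m : nat) (S : clifford_module b m).
Implicit Types (X Y Z u v w : p0).

Definition reflection w X : p0 := X - b X w *: w.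

Lemma reflection_linear w a X Y :
  reflection w (a *: X + Y) = a *: reflection w X + reflection w Y.
Proof.
rewrite /reflection (b_linear Hb) scalerDl scalerBr scalerA opprD.
by rewrite addrACA.
Qed.

Lemma reflection_isometry w X Y : b w w = 2 -> b (reflection w X) (reflection w Y) = b X Y.
Proof.
move=> w2; rewrite /reflection !(bD Hb, bN Hb, bZ Hb, bDr Hb, bNr Hb, bZr Hb) w2 !(b_sym Hb w).
by ring.
Qed.

Lemma reflectionK w X : b w w = 2 -> reflection w (reflection w X) = X.
Proof.
move=> w2; rewrite /reflection (bD Hb) (bN Hb) (bZ Hb) w2 -addrA -opprD -scalerDl.
have -> : b X w + (b X w - b X w * 2) = 0 by ring.
by rewrite scale0r subr0.
Qed.

Lemma gamma_unit w : b w w = 2 -> gam w * gam w = 1.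
Proof.
move=> w2; have := cliff_gammaP b w w; rewrite w2 -mulr2n -scaler_nat.
by move=> /(scalerI (_ : (2 : R[i]) != 0)); apply; rewrite pnatr_eq0.
Qed.

Lemma gammaB X Y : gam (X - Y) = gam X - gam Y.
Proof. by rewrite /gamma0 raddfB. Qed.
Lemma gammaZ a X : gam (a *: X) = a *: gam X.
Proof. by rewrite /gamma0 linearZ. Qed.

(** Conjugation by gam w is minus the reflection; the signs cancel in even products. *)
Lemma gamma_reflection w X : b w w = 2 -> gam w * gam X = - (gam (reflection w X) * gam w).
Proof.
move=> w2; rewrite /reflection gammaB gammaZ mulrBl clifford_scalerAl.
rewrite gamma_unit // -(cliff_gammaP b X w) opprB addrC addKr //.
Qed.

Definition isometry g : Prop :=
  (forall a X Y, g (a *: X + Y) = a *: g X + g Y) /\ (forall X Y, b (g X) (g Y) = b X Y).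

Context (B : seq p0) (oB : orthogonal_seq beta B) (pB : forall X, proj beta B X = X).

Lemma Sgam_linear a X Y : S (gam (a *: X + Y)) = a *: S (gam X) + S (gam Y).
Proof. by rewrite /gamma0 linearP rmorphD cliff_actZ. Qed.

Lemma Sgam_expand X : S (gam X) = \sum_(w <- B) (b X w / 2) *: S (gam w).
Proof.
rewrite -{1}(pB X) /proj; elim: B => [|w r IH]; rewrite ?(big_nil, big_cons).
  by rewrite /gamma0 !raddf0.
by rewrite Sgam_linear IH.
Qed.

Context (T : Type) (F : set_system T) {FF : Filter F}.

(* V1 is the part of the orthogonal basis that g is known to fix.  Two reflections, in directions that
   tend to each other, move g v back to v; c t corrects the scalar by which S (a t) may differ from a
   matrix close to 1. *)
Lemma spin_lift V2 : forall V1 (g : T -> p0 -> p0), V1 ++ V2 = B ->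
  (\forall t \near F, isometry (g t) /\ (forall v, v \in V1 -> g t v = v)) ->
  (forall v w, v \in B -> w \in B -> ctends F (fun t => b v (g t w)) (b v w)) ->
  exists (a : T -> clifford b) (c : T -> R[i]),
    (\forall t \near F, spin_group (a t) /\ forall X, a t * gam X = gam (g t X) * a t) /\
    tends F (fun t => c t *: S (a t)) 1%:M.
Proof.
elim: V2 => [|v V2 IH] V1 g.
  rewrite cats0 => ->; move=> gP gB; exists (fun=> 1), (fun=> 1); split; last first.
    apply: (tends_near _ (tends_cst _)); apply: nearW => t.
    by rewrite scale1r; apply: esym; exact: (rmorph1 S).
  apply: filterS gP => t [[gl gb] gV]; split; first by exists [::]; split=> //; rewrite big_nil.
  move=> X; rewrite mul1r mulr1; congr (gam _).
  have g0 : g t 0 = 0 by have := gl (-1) 0 0; rewrite scaler0 addr0 scaleN1r addNr.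
  rewrite -(pB X) /proj; elim: B gV => [|w r IH] gV; rewrite ?(big_nil, big_cons) //.
  rewrite gl gV ?mem_head // -IH // => u ur; rewrite gV // inE ur orbT //.
move=> VB gP gB.
have vB : v \in B by rewrite -VB mem_cat mem_head orbT.
case: oB => uB bB.
have v2 : b v v = 2 by rewrite bB // eqxx.
(* The reflection in g v + v sends g v to -v, and the one in v sends -v to v. The difference g v - v
   would give a single reflection, but it tends to 0 and could not be normalized. *)
pose u t := g t v + v.
pose k t : R[i] := sqrtC (2 / b (u t) (u t)).
have bvv : ctends F (fun t => b v (g t v)) 2 by rewrite -v2; exact: gB.
(* u tends to 2 v, and b v v = 2. *)
have buu : ctends F (fun t => b (u t) (u t)) 8.
  have E : (8 : R[i]) = (2 + 2) + (2 + 2) by ring.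
  rewrite E; apply: (ctends_near _ (ctendsD (ctendsD (ctends_cst _) (ctends_cst _)) (ctendsD bvv bvv))).
  apply: filterS gP => t [[gl gb] _].
  rewrite /u (bD Hb) !(bDr Hb) gb v2 (b_sym Hb (g t v)); ring.
have u0 : \forall t \near F, b (u t) (u t) != 0.
  by apply: ctends_neq0 buu; rewrite pnatr_eq0.
have kk t : k t * k t = 2 / b (u t) (u t) by rewrite -expr2 sqrtCK.
have hu : \forall t \near F, b (k t *: u t) (k t *: u t) = 2.
  by apply: filterS u0 => t ut0; rewrite (bZ Hb) (bZr Hb) mulrA kk divfK.
have kkt : ctends F (fun t => k t * k t) (2 / 8).
  apply: (ctends_near _ (ctendsM (ctends_cst _) (ctendsV _ buu))).
    by apply: nearW => t; rewrite kk.
  by rewrite pnatr_eq0.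
have but w : w \in B -> ctends F (fun t => b w (u t)) (b w v + b w v).
  move=> wB; apply: (ctends_near _ (ctendsD (gB _ _ wB vB) (ctends_cst (b w v)))).
  by apply: nearW => t; rewrite /u (bDr Hb).
pose g' t X := reflection v (reflection (k t *: u t) (g t X)).
have gg' t X : b (k t *: u t) (k t *: u t) = 2 ->
  g t X = reflection (k t *: u t) (reflection v (g' t X)).
  by move=> h; rewrite /g' !reflectionK.
have [] := IH (rcons V1 v) g'.
- by rewrite cat_rcons.
- apply: filterS3 gP u0 hu => t [[gl gb] gV] ut0 hut; split.
    split=> [a X Y|X Y]; first by rewrite /g' gl !reflection_linear.
    by rewrite /g' !reflection_isometry.
  move=> w; rewrite mem_rcons inE => /orP[/eqP -> |wV].
    have -> : g' t v = reflection v (- v).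
      rewrite /g'; congr reflection; rewrite /reflection (bZr Hb) scalerA mulrAC kk.
      have -> : b (g t v) (u t) = b (u t) (u t) / 2.
        by rewrite /u (bD Hb) !(bDr Hb) gb v2 (b_sym Hb v (g t v)); field.
      have -> : 2 / b (u t) (u t) * (b (u t) (u t) / 2) = 1.
        by field; exact: ut0.
      by rewrite scale1r /u opprD addrA subrr add0r.
    rewrite /reflection (bN Hb) v2 scaleNr opprK scaler_nat mulr2n addrA addNr add0r //.
  (* The vectors of [V1] are orthogonal to v and, being fixed by the isometry g, to g v; both
     reflections fix them. *)
  have wB : w \in B by rewrite -VB mem_cat wV.
  have wv : b w v = 0.
    rewrite bB //; case: eqVneq => // wE; move: uB; rewrite -VB cat_uniq => /and3P[_ /hasPn/(_ v)].
    by rewrite mem_head -wE wV => /(_ isT).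
  have gw : b w (g t v) = 0 by rewrite -(gV _ wV) gb.
  rewrite /g' (gV _ wV) {2}/reflection (bZr Hb) /u (bDr Hb) gw wv addr0 mulr0 scale0r subr0.
  by rewrite /reflection wv scale0r subr0.
- move=> x w xB wB.
  have L1 : ctends F (fun t => b (g t w) (u t)) (b w v + b w v).
    rewrite {2}(b_sym Hb w v); apply: (ctends_near _ (ctendsD (ctends_cst (b w v)) (gB _ _ vB wB))).
    by apply: filterS gP => t [[gl gb] _]; rewrite /u (bDr Hb) gb (b_sym Hb (g t w) v).
  have L2 y : y \in B -> ctends F (fun t => b y (reflection (k t *: u t) (g t w)))
      (b y w - 2 / 8 * (b w v + b w v) * (b y v + b y v)).
    move=> yB; apply: (ctends_near _ (ctendsB (gB _ _ yB wB) (ctendsM (ctendsM kkt L1) (but _ yB)))).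
    apply: nearW => t; rewrite /reflection (bDr Hb) (bNr Hb) (bZr Hb) (bZr Hb) (bZr Hb (k t)); ring.
  have := ctendsB (L2 _ xB) (ctendsM (L2 _ vB) (ctends_cst (b x v))).
  have -> : b x w - 2 / 8 * (b w v + b w v) * (b x v + b x v) -
     (b v w - 2 / 8 * (b w v + b w v) * (b v v + b v v)) * b x v = b x w.
    by rewrite v2 (b_sym Hb v w); field.
  move=> /(_ FF FF FF) L3; apply: (ctends_near _ L3); apply: nearW => t.
  by rewrite /g' [reflection v _]/reflection (bDr Hb) (bNr Hb) (bZr Hb) (b_sym Hb v).
move=> a' [c' [aP cP]].
(* gam (k u) gam v is close to k gam (2 v) gam v = 2 k. Dividing by 2 k cancels the square root k
   exactly, so its choice of branch need not be continuous. *)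
exists (fun t => gam (k t *: u t) * gam v * a' t), (fun t => c' t / (2 * k t)); split.
  apply: filterS2 hu aP => t h2 [[vs [vs0 vs1 ->]] ag]; split.
    exists (k t *: u t :: v :: vs); split.
    - by rewrite /= negbK.
    - by move=> w; rewrite !inE => /or3P[/eqP ->|/eqP ->|/vs1] //; exact: gamma_unit.
    - by rewrite !big_cons mulrA.
  move=> X; rewrite -!mulrA; set a := a' t in ag *.
  rewrite ag (mulrA (gam v)) (gamma_reflection _ v2) mulNr mulrN -!mulrA.
  rewrite (mulrA _ (gam (reflection _ _))) (gamma_reflection (reflection _ _) h2) mulNr opprK -!mulrA.
  by rewrite -gg'.
have Gu : tends F (fun t => S (gam (u t))) (2 *: S (gam v)).
  have -> : 2 *: S (gam v) = \sum_(w <- B) (2 * (b v w / 2)) *: S (gam w).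
    by rewrite {1}Sgam_expand scaler_sumr; apply: eq_bigr => w _; rewrite scalerA.
  apply: (@tends_near _ _ _ _ _ _ (fun t => \sum_(w <- B) (b (u t) w / 2) *: S (gam w))).
    by apply: nearW => t; rewrite [in RHS]Sgam_expand.
  apply: tends_big_seq => w wB; apply: tendsZ; last exact: tends_cst.
  have -> : 2 * (b v w / 2) = (b w v + b w v) / 2 by rewrite (b_sym Hb v w); field.
  apply: ctendsM (ctends_cst _); apply: (ctends_near _ (but _ wB)).
  by apply: nearW => t; rewrite (b_sym Hb).
have := tends_mulmx (tendsZ (ctends_cst (2^-1)) (tends_mulmx Gu (tends_cst (S (gam v))))) cP.
have -> : 2^-1 *: ((2 *: S (gam v)) *m S (gam v)) *m 1%:M = 1%:M.
  rewrite mulmx1 -scalemxAl scalerA mulVf ?pnatr_eq0 // scale1r.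
  have E : S 1 = S (gam v) * S (gam v) by rewrite -rmorphM gamma_unit.
  exact: etrans (esym E) (rmorph1 S).
move=> /(_ FF FF FF FF FF) L3; apply: (tends_near _ L3); apply: filterS u0 => t ut0.
have k0 : k t != 0.
  by rewrite /k sqrtC_eq0 mulf_neq0 ?invr_eq0 ?pnatr_eq0.
have E : S (gam (k t *: u t) * gam v * a' t) =
    k t *: (S (gam (u t)) *m S (gam v) *m S (a' t)).
  rewrite !rmorphM gammaZ cliff_actZ.
  by rewrite -[LHS]/((k t *: S (gam (u t))) *m S (gam v) *m S (a' t)) -!scalemxAl.
rewrite E -scalemxAl -scalemxAr !scalerA; congr (_ *: _).
by move: (k t) (c' t) k0 => kt ct kt0; field; exact: kt0.
Qed.

End SpinLift.

Section SpinLiftAd.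
Context {R : realType} {n : nat} (s : cartan_datum R n).
Local Notation M := 'M[R[i]]_n.+1.
Context (beta : M -> M -> R[i]) (Hb : invariant_form s beta).
Local Notation b := (beta0 (s := s) beta).
Local Notation p0 := (p0 s).
Context (m : nat) (S : clifford_module b m) (m0 : (0 < m)%N).
Context (B : seq p0) (oB : orthogonal_seq beta B) (pB : forall X, proj beta B X = X).

Lemma Ad_isometry k : cK s k -> isometry beta (Ad (L := cp s) k).
Proof.
move=> Kk; split=> [a X Y|X Y].
  rewrite /Ad -linearP; congr vsproj.
  by rewrite [vsval _]linearP mulrDr mulrDl -scalerAr -scalerAl.
by rewrite /beta0 !vsval_Ad // (beta_K Hb Kk) ?p0_cg.
Qed.

Lemma Ktilde_near_1 : exists2 d : R, 0 < d & forall k, cK s k -> nrm (k - 1) < d ->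
  exists2 a, Ktilde (s := s) (beta := beta) (k, a) & \tr (S a) != 0.
Proof.
pose F : set_system M := within (cK s) (nbhs (1 : M)).
have FF : Filter F by exact: within_filter.
have idF : tends F id (1 : M).
  apply: (tends_sub _ (tends_id (1 : M))) => P P1.
  by apply: (filterS _ P1) => k Pk _.
have KF : \forall k \near F, cK s k by apply/nbhs_nrmP; exists 1.
have [||a [c [aP ca]]] := @spin_lift _ _ s beta Hb m S B oB pB M F FF B [::] (fun k => Ad k) (cat0s _).
- by apply: filterS KF => k Kk; split=> //; exact: Ad_isometry.
- move=> v w vB wB.
  (* b v (Ad k w) is a linear function of k w k^-1; values in 1 x 1 matrices let [tends_linear]
     apply. *)
  pose L (Y : M) : 'M[R[i]]_1 := (b v (vsproj (cp s) Y))%:M.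
  have Llin : linear L by move=> a X Y; rewrite /L linearP (bDr Hb) (bZr Hb) raddfD scale_scalar_mx.
  pose L' : {linear M -> 'M[R[i]]_1} := HB.pack L (GRing.isLinear.Build _ _ _ _ L Llin).
  have u1 : (1 : M) \in unitmx by exact: unitmx1.
  have := tends_linear L' (tends_mulmx (tends_mulmx idF (tends_cst (vsval w))) (tends_invmx u1 idF)).
  move=> /(_ FF FF FF FF FF)/tendsP/(_ 0 0).
  have -> : L' ((1 : M) *m vsval w *m invmx 1) 0 0 = b v w.
    by rewrite /= mul1mx invmx1 mulmx1 mxE vsvalK.
  apply: ctends_near; apply: nearW => k.
  by rewrite /L' /= mxE.
have : ctends F (fun k => \tr (c k *: S (a k))) (\tr (1%:M : 'M[R[i]]_m)) by exact: ctends_tr.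
rewrite mxtrace1 => /ctends_neq0 tn.
have : \forall k \near F, \tr (c k *: S (a k)) != 0 by apply: tn; rewrite pnatr_eq0 -lt0n.
move=> {}tn.
have : \forall k \near F, cK s k -> exists2 a, Ktilde (s := s) (beta := beta) (k, a) & \tr (S a) != 0.
  apply: filterS2 aP tn => k [sa aX] tr0 Kk; exists (a k); first by split.
  by apply: contra_neq tr0; rewrite linearZ /= => ->; rewrite mulr0.
move=> /nbhs_nrmP[d d0 dP]; exists d => // k Kk /dP; exact.
Qed.

End SpinLiftAd.

(** * Irreducible representations and characters *)

Lemma col_neq0 (F : fieldType) p q (A : 'M[F]_(p, q)) : A != 0 -> exists j, col j A != 0.
Proof.
apply: contra_neqP => nx; apply/matrixP => i j; rewrite mxE.
have : col j A = 0 by apply: contrapT => Aj; apply: nx; exists j; apply/eqP.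
by move=> /colP/(_ i); rewrite !mxE.
Qed.

Section Representations.
Context {C : numClosedFieldType} {T : Type} (P : T -> Prop) (op : T -> T -> T) (e : T).
Context (Pe : P e) (Pop : forall k l, P k -> P l -> P (op k l)).

Inductive lin_span {U : lmodType C} (f : T -> U) : U -> Prop :=
| LinSpan0 : lin_span f 0
| LinSpanD a k x : P k -> lin_span f x -> lin_span f (a *: f k + x).

Definition lin_closed {U : lmodType C} (W : U -> Prop) : Prop :=
  forall a u v, W u -> W v -> W (a *: u + v).

Lemma lin_span_closed (U : lmodType C) (f : T -> U) : lin_closed (lin_span f).
Proof.
move=> a x y; elim=> [|c k x' Pk _ IH] hy; first by rewrite scaler0 add0r.
by rewrite scalerDr scalerA -addrA; apply: LinSpanD => //; exact: IH.
Qed.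

Lemma lin_span_gen (U : lmodType C) (f : T -> U) k : P k -> lin_span f (f k).
Proof.
move=> Pk; rewrite -[f k]addr0 -[f k]scale1r; apply: LinSpanD => //; exact: LinSpan0.
Qed.

Lemma lin_span_sub (U : lmodType C) (f : T -> U) (W : U -> Prop) : W 0 -> lin_closed W ->
  (forall k, P k -> W (f k)) -> forall x, lin_span f x -> W x.
Proof. by move=> W0 Wl Wf x; elim=> // a k y Pk _ Wy; apply: Wl => //; exact: Wf. Qed.

Definition representation r (rho : T -> 'M[C]_r) : Prop :=
  rho e = 1%:M /\ forall k l, P k -> P l -> rho (op k l) = rho k *m rho l.

Definition irreducible r (rho : T -> 'M[C]_r) : Prop :=
  forall W : 'cV[C]_r -> Prop, lin_closed W ->
    (forall k u, P k -> W u -> W (rho k *m u)) ->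
    (exists2 u, W u & u != 0) -> forall u, W u.

Section OneRepresentation.
Context {r : nat} (rho : T -> 'M[C]_r) (rhoR : representation rho) (rhoI : irreducible rho).

Lemma lin_span_orbit (v z : 'cV[C]_r) : v != 0 -> exists2 y, lin_span rho y & z = y *m v.
Proof.
move=> v0; apply: (rhoI (W := fun z => exists2 y, lin_span rho y & z = y *m v)).
- move=> a _ _ [y hy ->] [y' hy' ->]; exists (a *: y + y'); first exact: lin_span_closed.
  by rewrite mulmxDl scalemxAl.
- move=> k _ Pk [y hy ->]; exists (rho k *m y); last by rewrite mulmxA.
  apply: (lin_span_sub (W := fun y => lin_span rho (rho k *m y)) _ _ _ hy).
  + by rewrite mulmx0; exact: LinSpan0.
  + by move=> a x x' hx hx'; rewrite mulmxDr -scalemxAr; exact: lin_span_closed.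
  + by move=> l Pl; rewrite -rhoR.2 //; apply: lin_span_gen; exact: Pop.
exists v => //; exists (rho e); first exact: lin_span_gen.
by rewrite rhoR.1 mul1mx.
Qed.

Context (J : 'M[C]_r -> Prop) (Jl : lin_closed J) (JS : forall x, J x -> lin_span rho x).
Context (JL : forall k x, P k -> J x -> J (rho k *m x)).
Context (JR : forall k x, P k -> J x -> J (x *m rho k)).

Lemma ideal0 (x : 'M[C]_r) : J x -> J 0.
Proof. by move=> Jx; rewrite -(addNr x) -scaleN1r; exact: Jl. Qed.

Lemma ideal_span (y x : 'M[C]_r) : lin_span rho y -> J x -> J (y *m x).
Proof.
move=> hy Jx; apply: (lin_span_sub (W := fun y => J (y *m x)) _ _ _ hy).
- by rewrite mul0mx; exact: ideal0 Jx.
- by move=> a u v Ju Jv; rewrite mulmxDl -scalemxAl; exact: Jl.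
- by move=> k Pk; exact: JL.
Qed.

Lemma ideal_spanr (y x : 'M[C]_r) : lin_span rho y -> J x -> J (x *m y).
Proof.
move=> hy Jx; apply: (lin_span_sub (W := fun y => J (x *m y)) _ _ _ hy).
- by rewrite mulmx0; exact: ideal0 Jx.
- by move=> a u v Ju Jv; rewrite mulmxDr -scalemxAr; exact: Jl.
- by move=> k Pk; exact: JR.
Qed.

(** Descent on the rank: if x y x is not a multiple of x, subtract l x with l an eigenvalue of the
    operator that y induces between the row and column bases of x. The result is nonzero, lies in J
    and has smaller rank. *)
Lemma ideal_scalar (x : 'M[C]_r) : J x -> x != 0 ->
  exists x1, [/\ J x1, x1 != 0 & forall y, lin_span rho y -> exists l, x1 *m y *m x1 = l *: x1].
Proof.
have [p] := ubnP (\rank x); elim: p x => // p IH x; rewrite ltnS => rp Jx x0.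
have [h|/existsNP[y /not_implyP[hy nl]]] :=
  pselect (forall y, lin_span rho y -> exists l, x *m y *m x = l *: x); first by exists x.
have rx : (0 < \rank x)%N by rewrite lt0n mxrank_eq0.
have [l lE] := eigenvalue_closed (row_base x *m y *m col_base x) rx.
have xE : x *m y *m x - l *: x =
    col_base x *m (row_base x *m y *m col_base x - l%:M) *m row_base x.
  have key q (L : 'M[C]_(r, q)) (R : 'M[C]_(q, r)) :
      L *m (R *m y *m L - l%:M) *m R = (L *m R) *m y *m (L *m R) - l *: (L *m R).
    by rewrite mulmxBr mulmxBl mul_mx_scalar -scalemxAl !mulmxA.
  by rewrite key mulmx_base.
apply: (IH (x *m y *m x - l *: x)).
- apply: leq_trans rp; rewrite xE; apply: leq_ltn_trans (mxrankM_maxl _ _) _.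
  apply: leq_ltn_trans (mxrankM_maxr _ _) _.
  rewrite ltn_neqAle rank_leq_row andbT -/(row_free _).
  by move: lE; rewrite /eigenvalue /eigenspace kermx_eq0.
- have -> : x *m y *m x - l *: x = (- l) *: x + x *m y *m x by rewrite scaleNr addrC.
  apply: Jl => //; apply: (ideal_span _ (Jx)); apply: JS; exact: (ideal_spanr hy Jx).
- by rewrite subr_eq0; apply/eqP => E; apply: nl; exists l.
Qed.

Lemma ideal_rank_one (x : 'M[C]_r) : J x -> x != 0 ->
  exists (v : 'cV[C]_r) (phi : 'rV[C]_r), J (v *m phi) /\ \tr (v *m phi) != 0.
Proof.
move=> + x00 => /ideal_scalar/(_ x00)[{x00}x [Jx x0 hx]].
have [j xj] := col_neq0 x0.
pose v := col j x.
(* [x z] is a multiple of [v] for every [z], as [z = y v] with [y] in the span. *)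
have xz z : exists l, x *m z = l *: v.
  have [y hy ->] := lin_span_orbit z xj.
  have [l lE] := hx y hy; exists l.
  by rewrite /v !colE !mulmxA lE scalemxAl.
have [c cE] := choice (fun i : 'I_r => xz (delta_mx i 0)).
pose phi : 'rV[C]_r := \row_i c i.
have xE : x = v *m phi.
  apply/matrixP => i k; rewrite mxE big_ord1 [phi _ _]mxE.
  have := cE k; rewrite -colE => /colP/(_ i); rewrite [LHS]mxE => ->.
  by rewrite mxE mulrC.
have phi0 : phi != 0 by apply: contra_neq x0; rewrite xE => ->; rewrite mulmx0.
(* Otherwise phi kills the orbit of v, which spans the whole space. *)
have [k Pk tk] : exists2 k, P k & \tr (rho k *m v *m phi) != 0.
  apply: contrapT => nk.
  have z0 (z : 'cV[C]_r) : phi *m z = 0.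
    have [y hy ->] := lin_span_orbit z xj.
    apply: (lin_span_sub (W := fun y => phi *m (y *m v) = 0) _ _ _ hy).
    - by rewrite mul0mx mulmx0.
    - by move=> a u w u0 w0; rewrite mulmxDl mulmxDr -scalemxAl -scalemxAr u0 w0 scaler0 addr0.
    - move=> k Pk; apply: contrapT => n0; apply: nk; exists k => //.
      rewrite mxtrace_mulC; apply: contra_notN n0 => /eqP t0.
      by rewrite [LHS]mx11_scalar -trace_mx11 t0 raddf0.
  move/eqP: phi0; apply; apply/rowP => i; have := z0 (delta_mx i 0).
  by rewrite -colE => /colP/(_ 0); rewrite !mxE.
by exists (rho k *m v), phi; split=> //; rewrite -mulmxA -xE; exact: JL.
Qed.

End OneRepresentation.

(** * Irreducible representations with equal characters *)

Section Characters.
Context {r r' : nat} (rho : T -> 'M[C]_r) (rho' : T -> 'M[C]_r').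
Context (rhoR : representation rho) (rhoI : irreducible rho) (r0 : (0 < r)%N).
Context (rhoR' : representation rho') (rhoI' : irreducible rho').
Context (eqtr : forall k, P k -> \tr (rho k) = \tr (rho' k)).

(** Span of the diagonal pairs. Equality of characters makes it the graph of a function from the
    span of rho to that of rho'. *)
Let A : 'M[C]_r * 'M[C]_r' -> Prop := lin_span (fun k => (rho k, rho' k)).

Lemma pair_closed : lin_closed A. Proof. exact: lin_span_closed. Qed.

Lemma pair_closed2 a x x' y y' : A (x, x') -> A (y, y') -> A (a *: x + y, a *: x' + y').
Proof. exact: pair_closed. Qed.

Lemma pair_tr x : A x -> \tr x.1 = \tr x.2.
Proof.
apply: (lin_span_sub (W := fun x => \tr x.1 = \tr x.2)) => //=.
- by rewrite !linear0.
- by move=> a u v hu hv; rewrite !linearP /= hu hv.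
Qed.

Lemma pair_fst x : A x -> lin_span rho x.1.
Proof.
apply: (lin_span_sub (W := fun x => lin_span rho x.1)) => /=; first exact: LinSpan0.
- by move=> a u v; exact: lin_span_closed.
- exact: lin_span_gen.
Qed.

Lemma pair_snd x : A x -> lin_span rho' x.2.
Proof.
apply: (lin_span_sub (W := fun x => lin_span rho' x.2)) => /=; first exact: LinSpan0.
- by move=> a u v; exact: lin_span_closed.
- exact: lin_span_gen.
Qed.

Lemma pairL k x : P k -> A x -> A (rho k *m x.1, rho' k *m x.2).
Proof.
move=> Pk hx; apply: (lin_span_sub (W := fun x => A (rho k *m x.1, rho' k *m x.2)) _ _ _ hx).
- by rewrite /= !mulmx0; exact: LinSpan0.
- move=> a u v hu hv; have := pair_closed a hu hv.
  by rewrite /= !mulmxDr -!scalemxAr.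
- by move=> l Pl /=; rewrite -rhoR.2 // -rhoR'.2 //; apply: (lin_span_gen _ (Pop Pk Pl)).
Qed.

Lemma pairR k x : P k -> A x -> A (x.1 *m rho k, x.2 *m rho' k).
Proof.
move=> Pk hx; apply: (lin_span_sub (W := fun x => A (x.1 *m rho k, x.2 *m rho' k)) _ _ _ hx).
- by rewrite /= !mul0mx; exact: LinSpan0.
- move=> a u v hu hv; have := pair_closed a hu hv.
  by rewrite /= !mulmxDl -!scalemxAl.
- by move=> l Pl /=; rewrite -rhoR.2 // -rhoR'.2 //; apply: (lin_span_gen _ (Pop Pl Pk)).
Qed.

(** Such x' form a two-sided ideal of the span of rho' on which the trace vanishes, so it cannot
    contain the rank-one matrix of nonzero trace that a nonzero ideal has. *)
Lemma pair_injective x' : A (0, x') -> x' = 0.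
Proof.
move=> Ax; apply/eqP; apply: contraT => x0.
have [||||v [phi [/pair_tr /= <-]]] := @ideal_rank_one _ rho' rhoR' rhoI' (fun x => A (0, x)) _ _ _ _ x' Ax x0.
- by move=> a u w hu hw; have := pair_closed2 a hu hw; rewrite scaler0 addr0.
- by move=> y; exact: pair_snd.
- by move=> k y Pk /(pairL Pk) /=; rewrite mulmx0.
- by move=> k y Pk /(pairR Pk) /=; rewrite mul0mx.
- by rewrite linear0 eqxx.
Qed.

(** Let v phi be a rank-one element of the span of rho and x' its partner in [A], nonzero since
    their traces agree. The matrices z phi form a copy of the representation rho, and z goes to the
    j-th column of the partner of z phi, where column j of x' is nonzero. *)
Lemma character_intertwiner : exists2 B : 'M[C]_(r', r), B != 0 &
  forall k, P k -> B *m rho k = rho' k *m B.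
Proof.
pose J x := exists x', A (x, x').
have [||||||v [phi [[x' Ax] tx]]] := @ideal_rank_one _ rho rhoR rhoI J _ _ _ _ 1%:M.
- by move=> a u w [u' hu] [w' hw]; exists (a *: u' + w'); exact: (pair_closed2 a hu hw).
- by move=> y [y' /pair_fst].
- by move=> k y Pk [y' /(pairL Pk) /= h]; exists (rho' k *m y').
- by move=> k y Pk [y' /(pairR Pk) /= h]; exists (y' *m rho' k).
- by exists (rho' e); rewrite -rhoR.1; exact: (lin_span_gen _ Pe).
- apply: contraTneq r0 => /matrixP h; rewrite -eqn0Ngt; apply/eqP.
  by case: (r) h => // n /(_ 0 0) /eqP; rewrite !mxE oner_eq0.
have v0 : v != 0 by apply: contra_neq tx => ->; rewrite mul0mx linear0.
have [j xj] : exists j, col j x' != 0.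
  by apply: col_neq0; apply: contra_neq tx => x'0; rewrite (pair_tr Ax) /= x'0 linear0.
have exz z : exists x', A (z *m phi, x').
  have [y hy ->] := lin_span_orbit rhoR rhoI z v0.
  have : J (y *m (v *m phi)).
    apply: (ideal_span (rho := rho) (J := J)) => //; last by exists x'.
    - by move=> a u w [u' hu] [w' hw]; exists (a *: u' + w'); exact: (pair_closed2 a hu hw).
    - by move=> k w Pk [y' /(pairL Pk) /= h]; exists (rho' k *m y').
  by rewrite mulmxA.
have [g gA] := choice exz.
have guniq z y : A (z *m phi, y) -> g z = y.
  move=> hy; apply/eqP; rewrite -subr_eq0 -scaleN1r addrC; apply/eqP/pair_injective.
  by have := pair_closed2 (-1) hy (gA z); rewrite !scaleN1r addNr.
have glin : linear g.
  by move=> a u w; apply: guniq; rewrite mulmxDl -scalemxAl; exact: (pair_closed2 a (gA u) (gA w)).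
pose B : 'M[C]_(r', r) := \matrix_(i, l) g (delta_mx l 0) i j.
have BE z : B *m z = col j (g z).
  pose G : {linear 'cV[C]_r -> 'M[C]_r'} := HB.pack g (GRing.isLinear.Build _ _ _ _ g glin).
  rewrite -[g]/(G : _ -> _) {2}[z]matrix_sum_delta linear_sum.
  apply/colP => i; rewrite !mxE summxE; apply: eq_bigr => l _.
  by rewrite big_ord1 linearZ !mxE mulrC.
exists B.
  by apply: contra_neq xj => B0; rewrite -(guniq v x' Ax) -BE B0 mul0mx.
move=> k Pk; apply/matrixP => i l.
have E : B *m (rho k *m (delta_mx l 0 : 'cV[C]_r)) = rho' k *m (B *m delta_mx l 0).
  rewrite !BE (guniq _ (rho' k *m g (delta_mx l 0))); last first.
    by rewrite -mulmxA; exact: (pairL Pk (gA _)).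
  by rewrite !colE mulmxA.
by move: E; rewrite !mulmxA -!colE => /colP/(_ i); rewrite !mxE.
Qed.

End Characters.
End Representations.

(** * Traces of operators on matrices, and subspaces given by predicates *)

Lemma trace_lin_mx {F : fieldType} m r (A : 'M[F]_m) (B : 'M[F]_r)
    (f : {linear 'M[F]_(m, r) -> 'M[F]_(m, r)}) : (forall X, f X = A *m X *m B) ->
  \tr (lin_mx f) = \tr A * \tr B.
Proof.
move=> fE; rewrite /mxtrace (reindex _ (curry_mxvec_bij m r)) /=.
rewrite (eq_bigr (fun p => lin_mx f (mxvec_index p.1 p.2) (mxvec_index p.1 p.2))); last by case.
rewrite -(pair_bigA _ (fun i j => lin_mx f (mxvec_index i j) (mxvec_index i j))) /=.
rewrite mulr_suml; apply: eq_bigr => i _; rewrite mulr_sumr; apply: eq_bigr => j _.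
have -> : lin_mx f (mxvec_index i j) (mxvec_index i j) = f (delta_mx i j) i j.
  have := mul_vec_lin f (delta_mx i j); rewrite mxvec_delta -rowE => /rowP/(_ (mxvec_index i j)).
  by rewrite mxvecE mxE.
rewrite fE mxE (bigD1 j) //= big1 ?addr0.
  rewrite mxE (bigD1 i) //= big1 ?addr0 ?mxE ?eqxx ?mulr1 //.
  by move=> l li; rewrite mxE (negbTE li) mulr0.
move=> l lj; rewrite mxE big1 ?mul0r // => q _.
by rewrite mxE (negbTE lj) andbF mulr0.
Qed.

(** A vspace of maximal dimension inside L exhausts L. *)
Lemma subspace_vspace {F : fieldType} {W : vectType F} (L : W -> Prop) :
  L 0 -> (forall a u v, L u -> L v -> L (a *: u + v)) ->
  exists U : {vspace W}, forall x, x \in U <-> L x.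
Proof.
move=> L0 Ll.
pose p k := `[< exists2 U : {vspace W}, (forall x, x \in U -> L x) & \dim U = k >].
have p0 : exists k, p k.
  exists 0%N; apply/asboolP; exists 0%VS; last exact: dimv0.
  by move=> x; rewrite memv0 => /eqP ->.
have pb k : p k -> (k <= \dim {:W})%N by move=> /asboolP[U _ <-]; exact/dimvS/subvf.
case: (ex_maxnP p0 pb) => k /asboolP[U UL Uk] maxk.
exists U => x; split; first exact: UL.
move=> Lx; apply: contraT => xU.
have /maxk : p (\dim (U + <[x]>)).
  apply/asboolP; exists (U + <[x]>)%VS => // y /memv_addP[u uU [w /vlineP[a ->] ->]].
  by rewrite addrC; apply: Ll => //; exact: UL.
rewrite -Uk leqNgt => /negP[]; rewrite ltn_neqAle dimvS ?addvSl // andbT.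
apply: contra xU => /eqP dE; have : U == (U + <[x]>)%VS by rewrite eqEdim addvSl dE leqnn.
move=> /eqP ->; apply/memv_addP; exists 0; rewrite ?mem0v //.
by exists x; rewrite ?memv_line ?add0r.
Qed.

(** * Modules of the motion group *)

Lemma lin_mx_conj {F : fieldType} p q p' q' (f : {linear 'M[F]_(p, q) -> 'M[F]_(p, q)})
    (f' : {linear 'M[F]_(p', q') -> 'M[F]_(p', q')}) (g : {linear 'M[F]_(p, q) -> 'M[F]_(p', q')})
    (h : {linear 'M[F]_(p', q') -> 'M[F]_(p, q)}) :
  cancel g h -> cancel h g -> (forall X, g (f X) = f' (g X)) -> \tr (lin_mx f) = \tr (lin_mx f').
Proof.
move=> gh hg gf.
have ext a b (X Y : 'M[F]_(a, b)) : (forall u : 'rV_a, u *m X = u *m Y) -> X = Y.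
  by move=> XY; apply/row_matrixP => i; rewrite !rowE.
have gh1 : lin_mx g *m lin_mx h = 1%:M.
  by apply: ext => u; rewrite -[u]vec_mxK mulmxA !mul_vec_lin /= gh mulmx1.
have hg1 : lin_mx h *m lin_mx g = 1%:M.
  by apply: ext => u; rewrite -[u]vec_mxK mulmxA !mul_vec_lin /= hg mulmx1.
have fg : lin_mx f *m lin_mx g = lin_mx g *m lin_mx f'.
  by apply: ext => u; rewrite -[u]vec_mxK !mulmxA !mul_vec_lin /= gf.
by rewrite -[lin_mx f]mulmx1 -gh1 mulmxA fg -mulmxA mxtrace_mulC -mulmxA hg1 mulmx1.
Qed.

Section Modules.
Context {R : realType} {n : nat} (s : cartan_datum R n).
Local Notation M := 'M[R[i]]_n.+1.
Local Notation K := (cK s).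

Section TraceExtension.
Context {r r' : nat} (a : M -> 'M[R[i]]_r) (a' : M -> 'M[R[i]]_r').
Context (aR : representation K *%R 1 a) (aR' : representation K *%R 1 a').
Context (d : R) (d0 : 0 < d)
  (near : forall k, K k -> nrm (k - 1) < d -> \tr (a k) = \tr (a' k)).

Let W := ('M[R[i]]_r * 'M[R[i]]_r')%type.

Definition trace_agree (e : R) (X : W) : Prop :=
  forall k, K k -> nrm (k - 1) < e -> \tr (X.1 *m a k) = \tr (X.2 *m a' k).

Lemma trace_agreeP e c X Y : trace_agree e X -> trace_agree e Y -> trace_agree e (c *: X + Y).
Proof.
move=> hX hY k Kk ke; have := hX k Kk ke; have := hY k Kk ke.
by rewrite /= !mulmxDl -!scalemxAl !mxtraceD !mxtraceZ => -> ->.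
Qed.

Lemma trace_agree_le e e' X : e' <= e -> trace_agree e X -> trace_agree e' X.
Proof. by move=> ee hX k Kk ke; apply: hX => //; exact: lt_le_trans ee. Qed.

Lemma trace_agree_uniform : exists2 e0 : R, 0 < e0 &
  forall e X, 0 < e -> trace_agree e X -> trace_agree e0 X.
Proof.
have [|c X Y [e1 e10 h1] [e2 e20 h2]|U UP] :=
    @subspace_vspace _ W (fun X => exists2 e, 0 < e & trace_agree e X).
- by exists 1 => // k _ _; rewrite !mul0mx !linear0.
- exists (Num.min e1 e2); first by rewrite lt_min e10 e20.
  by apply: trace_agreeP; [apply: trace_agree_le h1|apply: trace_agree_le h2];
    rewrite ge_min lexx ?orbT.
have [e0 e00 he0] : exists2 e0 : R, 0 < e0 & forall X, X \in (vbasis U : seq W) -> trace_agree e0 X.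
  have : forall X, X \in (vbasis U : seq W) -> exists2 e, 0 < e & trace_agree e X.
    by move=> X /vbasis_mem/UP.
  elim: (vbasis U : seq W) => [|X Xs IH] h; first by exists 1.
  have [e1 e10 h1] := h X (mem_head _ _).
  have [|e2 e20 h2] := IH; first by move=> Y YX; apply: h; rewrite inE YX orbT.
  exists (Num.min e1 e2); first by rewrite lt_min e10 e20.
  move=> Y; rewrite inE => /orP[/eqP ->|/h2 hY].
    by apply: trace_agree_le h1; rewrite ge_min lexx.
  by apply: trace_agree_le hY; rewrite ge_min lexx orbT.
exists e0 => // e X epos hX; have /UP : exists2 e, 0 < e & trace_agree e X by exists e.
move=> /coord_vbasis ->; elim/big_rec: _ => [k _ _|i Y _ hY].
  by rewrite !mul0mx !linear0.
by apply: trace_agreeP => //; apply: he0; rewrite mem_nth // size_tuple.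
Qed.

(* The pairs [X] on which the traces agree near [1] form a finite-dimensional space, hence agree on
   a common neighbourhood; so this space is stable under right multiplication by elements of [K]
   close to [1]. *)
Lemma trace_extension k : K k -> \tr (a k) = \tr (a' k).
Proof.
have [K1 KM KV Ku] := cK_subgroup s.
have [e0 e00 he0] := trace_agree_uniform.
pose L X := exists2 e, 0 < e & trace_agree e X.
have stable w X : K w -> nrm (w - 1) < e0 / 2 -> L X -> L (X.1 *m a w, X.2 *m a' w).
  move=> Kw we [e epos /(he0 _ _ epos) hX].
  have nw : 0 < nrm w + 1 by apply: ltr_wpDl => //; exact: nrm_ge0.
  exists (e0 / 2 / (nrm w + 1)); first by rewrite !divr_gt0.
  move=> l Kl le /=; rewrite -!mulmxA -aR.2 // -aR'.2 //; apply: hX; first exact: KM.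
  have -> : w * l - 1 = w * (l - 1) + (w - 1) by rewrite mulrBr mulr1 addrA subrK.
  apply: le_lt_trans (nrmD _ _) _; rewrite [e0]splitr; apply: ler_ltD => //.
  apply: le_trans (nrmM _ _) _; rewrite mulrC.
  apply: le_trans (_ : nrm (l - 1) * (nrm w + 1) <= _).
    by apply: ler_wpM2l; [exact: nrm_ge0 | rewrite lerDl].
  by rewrite -ler_pdivlMr // ltW.
(* The induction step is an equivalence; its converse multiplies by w^-1, which must also be close
   to 1. *)
have [d1 d10 hd1] : exists2 d1 : R, 0 < d1 & forall w : M, nrm (w - 1) < d1 ->
    nrm (invmx w - 1) < e0 / 2.
  apply/nbhs_nrmP; have u1 : (1 : M) \in unitmx by exact: unitmx1.
  have := tends_invmx u1 (tends_id (1 : M)); rewrite invmx1; apply.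
  by rewrite divr_gt0.
(* The statement propagated is stronger: the traces of a k * a l and a' k * a' l agree for all l
   near 1. The case l = 1 is the claim. *)
move=> Kk; suff [e epos] : L (a k, a' k).
  move=> /(_ 1 K1); rewrite subrr nrm0 /= aR.1 aR'.1 !mulmx1; exact.
move: k Kk; apply: (cK_induction (P := fun k => L (a k, a' k))).
  exists d => // k Kk kd; rewrite /= aR.1 aR'.1 !mul1mx; exact: near.
exists (Num.min d1 (e0 / 2)); first by rewrite lt_min d10 divr_gt0.
move=> g w Kg Kw; rewrite lt_min => /andP[w1 w2]; split=> h.
  by rewrite aR.2 // aR'.2 //; exact: (stable _ (a g, a' g)).
have -> : g = (g * w) * w^-1 by rewrite mulrK //; exact: Ku.
rewrite (aR.2 (g * w)) ?(aR'.2 (g * w)); try exact: KM; try exact: KV.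
exact: (stable w^-1 (a (g * w), a' (g * w)) (KV _ Kw) (hd1 _ w1) h).
Qed.

End TraceExtension.

Section Basis.
Context (V : gK_module s).

Definition comb r (w : 'I_r -> V) (c : 'cV[R[i]]_r) : V := \sum_i c i 0 *: w i.

Lemma comb_linear r (w : 'I_r -> V) x c c' : comb w (x *: c + c') = x *: comb w c + comb w c'.
Proof.
rewrite /comb scaler_sumr -big_split; apply: eq_bigr => i _ /=.
by rewrite !mxE scalerA scalerDl.
Qed.

Lemma comb0 r (w : 'I_r -> V) : comb w 0 = 0.
Proof. by rewrite /comb big1 // => i _; rewrite mxE scale0r. Qed.

Context {r : nat} (w : 'I_r -> V) (a : M -> 'M[R[i]]_r) (wa : affords s (actK V) w a).

Lemma comb_inj : injective (comb w).
Proof.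
move=> c c' E; apply/colP => i; apply/eqP; rewrite -subr_eq0; apply/eqP.
have [free _] := wa; apply: (free (fun i => c i 0 - c' i 0)).
by under eq_bigr => j _ do rewrite scalerBl; rewrite sumrB -/(comb w c) E subrr.
Qed.

Lemma comb_act k c : K k -> actK V k (comb w c) = comb w (a k *m c).
Proof.
move=> Kk; rewrite /comb linear_sum.
under eq_bigr => j _ do rewrite linearZ /= (proj2 wa _ Kk) scaler_sumr.
rewrite exchange_big; apply: eq_bigr => i _ /=; rewrite mxE scaler_suml.
by apply: eq_bigr => j _; rewrite scalerA mulrC.
Qed.

Lemma affords_representation : representation K *%R 1 a.
Proof.
have [K1 _ _ _] := cK_subgroup s.
have ext (A A' : 'M[R[i]]_r) : (forall c : 'cV[R[i]]_r, comb w (A *m c) = comb w (A' *m c)) -> A = A'.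
  move=> h; apply/matrixP => i j; have /comb_inj := h (delta_mx j 0).
  by rewrite -!colE => /colP/(_ i); rewrite !mxE.
split; first by apply: ext => c; rewrite -(comb_act) // actK1 mul1mx.
move=> k l Kk Kl; apply: ext => c; rewrite -mulmxA -!comb_act ?actKM //.
by have [_ + _ _] := cK_subgroup s; apply.
Qed.

End Basis.

Section Irreducible.
Context (V : gK_module s) (Virr : gK_irreducible V).
Context (V0 : forall (X : p0 s) v, actg V (0, X) v = 0).

Lemma actg_split (Z : g0 s) v : actg V Z v = actg V (Z.1, 0) v.
Proof.
have := actgP 1 (Z.1, 0) (0, Z.2) v; rewrite V0 addr0 !scale1r => <-.
by congr (actg V _ v); rewrite -[RHS]/(Z.1 + 0, 0 + Z.2) addr0 add0r; case: Z.
Qed.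

(** A finite-dimensional K-stable subspace is stable under k, which acts by derivatives of the
    matrices of K, and under p_0, which acts by 0; irreducibility then applies. *)
Lemma span_stable r (w : 'I_r -> V) a : affords s (actK V) w a ->
  (exists c, comb w c != 0) -> forall v, exists c, v = comb w c.
Proof.
move=> wa [c0 wc0]; have [_ irr] := Virr.
pose W : set V := [set v | exists c, v = comb w c].
have [W0|WT] : W = [set 0] \/ W = setT.
- apply: irr.
  + by exists 0; rewrite comb0.
  + by move=> x _ _ [c ->] [c' ->]; exists (x *: c + c'); rewrite comb_linear.
  + by move=> k _ Kk [c ->]; exists (a k *m c); rewrite (comb_act wa).
  + move=> Z _ [c ->]; rewrite actg_split /comb linear_sum.
    elim/big_rec: _ => [|i _ _ [c' ->]]; first by exists 0; rewrite comb0.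
    pose D := \col_l ('D_1 (fun t : R[i] => a (expm (t *: vsval Z.1)) l i) 0).
    exists (c i 0 *: D + c'); rewrite comb_linear linearZ /= (actK_differential wa).
    by congr (_ *: _ + _); apply: eq_bigr => l _; rewrite mxE.
- by case/negP: wc0; apply/eqP; have : W (comb w c0) by [exists c0]; rewrite W0.
by move=> v; have : W v by rewrite WT.
Qed.

Lemma irreducible_finite : exists r (w : 'I_r -> V) a, [/\ (0 < r)%N, affords s (actK V) w a &
  forall v, exists c, v = comb w c].
Proof.
have [[v v0] _] := Virr; have [r [w [a [wa _ [c vE]]]]] := actK_finite v.
have vE' : v = comb w (\col_i c i) by rewrite vE; apply: eq_bigr => i _; rewrite mxE.
exists r, w, a; split=> //; last by apply: (span_stable wa); exists (\col_i c i); rewrite -?vE'.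
by rewrite lt0n; apply: contra_neq v0 => r0; rewrite vE; move: (w) (c); rewrite r0 => *; rewrite big_ord0.
Qed.

(** A basis of an invariant subspace of coordinates again affords a matrix representation of K
    inside V, to which [span_stable] applies. *)
Lemma affords_irreducible r (w : 'I_r -> V) a : affords s (actK V) w a -> irreducible K a.
Proof.
move=> wa W Wl Wa [c0 Wc0 c00].
have W0 : W 0 by have := Wl (-1) _ _ Wc0 Wc0; rewrite scaleN1r addNr.
have [U UP] := subspace_vspace W0 Wl.
pose w' (j : 'I_(\dim U)) := comb w (vbasis U)`_j.
pose a' k : 'M[R[i]]_(\dim U) := \matrix_(i, j) coord (vbasis U) i (a k *m (vbasis U)`_j).
have w'E c : \sum_i c i *: w' i = comb w (\sum_i c i *: (vbasis U)`_i).
  elim/big_rec2: _ => [|i u v _ ->]; first by rewrite comb0.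
  by rewrite comb_linear.
have wa' : affords s (actK V) w' a'.
  split=> [c|k Kk j].
    rewrite w'E -(comb0 w) => /(comb_inj wa) E i.
    by have /freeP := basis_free (vbasisP U); apply.
  rewrite w'E /w' (comb_act wa) //; congr comb.
  have : a k *m (vbasis U)`_j \in U.
    by apply/UP/Wa => //; apply/UP/vbasis_mem; rewrite mem_nth // size_tuple.
  by move=> /coord_vbasis {1}->; apply: eq_bigr => i _; rewrite mxE.
have spanW : exists c, comb w' c != 0.
  have /UP/coord_vbasis E := Wc0.
  exists (\col_i coord (vbasis U) i c0); rewrite /comb.
  under eq_bigr => i _ do rewrite mxE.
  by rewrite w'E -E; apply: contra_neq c00; rewrite -(comb0 w) => /(comb_inj wa).
move=> u; have [c E] := span_stable wa' spanW (comb w u).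
move: E; rewrite /comb w'E => /(comb_inj wa) ->; apply/UP.
by apply: memv_suml => i _; apply/memvZ/vbasis_mem; rewrite mem_nth // size_tuple.
Qed.

End Irreducible.
End Modules.

Lemma linear_pack (F : fieldType) (U V : lmodType F) (f : U -> V) : linear f ->
  exists g : {linear U -> V}, forall x, g x = f x.
Proof. move=> fl; pose g : {linear U -> V} := HB.pack f (GRing.isLinear.Build _ _ _ _ f fl).
by exists g. Qed.

Lemma linear_inverse (F : fieldType) (U V : lmodType F) (f : {linear U -> V}) : bijective f ->
  exists g : {linear V -> U}, cancel f g /\ cancel g f.
Proof.
case=> g fg gf; have [|h hE] := @linear_pack F V U g.
  by move=> a x y; apply: (can_inj fg); rewrite gf linearP !gf.
by exists h; split=> x; rewrite hE.
Qed.

(** * Dirac cohomology when p_0 acts by 0 *)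

Section DiracCohomology.
Context {R : realType} {n : nat} (s : cartan_datum R n).
Local Notation M := 'M[R[i]]_n.+1.
Context (beta : M -> M -> R[i]).
Local Notation b := (beta0 (s := s) beta).
Local Notation p0 := (p0 s).
Context (d : nat) (e e' : d.-tuple p0) (m : nat) (S : clifford_module b m).

Section OneModule.
Context (V : gK_module s) (V0 : forall (X : p0) v, actg V (0, X) v = 0).

Lemma dirac_op0 (x : spinors V m) : dirac_op e e' S x = 0.
Proof.
rewrite /dirac_op big1 // => i _; apply/ffunP => j; rewrite !ffunE big1 // => l _.
by rewrite V0 scaler0.
Qed.

Lemma dirac_cohomology_spinors :
  exists j : {linear dirac_cohomology e e' S V -> spinors V m}, bijective j /\
  forall x q, j (dirac_cohomology_act x q) = tensor_op (actK V x.1) (S x.2) (j q).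
Proof.
pose D : {linear spinors V m -> spinors V m} := @dirac_op _ _ s beta d e e' m S V.
have hv (x : spinors V m) : x \in ker_pred D by rewrite inE; apply/eqP; exact: dirac_op0.
(* The image of D is 0, so each class has a single representative. *)
have jpi (y : ker_type D) : val (repr (\pi_(ker_mod_im D)%qT y)) = val y.
  have /lq_eqP : \pi_(ker_mod_im D)%qT (repr (\pi_(ker_mod_im D)%qT y)) = \pi_(ker_mod_im D)%qT y.
    by rewrite reprK.
  move=> /asboolP[z]; rewrite [D z]dirac_op0 raddfB => /esym/eqP.
  by rewrite subr_eq0 => /eqP.
pose j (q : dirac_cohomology e e' S V) : spinors V m := val (repr (q : ker_mod_im D)).
have jl : linear j.
  move=> c q1 q2; rewrite /j -{1}[q1]reprK -{1}[q2]reprK.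
  have -> : c *: \pi_(ker_mod_im D)%qT (repr (q1 : ker_mod_im D)) +
      \pi_(ker_mod_im D)%qT (repr (q2 : ker_mod_im D)) =
      \pi_(ker_mod_im D)%qT (c *: repr (q1 : ker_mod_im D) + repr (q2 : ker_mod_im D)).
    by rewrite -[_ *: _]/(lq_scale _ _) lq_scaleE lq_addE.
  by rewrite jpi linearP.
have [J JE] := linear_pack jl; exists J; split.
  pose i x : ker_type D := exist (fun x => x \in ker_pred D) x (hv x).
  exists (fun x => \pi_(ker_mod_im D)%qT (i x)).
    move=> q; rewrite JE /j.
    have -> : i (val (repr (q : ker_mod_im D))) = repr (q : ker_mod_im D) by exact: val_inj.
    by rewrite reprK.
  by move=> x; rewrite JE /j jpi.
(* Every spinor lies in ker D, so the default of [insubd] does not occur. *)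
by move=> x q; rewrite !JE /j /dirac_cohomology_act /ker_mod_im_map jpi insubdK.
Qed.

End OneModule.

Section TwoModules.
Context (V V' : gK_module s) (V0 : forall (X : p0) v, actg V (0, X) v = 0)
  (V0' : forall (X : p0) v, actg V' (0, X) v = 0).

Lemma spinors_isomorphic : dirac_cohomology_isomorphic e e' S V V' ->
  exists f : {linear spinors V m -> spinors V' m}, bijective f /\
    forall k a x, Ktilde (s := s) (beta := beta) (k, a) ->
      f (tensor_op (actK V k) (S a) x) = tensor_op (actK V' k) (S a) (f x).
Proof.
move=> [f [fb fK]].
have [j [jb jK]] := dirac_cohomology_spinors V0.
have [j' [jb' jK']] := dirac_cohomology_spinors V0'.
have [h [jh hj]] := linear_inverse jb.
have [|F FE] := @linear_pack _ _ _ (fun x => j' (f (h x))).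
  by move=> c x y; rewrite !linearP.
exists F; split.
  apply: (eq_bij (f := j' \o f \o h)); last by move=> x; rewrite FE.
  by apply: bij_comp; [exact: bij_comp | exists j].
move=> k a x ka; rewrite !FE.
have -> : h (tensor_op (actK V k) (S a) x) = dirac_cohomology_act (k, a) (h x).
  by apply: (can_inj jh); rewrite hj jK hj.
by rewrite fK // jK'.
Qed.

End TwoModules.

(** Coordinates on V (x) C^m in which the tensor product action becomes X |-> A X a(k)^T, an
    operator of trace tr A tr a(k) by [trace_lin_mx]. *)
Definition spinor_comb (V : gK_module s) r (w : 'I_r -> V) (X : 'M[R[i]]_(m, r)) : spinors V m :=
  [ffun i => comb w (row i X)^T].

Lemma spinor_comb_linear (V : gK_module s) r (w : 'I_r -> V) : linear (spinor_comb w).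
Proof.
move=> c X Y; apply/ffunP => i; rewrite !ffunE -comb_linear; congr comb.
by rewrite !linearP.
Qed.

Lemma spinor_comb_bij (V : gK_module s) r (w : 'I_r -> V) a : affords s (actK V) w a ->
  (forall v, exists c, v = comb w c) -> bijective (spinor_comb w).
Proof.
move=> wa wV; have [c cE] := choice wV.
exists (fun x : spinors V m => \matrix_i (c (x i))^T) => [X|x].
  apply/row_matrixP => i; rewrite rowK; apply: trmx_inj; rewrite trmxK.
  by apply: (comb_inj wa); rewrite -cE ffunE.
by apply/ffunP => i; rewrite ffunE rowK trmxK -cE.
Qed.

Lemma tensor_op_comb (V : gK_module s) r (w : 'I_r -> V) a k (A : 'M[R[i]]_m) X :
  affords s (actK V) w a -> cK s k ->
  tensor_op (actK V k) A (spinor_comb w X) = spinor_comb w (A *m X *m (a k)^T).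
Proof.
move=> wa Kk; apply/ffunP => i; rewrite !ffunE.
under eq_bigr => j _ do rewrite ffunE (comb_act wa) //.
have -> : (row i (A *m X *m (a k)^T))^T = a k *m \sum_j A i j *: (row j X)^T.
  rewrite row_mul trmx_mul trmxK; congr (_ *m _); apply/colP => l.
  rewrite !mxE summxE; apply: eq_bigr => j _; by rewrite !mxE.
rewrite mulmx_sumr; elim/big_rec2: _ => [|j u v _ ->]; first by rewrite comb0.
by rewrite -scalemxAr comb_linear.
Qed.

(** The factor [\tr A] stays on both sides because it may vanish; f has to intertwine only this one
    pair (k, A). *)
Lemma spinor_trace (V V' : gK_module s) r r' (w : 'I_r -> V) (w' : 'I_r' -> V') a a'
    (f : {linear spinors V m -> spinors V' m}) k (A : 'M[R[i]]_m) :
  affords s (actK V) w a -> (forall v, exists c, v = comb w c) ->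
  affords s (actK V') w' a' -> (forall v, exists c, v = comb w' c) ->
  bijective f -> cK s k ->
  (forall x, f (tensor_op (actK V k) A x) = tensor_op (actK V' k) A (f x)) ->
  \tr A * \tr (a k) = \tr A * \tr (a' k).
Proof.
move=> wa wV wa' wV' fb Kk fA.
have [P PE] := linear_pack (spinor_comb_linear w).
have [P' PE'] := linear_pack (spinor_comb_linear w').
have Pb : bijective P by apply: eq_bij (spinor_comb_bij wa wV) _ _ => x; rewrite PE.
have Pb' : bijective P' by apply: eq_bij (spinor_comb_bij wa' wV') _ _ => x; rewrite PE'.
have [Q [PQ QP]] := linear_inverse Pb.
have [Q' [PQ' QP']] := linear_inverse Pb'.
have [g [fg gf]] := linear_inverse fb.
have [|G GE] := @linear_pack _ _ _ (fun X => Q' (f (P X))); first by move=> c x y; rewrite !linearP.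
have [|H HE] := @linear_pack _ _ _ (fun X => Q (g (P' X))); first by move=> c x y; rewrite !linearP.
rewrite -(mxtrace_tr (a k)) -(mxtrace_tr (a' k)).
rewrite -(trace_lin_mx (f := mulmxr (a k)^T \o mulmx A)) //.
rewrite -(trace_lin_mx (f := mulmxr (a' k)^T \o mulmx A)) //.
apply: (@lin_mx_conj _ _ _ _ _ _ _ G H).
- by move=> X; rewrite HE GE QP' fg PQ.
- by move=> X; rewrite GE HE QP gf PQ'.
move=> X; rewrite !GE /= PE -(tensor_op_comb _ _ wa Kk) fA -PE -[f (P X)]QP'.
by rewrite PE' (tensor_op_comb _ _ wa' Kk) -!PE' !PQ'.
Qed.

End DiracCohomology.

(** * From an intertwiner of K to an isomorphism of modules *)

Section Main.
Context {R : realType} {n : nat} (s : cartan_datum R n).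
Local Notation M := 'M[R[i]]_n.+1.
Local Notation K := (cK s).
Context (V V' : gK_module s).
Context (V0 : forall (X : p0 s) v, actg V (0, X) v = 0)
  (V0' : forall (X : p0 s) v, actg V' (0, X) v = 0).

(** Schur's lemma: the kernel and the image of B are invariant. Equivariance under k follows from
    that under K, since f carries w to a family affording the same matrices, which have the same
    derivatives. *)
Lemma intertwiner_isomorphism r r' (w : 'I_r -> V) (w' : 'I_r' -> V') a a' (B : 'M[R[i]]_(r', r)) :
  affords s (actK V) w a -> (forall v, exists c, v = comb w c) ->
  affords s (actK V') w' a' -> (forall v, exists c, v = comb w' c) ->
  irreducible K a -> irreducible K a' ->
  B != 0 -> (forall k, K k -> B *m a k = a' k *m B) -> gK_isomorphic V V'.
Proof.
move=> wa wV wa' wV' aI aI' B0 Ba.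
have Bk (c : 'cV[R[i]]_r) : B *m c = 0 -> c = 0.
  move=> Bc; apply/eqP; apply: contraT => c0; case/negP: B0; apply/eqP.
  apply/matrixP => i j; rewrite mxE.
  have : B *m (delta_mx j 0 : 'cV[R[i]]_r) = 0.
    apply: (aI (fun c => B *m c = 0)); last by exists c.
    - by move=> x u v u0 v0; rewrite mulmxDr -scalemxAr u0 v0 scaler0 addr0.
    - by move=> k u Kk u0; rewrite mulmxA Ba // -mulmxA u0 mulmx0.
  by rewrite -colE => /colP/(_ i); rewrite !mxE.
have [j Bj] := col_neq0 B0.
have Bs : forall c' : 'cV[R[i]]_r', exists c : 'cV[R[i]]_r, c' = B *m c.
  apply: (aI' (fun c' => exists c : 'cV[R[i]]_r, c' = B *m c)).
  - by move=> x _ _ [u ->] [v ->]; exists (x *: u + v); rewrite mulmxDr scalemxAr.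
  - by move=> k _ Kk [u ->]; exists (a k *m u); rewrite !mulmxA Ba.
  - by exists (col j B) => //; exists (delta_mx j 0); rewrite colE.
have [co coE] := choice wV.
have coK c : co (comb w c) = c by apply: (comb_inj wa); rewrite -coE.
have col_ : linear co by move=> x u v; rewrite {1}(coE u) {1}(coE v) -comb_linear coK.
have [|f fE] := @linear_pack _ _ _ (fun v => comb w' (B *m co v)).
  by move=> x u v; rewrite col_ mulmxDr -scalemxAr comb_linear.
have fi : injective f.
  move=> u v uv; have : f (u - v) = 0 by rewrite linearB uv subrr.
  rewrite fE -(comb0 w') => /(comb_inj wa') /Bk c0; apply/eqP.
  by rewrite -subr_eq0 (coE (u - v)) c0 comb0.
have fb : bijective f.
  have fs v' : exists v, v' = f v.
    have [c' ->] := wV' v'; have [c ->] := Bs c'.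
    by exists (comb w c); rewrite fE coK.
  have [g gE] := choice fs; exists g => // v; first by apply: fi; rewrite -gE.
have fK k v : K k -> f (actK V k v) = actK V' k (f v).
  by move=> Kk; rewrite !fE {1}(coE v) (comb_act wa) // coK (comb_act wa') // mulmxA Ba // mulmxA.
have wfa : affords s (actK V') (f \o w) a.
  have [wfree wact] := wa; split=> [c E i|k Kk l] /=.
    apply: (wfree c); apply: fi; rewrite linear0 -E linear_sum; apply: eq_bigr => l _.
    by rewrite linearZ.
  rewrite -fK // wact // linear_sum; apply: eq_bigr => i _.
  by rewrite linearZ.
exists f; split=> // Z v.
rewrite (actg_split V0) (actg_split V0') (coE v) /comb !linear_sum; apply: eq_bigr => l _.
rewrite !linearZ /=; congr (_ *: _).
rewrite (actK_differential wa) (actK_differential wfa) linear_sum; apply: eq_bigr => i _.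
by rewrite linearZ.
Qed.

End Main.

Theorem theorem2p7p1 (R : realType) (n : nat) (s : cartan_datum R n)
    (beta : 'M[R[i]]_n.+1 -> 'M[R[i]]_n.+1 -> R[i])
    (Hbeta : invariant_form s beta)
    (d : nat) (e e' : d.-tuple (p0 s)) (He : dual_bases beta e e')
    (m : nat) (S0 : clifford_module (beta0 (s := s) beta) m)
    (HS0 : simple_clifford_module S0)
    (V V' : gK_module s) :
  dirac_series e e' S0 V ->
  dirac_series e e' S0 V' ->
  dirac_cohomology_isomorphic e e' S0 V V' ->
  gK_isomorphic V V'.
Proof.
move=> dV dV' HD; have [m0 _] := HS0.
have [B [oB rB pB]] := orthogonal_basis Hbeta.
have V0 := p0_acts_trivially Hbeta He oB rB pB dV.
have V0' := p0_acts_trivially Hbeta He oB rB pB dV'.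
have [Virr _ _] := dV; have [Virr' _ _] := dV'.
have [r [w [a [r0 wa wV]]]] := irreducible_finite Virr V0.
have [r' [w' [a' [r0' wa' wV']]]] := irreducible_finite Virr' V0'.
have [aR aR'] := (affords_representation wa, affords_representation wa').
have [aI aI'] := (affords_irreducible Virr V0 wa, affords_irreducible Virr' V0' wa').
have [f [fb fK]] := spinors_isomorphic V0 V0' HD.
have [dl dl0 lift] := Ktilde_near_1 Hbeta S0 m0 oB pB.
have near k : cK s k -> nrm (k - 1) < dl -> \tr (a k) = \tr (a' k).
  move=> Kk kd; have [x xk tx] := lift k Kk kd; apply: (mulfI tx).
  by apply: (spinor_trace wa wV wa' wV' fb Kk) => y; exact: fK.
have tr := trace_extension aR aR' dl0 near.
have [K1 KM _ _] := cK_subgroup s.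
have [C C0 CE] := character_intertwiner K1 KM aR aI r0 aR' aI' tr.
exact: (intertwiner_isomorphism V0 V0' wa wV wa' wV' aI aI' C0 CE).
Qed.
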